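(* Let $n\ge1$, $a>0$, $I=\left]\phi_{\min};\phi_{\max}\right[$ an open interval and $\widetilde I:=\left]\phi_{\min}-\pi;\phi_{\max}\right[$. Consider the differential equation $$\frac{dY}{dz}=\left(\Lambda(z)+R(z)\right)Y(z),$$ with $\Lambda\in\mathscr O(\mathbb H_{\widetilde I,a};\mathfrak h(n,\mathbb C))$ and $R\in\mathscr O(\mathbb H_{\widetilde I,a};\mathfrak{gl}(n,\mathbb C))$. Assume that $j_o\in\{1,\dots,n\}$ is a subdominant index on $I$ for $\Lambda$ and that $R$ satisfies the S-decay condition on $I$. Then there exists a unique vector solution $y_{j_o}\in\mathscr O(\mathbb H_{\widetilde I,a};\mathbb C^n)$ with asymptotic behaviour $$y_{j_o}(z)=\left(e_{j_o}+o(1)\right)\exp\left(\int_{z_o}^z\Lambda_{j_oj_o}(w)\,dw\right),$$ for any closed interval $\widetilde J\subset\widetilde I$ and $z\to\infty$ in $\mathbb H_{\widetilde J,a}$, where $z_o$ is an arbitrary point of $\mathbb H_{\widetilde I,a}$ and $e_{j_o}$ is the $j_o$-th vector of the standard basis of $\mathbb C^n$.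
   Context: Notation. $\widetilde{\mathbb C^*}$ is the universal cover of $\mathbb C^*$; its points have modulus $|z|>0$ and argument $\arg z\in\mathbb R$. For $\phi\in\mathbb R$, $a>0$, $\mathbb H_{\phi,a}:=\{z\in\widetilde{\mathbb C^*}:\arg z\in\left]\phi-\frac\pi2;\phi+\frac\pi2\right[,\ |z|\ge\frac{a}{\cos(\phi-\arg z)}\}$, and for an interval $I\subseteq\mathbb R$, $\mathbb H_{I,a}:=\bigcup_{\phi\in I}\mathbb H_{\phi,a}$. $\mathfrak h(n,\mathbb C)\subset\mathfrak{gl}(n,\mathbb C)$ are the diagonal matrices; $\mathfrak{gl}(n,\mathbb C)$ carries an arbitrary norm. $\mathscr O(C;V)$ is the space of $V$-valued holomorphic functions on $C$ (if $C$ is not open: on some open set containing $C$). $\|\cdot\|_1$ is the $L^1$-norm with respect to arc length. Curves $\iota^\phi_{a,b}$. Let $\mathbb H_{[\phi],a}:=\mathbb H_{[\phi-\pi,\phi],a}$. For $b\in\mathbb R$, $\iota^\phi_{a,b}\subset\mathbb H_{[\phi],a}$ is the straight line or half-line with support: - if $b\ge a$: $|z|=\frac{b}{\cos(\phi-\arg z)}$, $\phi-\frac\pi2<\arg z<\phi+\frac\pi2$; - if $0<b<a$: $|z|=\frac{b}{\cos(\phi-\arg z)}$, $\phi-\frac\pi2<\arg z\le\phi-\frac\pi2+\sin^{-1}(b/a)$; - if $b=0$: $|z|\ge a$, $\arg z=\phi-\frac\pi2$; - if $-a<b<0$: $|z|=\frac{b}{\cos(\phi-\arg z)}$, $\phi-\frac\pi2+\sin^{-1}(b/a)\le\arg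 z<\phi-\frac\pi2$; - if $b\le-a$: $|z|=\frac{b}{\cos(\phi-\arg z)}$, $\phi-\frac{3\pi}2<\arg z<\phi-\frac\pi2$. Each is oriented so that its tangent at any point is the unit vector of argument $\phi-\frac\pi2$; $w\le z$ on it means $w$ precedes $z$. Subdominant index. $j_o\in\{1,\dots,n\}$ is a subdominant index on $I$ for $\Lambda\in\mathscr O(\mathbb H_{\widetilde I,a};\mathfrak h(n,\mathbb C))$ if for any closed interval $J\subseteq I$ there exists $K_2\in\mathbb R$ such that $$\inf_{\phi\in J}\ \inf_{b\in\mathbb R}\ \inf_{\substack{w\le z\\ w,z\in\iota^\phi_{a,b}}}\operatorname{Re}\int_{w,\iota^\phi_{a,b}}^z(\Lambda_{ii}(t)-\Lambda_{j_oj_o}(t))dt\ge K_2\qquad\forall i\in\{1,\dots,n\}.$$ S-decay condition. $R\in\mathscr O(\mathbb H_{\widetilde I,a};\mathfrak{gl}(n,\mathbb C))$ satisfies the S-decay condition on $I$ if for any closed interval $J\subseteq I$ $$\widetilde M_{R,a,J}:=\sup_{\phi\in J}\sup_{b\in\mathbb R}\|R|_{\iota^\phi_{a,b}}\|_1<+\infty,\qquad \lim_{a\to+\infty}\widetilde M_{R,a,J}=0$$ (in the limit, $a$ is replaced by increasing values and $R$ is restricted accordingly). *)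

(* Defs.v *)
From HB Require Import structures.
From mathcomp Require Import all_boot all_order all_algebra.
From mathcomp Require Import all_classical all_reals all_analysis.
From mathcomp Require Import ring lra.
From mathcomp Require Import complex.

Set Implicit Arguments.
Unset Strict Implicit.
Unset Printing Implicit Defensive.

Import Order.TTheory GRing.Theory Num.Theory.
Import numFieldTopology.Exports numFieldNormedType.Exports.

Local Open Scope classical_set_scope.
Local Open Scope ring_scope.
Local Open Scope complex_scope.

(* A point of the universal cover of C^* is a pair (modulus, argument).  Pairs *)
(* with nonpositive modulus are junk: every set used below consists of pairs   *)
(* with positive modulus.                                                      *)
Notation ucover K := (K * K)%type.

Section Cover.
Context {K : realType}.
Implicit Types (phi a b s t : K) (z : ucover K).

Definition cproj z : K[i] := (z.1 * cos z.2) +i* (z.1 * sin z.2).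

Definition cexp (w : K[i]) : K[i] :=
  (expR (complex.Re w) * cos (complex.Im w))
  +i* (expR (complex.Re w) * sin (complex.Im w)).

Definition Hsector phi a : set (ucover K) :=
  [set z | phi - pi / 2 < z.2 < phi + pi / 2 /\ a / cos (phi - z.2) <= z.1].

Definition Hunion (I : set K) a : set (ucover K) :=
  \bigcup_(phi in I) Hsector phi a.

Definition iota_curve phi a b : set (ucover K) := [set z |
  [\/ [/\ a <= b, phi - pi / 2 < z.2 < phi + pi / 2
        & z.1 = b / cos (phi - z.2)],
      [/\ 0 < b < a, phi - pi / 2 < z.2 <= phi - pi / 2 + asin (b / a)
        & z.1 = b / cos (phi - z.2)]
    | [\/ [/\ b = 0, a <= z.1 & z.2 = phi - pi / 2],
          [/\ - a < b < 0, phi - pi / 2 + asin (b / a) <= z.2 < phi - pi / 2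
            & z.1 = b / cos (phi - z.2)]
        | [/\ b <= - a, phi - 3 * pi / 2 < z.2 < phi - pi / 2
            & z.1 = b / cos (phi - z.2)]]]].

(* Arc-length parametrization of the line carrying [iota_curve phi a b],       *)
(* oriented by the unit tangent e^{i(phi - pi/2)}; see [cproj_line] and        *)
(* [iota_curve_line].                                                          *)
Definition line phi b s : ucover K :=
  if b == 0 then (s, phi - pi / 2)
  else (Num.sqrt (b ^+ 2 + s ^+ 2),
        (if 0 < b then phi else phi - pi) - atan (s / b)).

Lemma cproj_line phi b s :
  cproj (line phi b s) = b%:C * cexp (phi *i) + s%:C * cexp ((phi - pi / 2) *i).
Proof.
rewrite /cproj /line /cexp /= !expR0 !mul1r.
case: eqVneq => [->|b0] /=.
  by apply/eqP; rewrite eq_complex /=; apply/andP; split; apply/eqP; ring.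
set u := s / b.
have su : s = b * u by rewrite /u mulrC divfK.
have q0 : 0 < Num.sqrt (1 + u ^+ 2) by rewrite sqrtr_gt0 ltr_pwDl ?sqr_ge0.
have ca : cos (atan u) * Num.sqrt (1 + u ^+ 2) = 1.
  by rewrite cos_atan mulVf ?gt_eqF.
have sa : sin (atan u) * Num.sqrt (1 + u ^+ 2) = u.
  have c0 : cos (atan u) != 0 by rewrite cos_atan invr_eq0 gt_eqF.
  have -> : sin (atan u) = u * cos (atan u).
    by rewrite -{2}(atanK u) /tan divfK.
  by rewrite -mulrA ca mulr1.
have -> : Num.sqrt (b ^+ 2 + s ^+ 2) = `|b| * Num.sqrt (1 + u ^+ 2).
  rewrite su -sqrtr_sqr -sqrtrM ?sqr_ge0//; congr Num.sqrt; ring.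
rewrite cosBpihalf sinBpihalf cosB sinB.
have [cE sE] : `|b| * cos (if 0 < b then phi else phi - pi) = b * cos phi /\
               `|b| * sin (if 0 < b then phi else phi - pi) = b * sin phi.
  case: ifPn => [b_gt0|]; first by rewrite gtr0_norm.
  rewrite -leNgt => b_le0; rewrite ler0_norm// cosB sinB cospi sinpi.
  by split; ring.
set t := (if _ then _ else _) in cE sE *.
set q := Num.sqrt _ in ca sa *.
apply/eqP; rewrite eq_complex /=; apply/andP; split; apply/eqP.
- transitivity (`|b| * cos t * (cos (atan u) * q)
                + `|b| * sin t * (sin (atan u) * q)); first by ring.
  by rewrite ca sa cE sE su; ring.
- transitivity (`|b| * sin t * (cos (atan u) * q)
                - `|b| * cos t * (sin (atan u) * q)); first by ring.
  by rewrite ca sa cE sE su; ring.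
Qed.

Lemma iota_curve_line phi a b z : 0 < a -> iota_curve phi a b z ->
  exists s, z = line phi b s.
Proof.
move=> a0; have pi0 := pi_gt0 K.
have main : b != 0 ->
    phi - (if 0 < b then 0 else pi) - pi / 2 < z.2
      < phi - (if 0 < b then 0 else pi) + pi / 2 ->
    z.1 = b / cos (phi - z.2) -> exists s, z = line phi b s.
  move=> b0; set t := if 0 < b then phi else phi - pi.
  have -> : phi - (if 0 < b then 0 else pi) = t by rewrite /t; case: ifP; lra.
  move=> tz z1; pose x := t - z.2.
  have xI : - (pi / 2) < x < pi / 2 by rewrite /x; lra.
  have c0 := cos_gt0_pihalf xI.
  exists (b * tan x); rewrite /line (negbTE b0) -/t.
  have -> : b * tan x / b = tan x by rewrite mulrAC divff// mul1r.
  rewrite tanK ?in_itv//.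
  have -> : b ^+ 2 + (b * tan x) ^+ 2 = (b / cos x) ^+ 2.
    by rewrite expr_div_n (cos2_tan2 (lt0r_neq0 c0)); ring.
  rewrite sqrtr_sqr normrM normfV (gtr0_norm c0).
  case: z z1 {tz} @x xI c0 => r th /= -> _ c0.
  congr pair; last by ring.
  rewrite /t; case: ifPn => [b_gt0|]; first by rewrite gtr0_norm.
  rewrite -leNgt => b_le0; rewrite ler0_norm//.
  have -> : phi - pi - th = phi - th - pi by ring.
  by rewrite [cos (_ - pi)]cosB cospi sinpi mulr0 addr0 mulrN1 invrN mulrNN.
move=> [[ab zI z1]|[bI zI z1]|[[b0 az zI]|[bI zI z1]|[ab zI z1]]].
- have b0 : 0 < b by exact: lt_le_trans ab.
  by apply: main => //; rewrite ?gt_eqF// b0; lra.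
- have [b0 ba] := andP bI.
  have : asin (b / a) <= pi / 2.
    apply: asin_lepi2; rewrite ler_pdivrMr// mul1r (ltW ba) andbT.
    by apply: le_trans (lerN10 _) _; rewrite divr_ge0 ?ltW.
  by move=> ?; apply: main => //; rewrite ?gt_eqF// b0; lra.
- exists z.1; rewrite /line b0 eqxx -zI; by case: (z).
- have [ab b0] := andP bI.
  have : - (pi / 2) <= asin (b / a).
    apply: asin_geNpi2; rewrite ler_pdivlMr// mulN1r (ltW ab)/=.
    by apply: le_trans ler01; rewrite pmulr_lle0 ?invr_gt0 ?ltW.
  by move=> ?; apply: main => //; rewrite ?lt_eqF// (lt_gtF b0); lra.
- have b0 : b < 0 by lra.
  apply: main => //; rewrite ?lt_eqF// (lt_gtF b0); lra.
Qed.

(* The integral of f along g : [s, t] -> cover, with respect to the coordinate *)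
(* cproj on the cover.                                                         *)
Definition path_int (f : ucover K -> K[i]) (g : K -> ucover K) s t : K[i] :=
  let h x := f (g x) * (derive1 (fun x => complex.Re (cproj (g x))) x
                        +i* derive1 (fun x => complex.Im (cproj (g x))) x) in
  (\int[lebesgue_measure]_(x in `[s, t]) complex.Re (h x))
  +i* (\int[lebesgue_measure]_(x in `[s, t]) complex.Im (h x)).

(* A C^1 path on [0, 1], given as the restriction of a C^1 map on the whole    *)
(* line; (modulus, argument) are global smooth coordinates on the cover.       *)
Definition C1_path (D : set (ucover K)) (z0 z1 : ucover K) (g : K -> ucover K) :=
  [/\ [/\ forall x, derivable (fst \o g) x 1, continuous (derive1 (fst \o g)),
          forall x, derivable (snd \o g) x 1 & continuous (derive1 (snd \o g))],
      g 0 = z0, g 1 = z1 & forall x, 0 <= x <= 1 -> D (g x)].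

End Cover.

Section Analysis.
Context {K : realType}.

(* Complex derivative with respect to the local coordinate cproj; the type     *)
(* K[i]^o is K[i] with its norm topology.                                      *)
Definition is_cderive m n (f : ucover K -> 'M[K[i]]_(m, n)) (z : ucover K)
    (d : 'M[K[i]]_(m, n)) : Prop :=
  ((cproj w - cproj z)^-1 *: (f w - f z) : 'M[K[i]^o]_(m, n)) @[w --> z^']
    --> (d : 'M[K[i]^o]_(m, n)).

Definition holomorphic_on m n (D : set (ucover K))
    (f : ucover K -> 'M[K[i]]_(m, n)) : Prop :=
  exists U : set (ucover K),
    [/\ open U, D `<=` U, U `<=` [set z | 0 < z.1]
      & forall z, U z -> exists d, is_cderive f z d].

Definition is_norm n (N : 'M[K[i]]_n -> K) : Prop :=
  [/\ forall A B, N (A + B) <= N A + N B,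
      forall (c : K[i]) A, (N (c *: A))%:C = `|c| * (N A)%:C
    & forall A, N A = 0 -> A = 0].

Definition subdominant n (I : set K) (a : K) (Lambda : ucover K -> 'M[K[i]]_n)
    (jo : 'I_n) : Prop :=
  forall c d : K, c <= d -> `[c, d] `<=` I ->
  exists K2 : K, forall i phi b s t, c <= phi <= d -> s <= t ->
    iota_curve phi a b (line phi b s) -> iota_curve phi a b (line phi b t) ->
    K2 <= complex.Re (path_int (fun w => Lambda w i i - Lambda w jo jo)
                       (line phi b) s t).

Definition L1_iota n (N : 'M[K[i]]_n -> K) (R : ucover K -> 'M[K[i]]_n)
    (phi a b : K) : \bar K :=
  (\int[lebesgue_measure]_(s in [set s | iota_curve phi a b (line phi b s)])
     (N (R (line phi b s)))%:E)%E.

Definition Mtilde n (N : 'M[K[i]]_n -> K) (R : ucover K -> 'M[K[i]]_n) (a : K)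
    (J : set K) : \bar K :=
  ereal_sup [set L1_iota N R phi a b | phi in J & b in [set: K]].

Definition S_decay n (N : 'M[K[i]]_n -> K) (I : set K) (a : K)
    (R : ucover K -> 'M[K[i]]_n) : Prop :=
  forall c d : K, c <= d -> `[c, d] `<=` I ->
    (Mtilde N R a `[c, d] < +oo)%E /\
    Mtilde N R a' `[c, d] @[a' --> +oo] --> 0%E.

Definition solution_on n (D : set (ucover K)) (A : ucover K -> 'M[K[i]]_n)
    (y : ucover K -> 'cV[K[i]]_n) : Prop :=
  forall z, D z -> is_cderive y z (A z *m y z).

Definition vanishes_at_infinity n (D : set (ucover K))
    (u : ucover K -> 'cV[K[i]]_n) : Prop :=
  forall e : K, 0 < e -> exists M : K, forall z, D z -> M < z.1 ->
    forall k, `|u z k 0| < e%:C.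

(* As the domain is simply connected the integral of a holomorphic function    *)
(* from z0 to z is the integral along any path: the equation is required for   *)
(* all of them.                                                                *)
Definition has_asymptotics n (It : set K) (a : K) (z0 : ucover K)
    (lambda : ucover K -> K[i]) (e : 'cV[K[i]]_n) (y : ucover K -> 'cV[K[i]]_n)
    : Prop :=
  exists u : ucover K -> 'cV[K[i]]_n,
    (forall c d : K, c <= d -> `[c, d] `<=` It ->
       vanishes_at_infinity (Hunion `[c, d] a) u) /\
    (forall z g, C1_path (Hunion It a) z0 z g ->
       y z = cexp (path_int lambda g 0 1) *: (e + u z)).

End Analysis.

(* Main.v *)
(* Write a solution as [y = exp (int Lambda_jj) u], with [j = jo].  Along a curve iota^phi_{a,b} the vector [u] satisfies
   a Volterra equation, integrated backwards from a point [t] of the curve; its propagators [exp (int (Lambda_jj - Lambda_ii))]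
   are bounded because [jo] is subdominant, and its kernel is small for large [a] by S-decay.  Hence [u] at earlier
   points is controlled by [u t], and is close to [e_j] if [u t = e_j].  Two consequences:
   - a solution whose [u] tends to 0 along the ray [arg z = phi - pi/2] (the curve with [b = 0]) vanishes, which gives
     uniqueness;
   - the solutions with [u = e_j] at the point of modulus [T] of that ray converge as [T] tends to infinity.
   Let [y^phi] be the limit.  A far away point [z] with [phi - 3pi/2 < arg z < phi + pi/2], outside a strip around the
   rest of the line, is joined to the point of modulus [T] by a segment of a line of direction tending to that of
   [phi] as [T] grows, so the [u] of [y^phi] is close to [e_j] at [z].  This applies to points of the ray of [phi'] when
   [phi'] is close to [phi], so by uniqueness [y^phi] does not depend on [phi]; adapting [phi] to [arg z] then gives
   the asymptotics in all of the sector.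
   Solutions exist globally by Picard iteration, using primitives on the simply connected domain (Goursat's lemma in
   polar coordinates). *)
Require Import Defs.
From HB Require Import structures.
From mathcomp Require Import all_boot all_order all_algebra.
From mathcomp Require Import all_classical all_reals all_analysis.
From mathcomp Require Import measurable_realfun complex ring lra.

Set Implicit Arguments.
Unset Strict Implicit.
Unset Printing Implicit Defensive.

Import Order.TTheory GRing.Theory Num.Theory.
Import numFieldTopology.Exports numFieldNormedType.Exports.

Local Open Scope classical_set_scope.
Local Open Scope ring_scope.
Local Open Scope complex_scope.
Import ComplexField.Normc.

(** The Volterra equation is only used on compact segments, with prescribed value at the far end,
    and the limit is taken in the finite-dimensional space of solutions. So no fixed point on an
    unbounded curve is needed, and holomorphy of the limit is that of a solution with given initial
    value. A line passing closer to the origin than [a] is cut by the disc, and only what follows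
    the disc is available. This is the origin of the strip, and the reason for adapting the
    direction to the point: the curves of one direction phi cover angles of total width 2 pi,
    whereas the sector reaches from phimin - 3pi/2 to phimax + pi/2. Holomorphy on the sector means
    holomorphy on some open neighbourhood of arbitrary shape. The equation is solved on a domain D
    inside it that is stable under moving radially outwards, where points are joined by arcs of
    large modulus. Moduli are measured by the real-valued [normc], which keeps all estimates in the
    ordered field K. *)

Section ComplexBasics.
Context {K : realType}.
Implicit Types (x y : K[i]) (e : K).

Lemma normc_ge0 x : 0 <= normc x.
Proof. by case: x => a b; rewrite /normc sqrtr_ge0. Qed.

Lemma normcD x y : normc (x + y) <= normc x + normc y.
Proof. exact: le_normcD. Qed.

Lemma normcB x y : normc (x - y) <= normc x + normc y.
Proof. by rewrite -[normc y](normcN y); exact: normcD. Qed.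

Lemma normc_subC x y : normc (x - y) = normc (y - x).
Proof. by rewrite -[LHS](@normcN K) opprB. Qed.

Lemma normcB_tri x y z : normc (x - z) <= normc (x - y) + normc (y - z).
Proof. by apply: le_trans (normcD _ _); rewrite addrA subrK. Qed.

Lemma normc_real (a : K) : normc a%:C = `|a|.
Proof. by rewrite /normc/= expr0n/= addr0 sqrtr_sqr. Qed.

Lemma normc_Re x : `|complex.Re x| <= normc x.
Proof.
by case: x => a b; rewrite /normc -sqrtr_sqr ler_wsqrtr// lerDl sqr_ge0.
Qed.

Lemma normc_Im x : `|complex.Im x| <= normc x.
Proof.
by case: x => a b; rewrite /normc -sqrtr_sqr ler_wsqrtr// lerDr sqr_ge0.
Qed.

Lemma normc_le_ReIm x : normc x <= `|complex.Re x| + `|complex.Im x|.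
Proof.
case: x => a b /=; rewrite -[leRHS]ger0_norm ?addr_ge0// -sqrtr_sqr.
apply: ler_wsqrtr; rewrite sqrrD !real_normK ?num_real// addrAC lerDl.
by rewrite mulrn_wge0// mulr_ge0.
Qed.

Lemma normc_eq0 x : normc x = 0 -> x = 0.
Proof. exact: eq0_normc. Qed.

Lemma normc_sum (I : Type) (r : seq I) (P : pred I) (F : I -> K[i]) :
  normc (\sum_(i <- r | P i) F i) <= \sum_(i <- r | P i) normc (F i).
Proof.
elim/big_rec2: _ => [|i a b Pi h]; first by rewrite normc0.
by apply: le_trans (normcD _ _) _; rewrite lerD2l.
Qed.

Lemma normc_small x : (forall e, 0 < e -> normc x <= e) -> x = 0.
Proof.
move=> h; apply: normc_eq0; apply/eqP; rewrite eq_le normc_ge0 andbT.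
by apply/ler_addgt0Pl => e e0; rewrite addr0 h.
Qed.

Lemma normc_cexp x : normc (cexp x) = expR (complex.Re x).
Proof.
rewrite /cexp /normc !exprMn -mulrDr cos2Dsin2 mulr1 sqrtr_sqr.
by rewrite ger0_norm ?expR_ge0.
Qed.

Lemma cexpD x y : cexp (x + y) = cexp x * cexp y.
Proof.
case: x y => a b [c d]; apply/eqP; rewrite eq_complex /= expRD cosD sinD.
by apply/andP; split; apply/eqP; ring.
Qed.

Lemma cexp0 : cexp 0 = 1 :> K[i].
Proof. by rewrite /cexp/= expR0 cos0 sin0 mulr1 mulr0. Qed.

Lemma cexpN_mul x : cexp (- x) * cexp x = 1.
Proof. by rewrite -cexpD addNr cexp0. Qed.

Lemma Re_prod x y :
  complex.Re (x * y) = complex.Re x * complex.Re y - complex.Im x * complex.Im y.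
Proof. by case: x y => a b [c d]. Qed.

Lemma Im_prod x y :
  complex.Im (x * y) = complex.Re x * complex.Im y + complex.Im x * complex.Re y.
Proof. by case: x y => a b [c d]. Qed.

Lemma ReD x y : complex.Re (x + y) = complex.Re x + complex.Re y.
Proof. by case: x y => a b [c d]. Qed.

Lemma ImD x y : complex.Im (x + y) = complex.Im x + complex.Im y.
Proof. by case: x y => a b [c d]. Qed.

Lemma ReN x : complex.Re (- x) = - complex.Re x.
Proof. by case: x. Qed.

Lemma ImN x : complex.Im (- x) = - complex.Im x.
Proof. by case: x. Qed.

Lemma eqc x y :
  complex.Re x = complex.Re y -> complex.Im x = complex.Im y -> x = y.
Proof. by case: x y => a b [c d] /= -> ->. Qed.

End ComplexBasics.

(** * Derivatives of complex functions of a real variable *)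

Section RealDerivative.
Context {K : realType}.

(** The inequality is trivial at t = x, so this Landau form needs no punctured neighbourhood.
    Derivatives along curves and on the cover are put in the same form, which makes them easy to
    combine. *)
Lemma is_derive_eps (f : K -> K) (x d : K) : is_derive x (1 : K) f d <->
  forall e : K, 0 < e ->
    \forall t \near x, `|f t - f x - d * (t - x)| <= e * `|t - x|.
Proof.
pose q h := h^-1 *: ((f \o shift x) (h *: 1) - f x).
have qE h : h != 0 -> d - q h = - h^-1 * (f (h + x) - f x - d * h).
  move=> h0; rewrite /q /= /GRing.scale/= mulr1.
  by rewrite /q /= /GRing.scale/= ?mulr1; field.
have -> : is_derive x (1 : K) f d <-> q h @[h --> 0^'] --> d.
  split=> [[h1 <-]|h]; first exact: h1.
  by split; [apply/cvg_ex; exists d|exact/cvg_lim].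
split=> [/cvgrPdist_le h e e0|h].
  have /nbhs_ballP[r /= r0 hr] := h _ e0.
  apply/nbhs_ballP; exists r => //= t; rewrite /ball/= distrC => tr.
  have [->|tx] := eqVneq t x; first by rewrite !subrr mulr0 subrr normr0 mulr0.
  have tx0 : t - x != 0 by rewrite subr_eq0.
  have := hr (t - x); rewrite /ball/= sub0r normrN => /(_ tr tx0).
  rewrite qE// subrK normrM normrN normfV mulrC ler_pdivrMr ?normr_gt0//.
apply/cvgrPdist_le => e e0.
have /nbhs_ballP[r /= r0 hr] := h _ e0.
apply/nbhs_ballP; exists r => //= t; rewrite /ball/= sub0r normrN => tr t0.
have := hr (t + x); rewrite /ball/= opprD addrCA subrr addr0 normrN => /(_ tr).
rewrite addrK qE// normrM normrN normfV => h'.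
by rewrite mulrC ler_pdivrMr ?normr_gt0.
Qed.

(** Taken by components, so that the instances for real derivatives compute it; [hasdP] gives the
    form used in estimates. *)
Definition hasd (f : K -> K[i]) (x : K) (d : K[i]) : Prop :=
  is_derive x 1 (fun t => complex.Re (f t)) (complex.Re d) /\
  is_derive x 1 (fun t => complex.Im (f t)) (complex.Im d).

Lemma hasdP (f : K -> K[i]) x d : hasd f x d <->
  forall e : K, 0 < e ->
    \forall t \near x, normc (f t - f x - d * (t - x)%:C) <= e * `|t - x|.
Proof.
split=> [[/is_derive_eps hR /is_derive_eps hI] e e0|h].
  have e20 : 0 < e / 2 by rewrite divr_gt0.
  near=> t.
  have t1 : `|complex.Re (f t) - complex.Re (f x) - complex.Re d * (t - x)|
    <= e / 2 * `|t - x| by near: t; exact: hR.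
  have t2 : `|complex.Im (f t) - complex.Im (f x) - complex.Im d * (t - x)|
    <= e / 2 * `|t - x| by near: t; exact: hI.
  apply: le_trans (normc_le_ReIm _) _.
  rewrite !(ReD, ReN, ImD, ImN, Re_prod, Im_prod)/= !(mulr0, subr0, add0r).
  by lra.
split; apply/is_derive_eps => e e0; apply: filterS (h _ e0) => t; apply: le_trans.
  apply: le_trans (normc_Re _).
  by rewrite !(ReD, ReN, ImD, ImN, Re_prod, Im_prod)/= !(mulr0, subr0, add0r).
apply: le_trans (normc_Im _).
by rewrite !(ReD, ReN, ImD, ImN, Re_prod, Im_prod)/= !(mulr0, subr0, add0r).
Unshelve. all: by end_near. Qed.

Lemma hasd_cst (c : K[i]) x : hasd (fun=> c) x 0.
Proof. by split=> /=; exact: is_derive_cst. Qed.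

Lemma hasd_eq (f : K -> K[i]) x d d' : hasd f x d -> d = d' -> hasd f x d'.
Proof. by move=> h <-. Qed.

Lemma hasd_ext (f g : K -> K[i]) x d : f =1 g -> hasd f x d -> hasd g x d.
Proof. by move=> /funext ->. Qed.

Lemma hasdD (f g : K -> K[i]) x d d' : hasd f x d -> hasd g x d' ->
  hasd (fun t => f t + g t) x (d + d').
Proof.
move=> [f1 f2] [g1 g2]; split.
  by under eq_fun do rewrite ReD; rewrite ReD; exact: is_deriveD.
by under eq_fun do rewrite ImD; rewrite ImD; exact: is_deriveD.
Qed.

Lemma hasdN (f : K -> K[i]) x d : hasd f x d -> hasd (fun t => - f t) x (- d).
Proof.
move=> [f1 f2]; split.
  by under eq_fun do rewrite ReN; rewrite ReN; exact: is_deriveN.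
by under eq_fun do rewrite ImN; rewrite ImN; exact: is_deriveN.
Qed.

Lemma hasdB (f g : K -> K[i]) x d d' : hasd f x d -> hasd g x d' ->
  hasd (fun t => f t - g t) x (d - d').
Proof. by move=> hf hg; apply: hasdD => //; exact: hasdN. Qed.

Lemma hasdM (f g : K -> K[i]) x d d' : hasd f x d -> hasd g x d' ->
  hasd (fun t => f t * g t) x (d * g x + f x * d').
Proof.
move=> [f1 f2] [g1 g2]; split.
  under eq_fun do rewrite Re_prod.
  apply: is_derive_eq; rewrite ReD !Re_prod /GRing.scale/=; ring.
under eq_fun do rewrite Im_prod.
apply: is_derive_eq; rewrite ImD !Im_prod /GRing.scale/=; ring.
Qed.

Lemma hasdZ (c : K[i]) (f : K -> K[i]) x d : hasd f x d ->
  hasd (fun t => c * f t) x (c * d).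
Proof.
by move=> hf; apply: hasd_eq (hasdM (hasd_cst c x) hf) _; rewrite mul0r add0r.
Qed.

Lemma hasd_cexp (f : K -> K[i]) x d : hasd f x d ->
  hasd (fun t => cexp (f t)) x (d * cexp (f x)).
Proof.
move=> [f1 f2]; split => /=.
  apply: is_derive_eq; rewrite Re_prod /GRing.scale/=; ring.
apply: is_derive_eq; rewrite Im_prod /GRing.scale/=; ring.
Qed.

Lemma hasd_real (c : K[i]) (x0 x : K) : hasd (fun t => (t - x0)%:C * c) x c.
Proof.
split.
  under eq_fun do rewrite Re_prod/= mul0r subr0.
  by apply: is_derive_eq; rewrite /GRing.scale/=; ring.
under eq_fun do rewrite Im_prod/= mul0r addr0.
by apply: is_derive_eq; rewrite /GRing.scale/=; ring.
Qed.

(* Apply the real mean value theorem to [Re (c^* (f t - f s))], where [c] is the direction of [f t - f s]. *)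
Lemma mean_value_le (f : K -> K[i]) (g : K -> K) (df : K -> K[i]) (dg : K -> K) s t :
  s <= t ->
  (forall x, s <= x <= t -> hasd f x (df x)) ->
  (forall x, s <= x <= t -> is_derive x 1 g (dg x)) ->
  (forall x, s <= x <= t -> normc (df x) <= dg x) ->
  normc (f t - f s) <= g t - g s.
Proof.
move=> st hf hg hfg.
set v := f t - f s.
have key (a b : K) : a ^+ 2 + b ^+ 2 <= 1 ->
    a * complex.Re v + b * complex.Im v <= g t - g s.
  move=> ab.
  pose h x := g x - a * complex.Re (f x) - b * complex.Im (f x).
  have hd x : s <= x <= t -> is_derive x 1 h
      (dg x - a * complex.Re (df x) - b * complex.Im (df x)).
    move=> xI; have [h1 h2] := hf _ xI; have h3 := hg _ xI.
    by rewrite /h; apply: is_derive_eq; rewrite /GRing.scale/=; ring.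
  suff : h s <= h t by rewrite /h /v ReD ReN ImD ImN; lra.
  have [||c cI] := @MVT_segment _ h
    (fun x => dg x - a * complex.Re (df x) - b * complex.Im (df x)) _ _ st.
  - by move=> x; rewrite in_itv/= => /andP[/ltW sx /ltW xt]; apply: hd; rewrite sx.
  - apply: derivable_within_continuous => x; rewrite in_itv/= => xI.
    by have [] := hd _ xI.
  move=> E; rewrite -subr_ge0 E mulr_ge0 ?subr_ge0//.
  have cI' : s <= c <= t by move: cI; rewrite in_itv.
  have := hfg _ cI'; set w := df c => hw.
  have hw0 := normc_ge0 w.
  have : a * complex.Re w + b * complex.Im w <= normc w.
    rewrite -[leLHS]/(_); apply: le_trans (ler_norm _) _.
    rewrite -sqrtr_sqr; case: (w) => p q /=; apply: ler_wsqrtr.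
    have := mulr_ge0 (sqr_ge0 (a * q - b * p)) ler01.
    have : 0 <= (p ^+ 2 + q ^+ 2) * (1 - (a ^+ 2 + b ^+ 2)).
      by apply: mulr_ge0; [rewrite addr_ge0 ?sqr_ge0|rewrite subr_ge0].
    lra.
  lra.
have [v0|v0] := eqVneq (normc v) 0.
  by rewrite v0; have := key 0 0; rewrite expr0n/= addr0 !mul0r addr0; apply.
have E : (normc v) ^+ 2 = (complex.Re v) ^+ 2 + (complex.Im v) ^+ 2.
  by case: (v) => p q; rewrite /= sqr_sqrtr// addr_ge0 ?sqr_ge0.
have := key (complex.Re v / normc v) (complex.Im v / normc v).
rewrite !expr_div_n -mulrDl -E divff ?expf_neq0// lexx => /(_ isT).
rewrite mulrAC -expr2 [X in _ + X]mulrAC -expr2 -mulrDl -E expr2 mulfK//.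
Qed.

Lemma mean_value_cst (f : K -> K[i]) (df : K -> K[i]) B s t :
  s <= t ->
  (forall x, s <= x <= t -> hasd f x (df x)) ->
  (forall x, s <= x <= t -> normc (df x) <= B) ->
  normc (f t - f s) <= B * (t - s).
Proof.
move=> st hf hB; rewrite mulrBr.
apply: (@mean_value_le f (fun x => B * x) df (fun=> B)) => // x _.
by apply: is_derive_eq; rewrite /GRing.scale/=; ring.
Qed.

Lemma hasd0_cst (f : K -> K[i]) s t : s <= t ->
  (forall x, s <= x <= t -> hasd f x 0) -> f t = f s.
Proof.
move=> st hf; apply/eqP; rewrite -subr_eq0; apply/eqP; apply: normc_small => e e0.
apply: le_trans (ltW e0); rewrite -[leRHS](mul0r (t - s)).
by apply: (@mean_value_cst _ (fun=> 0)) => // x _; rewrite normc0.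
Qed.

End RealDerivative.

(** * Continuity of complex-valued functions *)

Section ComplexContinuity.
Context {K : realType} {T : topologicalType}.
Implicit Types (f g : T -> K[i]) (x : T).

Definition ccont f x : Prop :=
  forall e : K, 0 < e -> \forall w \near x, normc (f w - f x) <= e.

Lemma ccont_cst (c : K[i]) x : ccont (fun=> c) x.
Proof. by move=> e e0; near=> w; rewrite subrr normc0 ltW. Unshelve. all: by end_near. Qed.

Lemma ccontD f g x : ccont f x -> ccont g x -> ccont (fun t => f t + g t) x.
Proof.
move=> hf hg e e0; have e2 : 0 < e / 2 by rewrite divr_gt0.
near=> w; rewrite opprD addrACA (le_trans (normcD _ _))// (splitr e) lerD//.
  by near: w; exact: hf.
by near: w; exact: hg.
Unshelve. all: by end_near. Qed.

Lemma ccont_bnd f x : ccont f x ->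
  \forall w \near x, normc (f w) <= normc (f x) + 1.
Proof.
move=> /(_ 1 ltr01); apply: filterS => w h.
have := normcD (f w - f x) (f x); rewrite subrK; lra.
Qed.

Lemma ccontM f g x : ccont f x -> ccont g x -> ccont (fun t => f t * g t) x.
Proof.
move=> hf hg e e0.
have p0 : 0 < normc (f x) + 1 by rewrite ltr_wpDl ?normc_ge0.
have q0 : 0 < normc (g x) + 1 by rewrite ltr_wpDl ?normc_ge0.
have e1 : 0 < e / 2 / (normc (f x) + 1) by rewrite !divr_gt0.
have e2 : 0 < e / 2 / (normc (g x) + 1) by rewrite !divr_gt0.
near=> w.
have -> : f w * g w - f x * g x = f w * (g w - g x) + (f w - f x) * g x by ring.
rewrite (le_trans (normcD _ _))// !normcM (splitr e); apply: lerD.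
  rewrite -[leRHS](@divfK _ (normc (f x) + 1)) ?gt_eqF// mulrC.
  apply: ler_pM; rewrite ?normc_ge0//.
    by near: w; exact: hg.
  by near: w; exact: ccont_bnd.
rewrite -[leRHS](@divfK _ (normc (g x) + 1)) ?gt_eqF//.
apply: ler_pM; rewrite ?normc_ge0//; last by rewrite lerDl.
by near: w; exact: hf.
Unshelve. all: by end_near. Qed.

Lemma ccontN f x : ccont f x -> ccont (fun t => - f t) x.
Proof. by move=> hf e /hf; apply: filterS => w; rewrite -opprD normcN. Qed.

Lemma ccontB f g x : ccont f x -> ccont g x -> ccont (fun t => f t - g t) x.
Proof. by move=> hf hg; apply: ccontD => //; exact: ccontN. Qed.

Lemma ccont_sum (I : Type) (r : seq I) (f : I -> T -> K[i]) x :
  (forall i, ccont (f i) x) -> ccont (fun t => \sum_(i <- r) f i t) x.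
Proof.
move=> h; elim: r => [|i r IH].
  have -> : (fun t => \sum_(i <- [::]) f i t) = fun=> 0.
    by apply/funext => t; rewrite big_nil.
  exact: ccont_cst.
have -> : (fun t => \sum_(j <- i :: r) f j t) =
   fun t => f i t + \sum_(j <- r) f j t by apply/funext => t; rewrite big_cons.
exact: ccontD.
Qed.

Lemma ccontP f x : ccont f x <->
  {for x, continuous (fun t => complex.Re (f t))} /\
  {for x, continuous (fun t => complex.Im (f t))}.
Proof.
split=> [h|[/cvgrPdist_le hR /cvgrPdist_le hI] e e0].
  split; apply/cvgrPdist_le => e /h; apply: filterS => w; apply: le_trans;
    rewrite normc_subC; [apply: le_trans (normc_Re _)|apply: le_trans (normc_Im _)].
    by rewrite ReD ReN.
  by rewrite ImD ImN.
have e2 : 0 < e / 2 by rewrite divr_gt0.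
near=> w; apply: le_trans (normc_le_ReIm _) _.
rewrite (splitr e) ReD ImD ReN ImN lerD// distrC.
  by near: w; exact: hR.
by near: w; exact: hI.
Unshelve. all: by end_near. Qed.

Lemma ccont_normc f x : ccont f x -> {for x, continuous (fun t => normc (f t))}.
Proof.
move=> h; apply/cvgrPdist_le => e /h; apply: filterS => w; apply: le_trans.
rewrite ler_norml; apply/andP; split.
  have := normcD (f w - f x) (f x); rewrite subrK; lra.
have := normcD (f x - f w) (f w); rewrite subrK normc_subC; lra.
Qed.

End ComplexContinuity.

Lemma ccont_comp {K : realType} {S T : topologicalType} (f : T -> K[i])
    (g : S -> T) (y : S) :
  {for y, continuous g} -> ccont f (g y) -> ccont (fun t => f (g t)) y.
Proof. by move=> cg cf e /cf; exact: cg. Qed.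

(** * Integrals over a real segment, defined by antiderivatives *)

Section CurveIntegral.
Context {K : realType}.
Implicit Types (h H : K -> K[i]) (s t : K).

Lemma hasd_ccont h (x : K) d : hasd h x d -> ccont h x.
Proof.
by move=> [h1 h2]; apply/ccontP; split; apply: differentiable_continuous;
  apply/derivable1_diffP; [case: h1|case: h2].
Qed.

Lemma real_antiderivative (f : K -> K) s t : s <= t -> continuous f ->
  exists F : K -> K, forall x, s <= x <= t -> is_derive x (1 : K) F (f x).
Proof.
move=> st cf; exists (fun y => \int[lebesgue_measure]_(u in `[s - 1, y]) f u)%R.
move=> x /andP[sx xt].
have := @continuous_FTC1_closed K f (s - 1) x (t + 1).
move=> /(_ ltac:(lra)) d.
have [||d1] := d _ _ (cf x).
- by apply: continuous_compact_integrable;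
    [exact: segment_compact|exact: continuous_subspaceT].
- lra.
by rewrite derive1E => d2; exact: DeriveDef d1 d2.
Qed.

Lemma antiderivative h s t : s <= t ->
  (forall x, s <= x <= t -> ccont h x) ->
  exists H, forall x, s <= x <= t -> hasd H x (h x).
Proof.
move=> st ch.
(* Clamping to [s, t] extends h to a function that is continuous on the whole line and unchanged on
   the segment. *)
pose c (x : K) := Num.max s (Num.min t x).
have cI x : s <= c x <= t by rewrite /c le_max lexx/= ge_max st ge_min lexx.
have cc : continuous c.
  move=> x; apply: continuous_max; first exact: cst_continuous.
  by apply: continuous_min; [exact: cst_continuous|exact: cvg_id].
have cid x : s <= x <= t -> c x = x.
  by move=> /andP[sx xt]; rewrite /c (min_idPr xt) (max_idPr sx).
have chc x : ccont (h \o c) x by exact: (ccont_comp (cc x) (ch _ (cI x))).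
have [|F hF] := @real_antiderivative (fun x => complex.Re (h (c x))) s t st.
  by move=> x; have /ccontP[] := chc x.
have [|G hG] := @real_antiderivative (fun x => complex.Im (h (c x))) s t st.
  by move=> x; have /ccontP[] := chc x.
exists (fun x => F x +i* G x) => x xI.
by have := hF x xI; have := hG x xI; rewrite cid.
Qed.

Definition between s t (x : K) := Num.min s t <= x <= Num.max s t.

Lemma betweenC s t x : between s t x = between t s x.
Proof. by rewrite /between minC maxC. Qed.

Lemma between_le s t x : s <= t -> between s t x = (s <= x <= t).
Proof. by move=> st; rewrite /between (min_idPl st) (max_idPr st). Qed.

Lemma betweenl s t : between s t s.
Proof. by rewrite /between ge_min le_max lexx. Qed.

Lemma betweenr s t : between s t t.
Proof. by rewrite /between ge_min le_max lexx !orbT. Qed.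

Lemma between_in lo hi s t x :
  lo <= s <= hi -> lo <= t <= hi -> between s t x -> lo <= x <= hi.
Proof.
move=> /andP[s1 s2] /andP[t1 t2] /andP[x1 x2]; apply/andP; split.
  by apply: le_trans x1; rewrite le_min s1.
by apply: le_trans x2 _; rewrite ge_max s2.
Qed.

(** The integral is the increment of a chosen antiderivative, hence 0 if there is none. The order of
    s and t is free, so reversing a path is a change of sign. *)
Definition cint h s t : K[i] :=
  let H := xget (fun=> 0) [set H | forall x, between s t x -> hasd H x (h x)] in
  H t - H s.

Lemma cintE h H s t : (forall x, between s t x -> hasd H x (h x)) ->
  cint h s t = H t - H s.
Proof.
move=> hH; rewrite /cint; case: xgetP => [G _ hG|/(_ H)]; last by [].
have hd x : between s t x -> hasd (fun y => G y - H y) x 0.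
  by move=> xI; rewrite -(subrr (h x)); apply: hasdB; [exact: hG|exact: hH].
have E : G t - H t = G s - H s.
  have [st|ts] := leP s t.
    by apply: (@hasd0_cst _ (fun y => G y - H y)) => // x xI; apply: hd; rewrite between_le.
  apply/esym; apply: (@hasd0_cst _ (fun y => G y - H y)); first exact: ltW.
  by move=> x xI; apply: hd; rewrite betweenC between_le// ltW.
have -> : G t = H t + (G s - H s) by rewrite -E addrC subrK.
by ring.
Qed.

Lemma antiderivative_between h s t : (forall x, between s t x -> ccont h x) ->
  exists H, forall x, between s t x -> hasd H x (h x).
Proof.
move=> ch; have [||H hH] := @antiderivative h (Num.min s t) (Num.max s t).
  by rewrite ge_min !le_max !lexx ?orbT.
  exact: ch.
by exists H.
Qed.

Lemma cint_chasles h lo hi r s t : (forall x, lo <= x <= hi -> ccont h x) ->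
  lo <= r <= hi -> lo <= s <= hi -> lo <= t <= hi ->
  cint h r s + cint h s t = cint h r t.
Proof.
move=> ch rI sI tI.
have lohi : lo <= hi by case/andP: rI; exact: le_trans.
have [H hH] := antiderivative lohi ch.
rewrite !(@cintE h H); first by ring.
all: by move=> x xI; apply: hH; apply: between_in xI.
Qed.

Lemma cint_refl h s : cint h s s = 0.
Proof. by rewrite /cint subrr. Qed.

Lemma cintC h s t : cint h t s = - cint h s t.
Proof.
rewrite /cint; under eq_set do under eq_forall do rewrite betweenC.
by rewrite opprB.
Qed.

Lemma cintB h g s t : (forall x, between s t x -> ccont h x) ->
  (forall x, between s t x -> ccont g x) ->
  cint (fun x => h x - g x) s t = cint h s t - cint g s t.
Proof.
move=> /antiderivative_between[H hH] /antiderivative_between[G hG].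
rewrite (cintE hH) (cintE hG) (@cintE _ (fun x => H x - G x)); first by ring.
by move=> x xI; apply: hasdB; [exact: hH|exact: hG].
Qed.

Lemma cint_norm h s t B : (forall x, between s t x -> ccont h x) ->
  (forall x, between s t x -> normc (h x) <= B) ->
  normc (cint h s t) <= B * `|t - s|.
Proof.
move=> /antiderivative_between[H hH] hB; rewrite (cintE hH).
have [st|ts] := leP s t.
  rewrite ger0_norm ?subr_ge0//.
  by apply: (@mean_value_cst _ _ h) => // x xI; [apply: hH|apply: hB];
    rewrite between_le.
rewrite normc_subC ltr0_norm ?subr_lt0// opprB.
have tsW := ltW ts.
by apply: (@mean_value_cst _ _ h) => // x xI; [apply: hH|apply: hB];
    rewrite betweenC between_le.
Qed.

End CurveIntegral.

(** * Polar coordinates on the cover *)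

Section Cover.
Context {K : realType}.
Implicit Types (z w : ucover K) (r y : K).

Definition cis y : K[i] := cos y +i* sin y.

(** This is i times [cis y], the derivative of [cis]. *)
Definition ciscis y : K[i] := (- sin y) +i* cos y.

Lemma normc_cis y : normc (cis y) = 1.
Proof. by rewrite /cis /normc cos2Dsin2 sqrtr1. Qed.

Lemma normc_ciscis y : normc (ciscis y) = 1.
Proof. by rewrite /ciscis /normc sqrrN addrC cos2Dsin2 sqrtr1. Qed.

Lemma cprojE z : cproj z = z.1%:C * cis z.2.
Proof. by apply: eqc; rewrite ?Re_prod ?Im_prod/=; ring. Qed.

Lemma hasd_cis y : hasd cis y (ciscis y).
Proof. by split; rewrite /cis /ciscis /=; exact: _. Qed.

Lemma hasd_ciscis y : hasd ciscis y (- cis y).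
Proof. by split; rewrite /cis /ciscis /=; exact: _. Qed.

Lemma hasd_cproj1 r y : hasd (fun x => cproj (x, y)) r (cis y).
Proof.
apply: hasd_ext (hasd_real (cis y) 0 r) => x.
by rewrite cprojE subr0.
Qed.

Lemma hasd_cproj2 r y : hasd (fun x => cproj (r, x)) y (r%:C * ciscis y).
Proof.
by apply: hasd_ext (hasdZ r%:C (hasd_cis y)) => x; rewrite cprojE.
Qed.

Lemma cis_lip y y' : normc (cis y' - cis y) <= `|y' - y|.
Proof.
wlog yy : y y' / y <= y'.
  by move=> H; have [/H//|/ltW/H] := leP y y'; rewrite normc_subC distrC.
rewrite ger0_norm ?subr_ge0// -[leRHS]mul1r.
apply: (@mean_value_cst _ _ ciscis) => // x _; first exact: hasd_cis.
by rewrite normc_ciscis.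
Qed.

Lemma cproj_le z w :
  normc (cproj w - cproj z) <= `|w.1 - z.1| + `|z.1| * `|w.2 - z.2|.
Proof.
have -> : cproj w - cproj z =
    (w.1 - z.1)%:C * cis w.2 + z.1%:C * (cis w.2 - cis z.2).
  by rewrite !cprojE rmorphB/=; ring.
apply: le_trans (normcD _ _) _; rewrite !normcM !normc_real normc_cis mulr1.
by rewrite lerD2l ler_wpM2l// cis_lip.
Qed.

Lemma sin_near_ge : \forall x \near (0 : K), `|x| / 2 <= `|sin x|.
Proof.
have /is_derive_eps := is_derive_sin (0 : K).
rewrite cos0 sin0 => /(_ (1 / 2)) /(_ ltac:(lra)).
apply: filterS => x; rewrite !subr0 mul1r => h.
have := ler_normD (x - sin x) (sin x); rewrite subrK distrC; lra.
Qed.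

Lemma near_fst (P : K -> Prop) z : (\forall r \near z.1, P r) ->
  \forall w \near z, P w.1.
Proof. exact: cvg_fst. Qed.

Lemma near_snd (P : K -> Prop) z : (\forall r \near z.2, P r) ->
  \forall w \near z, P w.2.
Proof. exact: cvg_snd. Qed.

(** By the law of cosines the squared distance is (w.1 - z.1)^2 + 4 w.1 z.1 sin^2 of half the angle.
    Near z the modulus w.1 exceeds z.1 / 2 and a small sine is at least half its argument; 4 is
    large enough to absorb these losses. It turns errors in polar coordinates into errors relative
    to the local coordinate [cproj]. *)
Lemma cproj_ge z : 0 < z.1 -> \forall w \near z,
  `|w.1 - z.1| + z.1 * `|w.2 - z.2| <= 4 * normc (cproj w - cproj z).
Proof.
move=> z0.
have h1 : \forall w \near z, z.1 / 2 < w.1.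
  by apply: (@near_fst (fun r => z.1 / 2 < r)); apply: lt_nbhsr; lra.
have h2 : \forall w \near z, `|(w.2 - z.2) / 2| / 2 <= `|sin ((w.2 - z.2) / 2)|.
  apply: (@near_snd (fun y => `|(y - z.2) / 2| / 2 <= `|sin ((y - z.2) / 2)|)).
  have c : (y - z.2) / 2 @[y --> z.2] --> (0 : K).
    rewrite -[X in _ --> X](mul0r 2^-1) -(subrr z.2).
    by apply: cvgMl; apply: cvgB; [exact: cvg_id|exact: cvg_cst].
  exact: (c _ sin_near_ge).
near=> w.
have w1 : z.1 / 2 < w.1 by near: w.
have w2 : `|(w.2 - z.2) / 2| / 2 <= `|sin ((w.2 - z.2) / 2)| by near: w.
have E : normc (cproj w - cproj z) ^+ 2 =
    (w.1 - z.1) ^+ 2 + 4 * (w.1 * z.1) * sin ((w.2 - z.2) / 2) ^+ 2.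
  have -> : normc (cproj w - cproj z) ^+ 2 =
      (w.1 * cos w.2 - z.1 * cos z.2) ^+ 2 + (w.1 * sin w.2 - z.1 * sin z.2) ^+ 2.
    by rewrite /cproj/= sqr_sqrtr// addr_ge0 ?sqr_ge0.
  have c2 : 2 * sin ((w.2 - z.2) / 2) ^+ 2 = 1 - cos (w.2 - z.2).
    rewrite {2}[w.2 - z.2](_ : _ = ((w.2 - z.2) / 2) *+ 2); last by rewrite mulr2n; field.
    by rewrite cos_mulr2n sin2cos2 mulr2n; ring.
  have -> : 4 * (w.1 * z.1) * sin ((w.2 - z.2) / 2) ^+ 2 =
    2 * (w.1 * z.1) * (2 * sin ((w.2 - z.2) / 2) ^+ 2) by ring.
  rewrite c2 cosB.
  have h3 := cos2Dsin2 w.2; have h4 := cos2Dsin2 z.2.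
  transitivity (w.1 ^+ 2 * (cos w.2 ^+ 2 + sin w.2 ^+ 2) +
    z.1 ^+ 2 * (cos z.2 ^+ 2 + sin z.2 ^+ 2)
    - 2 * (w.1 * z.1) * (cos w.2 * cos z.2 + sin w.2 * sin z.2)); first by ring.
  by rewrite h3 h4; ring.
set p := `|w.1 - z.1|; set q := `|w.2 - z.2|.
have p0 : 0 <= p by rewrite /p.
have q0 : 0 <= q by rewrite /q.
have q2 : q ^+ 2 / 16 <= sin ((w.2 - z.2) / 2) ^+ 2.
  rewrite -[leRHS]real_normK ?num_real//.
  have -> : q ^+ 2 / 16 = (`|(w.2 - z.2) / 2| / 2) ^+ 2.
    by rewrite normrM -/q (@ger0_norm _ 2^-1) ?invr_ge0//; field.
  by rewrite ler_pXn2r// ?nnegrE ?divr_ge0.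
have p2 : p ^+ 2 = (w.1 - z.1) ^+ 2 by rewrite /p real_normK ?num_real.
rewrite -(@ler_pXn2r _ 2)// ?nnegrE; last 2 first.
  by rewrite addr_ge0// mulr_ge0// ltW.
  by rewrite mulr_ge0// normc_ge0.
rewrite exprMn E -p2.
have : (p + z.1 * q) ^+ 2 <= 2 * (p ^+ 2 + z.1 ^+ 2 * q ^+ 2).
  by rewrite -subr_ge0 (_ : _ - _ = (p - z.1 * q) ^+ 2) ?sqr_ge0//; ring.
move=> /le_trans; apply.
have : z.1 ^+ 2 / 2 * (q ^+ 2 / 16) <= w.1 * z.1 * sin ((w.2 - z.2) / 2) ^+ 2.
  apply: ler_pM => //; rewrite ?divr_ge0 ?sqr_ge0//.
  have : 0 <= (w.1 - z.1 / 2) * z.1 by rewrite mulr_ge0 ?ltW// subr_gt0.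
  lra.
have := sqr_ge0 p; lra.
Unshelve. all: by end_near. Qed.

Lemma cproj_neq z : 0 < z.1 -> \forall w \near z, w != z -> cproj w != cproj z.
Proof.
move=> z0; apply: filterS (cproj_ge z0) => w h; apply: contraNneq => E.
move: h; rewrite E subrr normc0 mulr0.
have := normr_ge0 (w.1 - z.1); have := mulr_ge0 (ltW z0) (normr_ge0 (w.2 - z.2)).
move=> a b c; have /eqP : `|w.1 - z.1| = 0 by lra.
have : z.1 * `|w.2 - z.2| = 0 by lra.
rewrite normr_eq0 subr_eq0 => /eqP; rewrite mulf_eq0 gt_eqF//= normr_eq0 subr_eq0.
move=> /eqP E2 /eqP E1; apply/eqP.
by rewrite [w]surjective_pairing [z]surjective_pairing E1 E2.
Qed.

End Cover.

(** * Complex derivatives on the cover *)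

Section CoverDerivative.
Context {K : realType}.
Implicit Types (f g : ucover K -> K[i]) (z w : ucover K).

(** The scalar form of [is_cderive], without quotient; [is_cderive_cd] relates the two. *)
Definition cd f z (d : K[i]) : Prop := forall e : K, 0 < e -> \forall w \near z,
  normc (f w - f z - d * (cproj w - cproj z)) <= e * normc (cproj w - cproj z).

Lemma ccont_cproj z : ccont cproj z.
Proof.
move=> e e0; have z0 : 0 < `|z.1| + 1 by rewrite ltr_wpDl.
have e1 : 0 < e / 2 / (`|z.1| + 1) by rewrite !divr_gt0.
have h1 : \forall w \near z, `|w.1 - z.1| <= e / 2.
  apply: (@near_fst _ (fun r => `|r - z.1| <= e / 2)).
  by apply/nbhs_ballP; exists (e / 2); rewrite /= ?divr_gt0// => y /ltW; rewrite distrC.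
have h2 : \forall w \near z, `|w.2 - z.2| <= e / 2 / (`|z.1| + 1).
  apply: (@near_snd _ (fun r => `|r - z.2| <= e / 2 / (`|z.1| + 1))).
  by apply/nbhs_ballP; exists (e / 2 / (`|z.1| + 1)) => // y /ltW; rewrite distrC.
near=> w; apply: le_trans (cproj_le _ _) _; rewrite (splitr e); apply: lerD.
  by near: w.
rewrite -[leRHS](@divfK _ (`|z.1| + 1)) ?gt_eqF// mulrC; apply: ler_pM => //.
  by near: w.
by rewrite lerDl.
Unshelve. all: by end_near. Qed.

Lemma cd_ccont f z d : cd f z d -> ccont f z.
Proof.
move=> h e e0; have d0 : 0 < normc d + 1 by rewrite ltr_wpDl ?normc_ge0.
have e1 : 0 < e / (normc d + 1) by rewrite divr_gt0.
near=> w.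
have h1 : normc (cproj w - cproj z) <= e / (normc d + 1).
  by near: w; exact: ccont_cproj.
have h2 : normc (f w - f z - d * (cproj w - cproj z)) <= 1 * normc (cproj w - cproj z).
  by near: w; exact: h.
have := normcD (f w - f z - d * (cproj w - cproj z)) (d * (cproj w - cproj z)).
rewrite subrK normcM => h3.
have : (normc d + 1) * normc (cproj w - cproj z) <= e.
  by rewrite mulrC -ler_pdivlMr.
lra.
Unshelve. all: by end_near. Qed.

Lemma cd_cst c z : cd (fun=> c) z 0.
Proof.
move=> e e0; near=> w; rewrite subrr mul0r subrr normc0.
by rewrite mulr_ge0 ?normc_ge0 ?ltW.
Unshelve. all: by end_near. Qed.

Lemma cd_cproj z : cd cproj z 1.
Proof.
move=> e e0; near=> w; rewrite mul1r subrr normc0.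
by rewrite mulr_ge0 ?normc_ge0 ?ltW.
Unshelve. all: by end_near. Qed.

Lemma cd_eq f z d d' : cd f z d -> d = d' -> cd f z d'.
Proof. by move=> h <-. Qed.

Lemma cdD f g z d d' : cd f z d -> cd g z d' -> cd (fun w => f w + g w) z (d + d').
Proof.
move=> hf hg e e0; have e2 : 0 < e / 2 by rewrite divr_gt0.
near=> w.
have -> : f w + g w - (f z + g z) - (d + d') * (cproj w - cproj z) =
  (f w - f z - d * (cproj w - cproj z)) + (g w - g z - d' * (cproj w - cproj z)).
  by ring.
apply: le_trans (normcD _ _) _; rewrite (splitr e) mulrDl; apply: lerD.
  by near: w; exact: hf.
by near: w; exact: hg.
Unshelve. all: by end_near. Qed.

Lemma cdM f g z d d' : cd f z d -> cd g z d' ->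
  cd (fun w => f w * g w) z (d * g z + f z * d').
Proof.
move=> hf hg e e0.
have p1 : 0 < normc (g z) + 1 by rewrite ltr_wpDl ?normc_ge0.
have p2 : 0 < normc d + 1 by rewrite ltr_wpDl ?normc_ge0.
have p3 : 0 < normc (f z) + 1 by rewrite ltr_wpDl ?normc_ge0.
have e1 : 0 < e / 3 / (normc (g z) + 1) by rewrite !divr_gt0.
have e2 : 0 < e / 3 / (normc d + 1) by rewrite !divr_gt0.
have e3 : 0 < e / 3 / (normc (f z) + 1) by rewrite !divr_gt0.
have cg := cd_ccont hg.
near=> w; set D := cproj w - cproj z.
have h1 : normc (f w - f z - d * D) <= e / 3 / (normc (g z) + 1) * normc D.
  by rewrite /D; near: w; exact: hf.
have h2 : normc (g w - g z) <= e / 3 / (normc d + 1) by near: w; exact: cg.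
have h3 : normc (g w - g z - d' * D) <= e / 3 / (normc (f z) + 1) * normc D.
  by rewrite /D; near: w; exact: hg.
have h4 : normc (g w) <= normc (g z) + 1 by near: w; exact: (ccont_bnd cg).
have -> : f w * g w - f z * g z - (d * g z + f z * d') * D =
  (f w - f z - d * D) * g w + d * D * (g w - g z) + f z * (g w - g z - d' * D).
  by ring.
have D0 := normc_ge0 D.
have t1 : normc ((f w - f z - d * D) * g w) <= e / 3 * normc D.
  rewrite normcM (le_trans (ler_pM _ _ h1 h4)) ?normc_ge0//.
  by rewrite mulrAC divfK ?gt_eqF.
have t2 : normc (d * D * (g w - g z)) <= e / 3 * normc D.
  rewrite !normcM mulrAC; apply: ler_wpM2r => //.
  rewrite -[leRHS](@divfK _ (normc d + 1)) ?gt_eqF// mulrC.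
  by apply: ler_pM; rewrite ?normc_ge0// lerDl.
have t3 : normc (f z * (g w - g z - d' * D)) <= e / 3 * normc D.
  have E : (normc (f z) + 1) * (e / 3 / (normc (f z) + 1) * normc D) = e / 3 * normc D.
    by rewrite mulrA mulrCA divff ?gt_eqF// mulr1.
  by rewrite normcM -E; apply: ler_pM; rewrite ?normc_ge0// lerDl.
have u1 := normcD ((f w - f z - d * D) * g w + d * D * (g w - g z)) (f z * (g w - g z - d' * D)).
have u2 := normcD ((f w - f z - d * D) * g w) (d * D * (g w - g z)).
lra.
Unshelve. all: by end_near. Qed.

Lemma cdN f z d : cd f z d -> cd (fun w => - f w) z (- d).
Proof.
move=> h e /h; apply: filterS => w.
by rewrite mulNr -!opprD normcN.
Qed.

Lemma cdB f g z d d' : cd f z d -> cd g z d' -> cd (fun w => f w - g w) z (d - d').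
Proof. by move=> hf hg; apply: cdD => //; exact: cdN. Qed.

Lemma cdZ c f z d : cd f z d -> cd (fun w => c * f w) z (c * d).
Proof. by move=> hf; apply: cd_eq (cdM (cd_cst c z) hf) _; rewrite mul0r add0r. Qed.

Lemma cd_sum (I : Type) (r : seq I) (f : I -> ucover K -> K[i]) z d :
  (forall i, cd (f i) z (d i)) ->
  cd (fun w => \sum_(i <- r) f i w) z (\sum_(i <- r) d i).
Proof.
move=> h; elim: r => [|i r IH].
  have -> : (fun w => \sum_(i <- [::]) f i w) = fun=> 0.
    by apply/funext => t; rewrite big_nil.
  by rewrite big_nil; exact: cd_cst.
have -> : (fun t => \sum_(j <- i :: r) f j t) =
   fun t => f i t + \sum_(j <- r) f j t by apply/funext => t; rewrite big_cons.
by rewrite big_cons; exact: cdD.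
Qed.

Lemma cd_chain f (g : K -> ucover K) x d v :
  {for x, continuous g} -> hasd (fun t => cproj (g t)) x v -> cd f (g x) d ->
  hasd (fun t => f (g t)) x (d * v).
Proof.
move=> cg /hasdP hv hf; apply/hasdP => e e0.
have v0 : 0 < normc v + 1 by rewrite ltr_wpDl ?normc_ge0.
have d0 : 0 < normc d + 1 by rewrite ltr_wpDl ?normc_ge0.
have e1 : 0 < e / 2 / (normc v + 1) by rewrite !divr_gt0.
have e2 : 0 < e / 2 / (normc d + 1) by rewrite !divr_gt0.
have hf' := cg _ (hf _ e1).
near=> t; set D := cproj (g t) - cproj (g x).
have h1 : normc (f (g t) - f (g x) - d * D) <= e / 2 / (normc v + 1) * normc D.
  by rewrite /D; near: t; exact: hf'.
have h2 : normc (D - v * (t - x)%:C) <= e / 2 / (normc d + 1) * `|t - x|.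
  by rewrite /D; near: t; exact: hv.
have h3 : normc (D - v * (t - x)%:C) <= 1 * `|t - x| by rewrite /D; near: t; exact: hv.
have h4 : normc D <= (normc v + 1) * `|t - x|.
  have := normcD (D - v * (t - x)%:C) (v * (t - x)%:C).
  rewrite subrK normcM normc_real; lra.
have -> : f (g t) - f (g x) - d * v * (t - x)%:C =
  (f (g t) - f (g x) - d * D) + d * (D - v * (t - x)%:C) by ring.
apply: le_trans (normcD _ _) _; rewrite (splitr e) mulrDl; apply: lerD.
  apply: le_trans h1 (le_trans (ler_wpM2l (ltW e1) h4) _).
  by rewrite mulrA divfK ?gt_eqF.
rewrite normcM -[e / 2](@divfK _ (normc d + 1)) ?gt_eqF// mulrAC mulrC.
by rewrite ler_pM ?normc_ge0// lerDl.
Unshelve. all: by end_near. Qed.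

Lemma cont_pair1 (y x : K) : {for x, continuous (fun t : K => (t, y) : ucover K)}.
Proof. by apply: (@cvg_pair _ _ _ _ (nbhs x) (nbhs y)); [exact: cvg_id|exact: cvg_cst]. Qed.

Lemma cont_pair2 (x y : K) : {for y, continuous (fun t : K => (x, t) : ucover K)}.
Proof. by apply: (@cvg_pair _ _ _ _ (nbhs x) (nbhs y)); [exact: cvg_cst|exact: cvg_id]. Qed.

Lemma cd_hasd1 f z d : cd f z d -> hasd (fun x => f (x, z.2)) z.1 (d * cis z.2).
Proof.
case: z => x y /= h.
by apply: (@cd_chain f (fun t => (t, y))) => //; [exact: cont_pair1|exact: hasd_cproj1].
Qed.

Lemma cd_hasd2 f z d :
  cd f z d -> hasd (fun y => f (z.1, y)) z.2 (d * (z.1%:C * ciscis z.2)).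
Proof.
case: z => x y /= h.
by apply: (@cd_chain f (fun t => (x, t))) => //; [exact: cont_pair2|exact: hasd_cproj2].
Qed.

End CoverDerivative.

(** * Circulation around polar rectangles *)

Section Rectangles.
Context {K : realType}.
Implicit Types (f g F : ucover K -> K[i]) (z w : ucover K) (r s x y : K).

(** Integrals of f dz in polar coordinates: dz is [cis y] dx on a ray and, in [Iv], x [ciscis t] dt
    on an arc of radius x. The circulation [rect] combines two of each. *)
Definition Ih f y r s := cint (fun x => f (x, y) * cis y) r s.

Definition Iv f x y y' := cint (fun t => f (x, t) * (x%:C * ciscis t)) y y'.

Definition rect f r s y y' := Ih f y r s + Iv f s y y' - Ih f y' r s - Iv f r y y'.

Definition inrect r s y y' z := between r s z.1 && between y y' z.2.

Lemma ccont_h f y x : ccont f (x, y) -> ccont (fun t => f (t, y) * cis y) x.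
Proof.
move=> cf; apply: ccontM; last exact: ccont_cst.
exact: (ccont_comp (cont_pair1 (y := y) (x := x))).
Qed.

Lemma ccont_v f x y : ccont f (x, y) -> ccont (fun t => f (x, t) * (x%:C * ciscis t)) y.
Proof.
move=> cf; apply: ccontM; first exact: (ccont_comp (cont_pair2 (x := x) (y := y))).
by apply: ccontM; [exact: ccont_cst|exact: hasd_ccont (hasd_ciscis y)].
Qed.

Lemma Ih_exact F f y r s : (forall x, between r s x -> cd F (x, y) (f (x, y))) ->
  Ih f y r s = F (s, y) - F (r, y).
Proof. by move=> h; apply: (@cintE _ _ (fun x => F (x, y))) => x /h /cd_hasd1. Qed.

Lemma Iv_exact F f x y y' : (forall t, between y y' t -> cd F (x, t) (f (x, t))) ->
  Iv f x y y' = F (x, y') - F (x, y).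
Proof. by move=> h; apply: (@cintE _ _ (fun t => F (x, t))) => t /h /cd_hasd2. Qed.

Lemma rect_exact F f r s y y' : (forall z, inrect r s y y' z -> cd F z (f z)) ->
  rect f r s y y' = 0.
Proof.
move=> h; rewrite /rect !(Ih_exact (F := F)) ?(Iv_exact (F := F)); first by ring.
all: move=> x xI; apply: h; by rewrite /inrect/= ?xI ?betweenl ?betweenr.
Qed.

Lemma Ih_norm f y r s B : (forall x, between r s x -> ccont f (x, y)) ->
  (forall x, between r s x -> normc (f (x, y)) <= B) ->
  normc (Ih f y r s) <= B * `|s - r|.
Proof.
move=> cf hB; apply: cint_norm => x xI; first by apply: ccont_h; exact: cf.
by rewrite normcM normc_cis mulr1 hB.
Qed.

Lemma Iv_norm f x y y' B : (forall t, between y y' t -> ccont f (x, t)) ->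
  (forall t, between y y' t -> normc (f (x, t)) <= B) ->
  normc (Iv f x y y') <= B * `|x| * `|y' - y|.
Proof.
move=> cf hB; apply: cint_norm => t tI; first by apply: ccont_v; exact: cf.
by rewrite !normcM normc_ciscis mulr1 normc_real ler_wpM2r ?hB.
Qed.

Lemma IhB f g y r s : (forall x, between r s x -> ccont f (x, y)) ->
  (forall x, between r s x -> ccont g (x, y)) ->
  Ih (fun w => f w - g w) y r s = Ih f y r s - Ih g y r s.
Proof.
move=> cf cg; rewrite -cintB => [||x /cg]; last exact: ccont_h.
  by congr cint; apply/funext => x; rewrite mulrBl.
by move=> x /cf; exact: ccont_h.
Qed.

Lemma IvB f g x y y' : (forall t, between y y' t -> ccont f (x, t)) ->
  (forall t, between y y' t -> ccont g (x, t)) ->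
  Iv (fun w => f w - g w) x y y' = Iv f x y y' - Iv g x y y'.
Proof.
move=> cf cg; rewrite -cintB => [||t /cg]; last exact: ccont_v.
  by congr cint; apply/funext => t; rewrite mulrBl.
by move=> t /cf; exact: ccont_v.
Qed.

Lemma rectB f g r s y y' : (forall z, inrect r s y y' z -> ccont f z) ->
  (forall z, inrect r s y y' z -> ccont g z) ->
  rect (fun w => f w - g w) r s y y' = rect f r s y y' - rect g r s y y'.
Proof.
move=> cf cg; rewrite /rect !IhB ?IvB; first by ring.
all: move=> x xI; by [apply: cf; rewrite /inrect/= ?xI ?betweenl ?betweenr
  |apply: cg; rewrite /inrect/= ?xI ?betweenl ?betweenr].
Qed.

Lemma rect_norm f r s y y' B M : (forall z, inrect r s y y' z -> ccont f z) ->
  (forall z, inrect r s y y' z -> normc (f z) <= B) ->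
  `|r| <= M -> `|s| <= M ->
  normc (rect f r s y y') <= 2 * B * (`|s - r| + M * `|y' - y|).
Proof.
move=> cf hB rM sM.
have B0 : 0 <= B.
  apply: le_trans (normc_ge0 (f (r, y))) (hB _ _).
  by rewrite /inrect/= ?betweenl ?betweenr.
have h1 : normc (Ih f y r s) <= B * `|s - r|.
  by apply: Ih_norm => x xI; [apply: cf|apply: hB]; rewrite /inrect/= ?xI ?betweenl ?betweenr.
have h2 : normc (Ih f y' r s) <= B * `|s - r|.
  by apply: Ih_norm => x xI; [apply: cf|apply: hB]; rewrite /inrect/= ?xI ?betweenl ?betweenr.
have h3 : normc (Iv f s y y') <= B * `|s| * `|y' - y|.
  by apply: Iv_norm => x xI; [apply: cf|apply: hB]; rewrite /inrect/= ?xI ?betweenl ?betweenr.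
have h4 : normc (Iv f r y y') <= B * `|r| * `|y' - y|.
  by apply: Iv_norm => x xI; [apply: cf|apply: hB]; rewrite /inrect/= ?xI ?betweenl ?betweenr.
have h5 : B * `|s| * `|y' - y| <= B * M * `|y' - y| by rewrite ler_wpM2r// ler_wpM2l.
have h6 : B * `|r| * `|y' - y| <= B * M * `|y' - y| by rewrite ler_wpM2r// ler_wpM2l.
rewrite /rect.
have u1 := normcB (Ih f y r s + Iv f s y y' - Ih f y' r s) (Iv f r y y').
have u2 := normcB (Ih f y r s + Iv f s y y') (Ih f y' r s).
have u3 := normcD (Ih f y r s) (Iv f s y y').
lra.
Qed.

Lemma rectCh f r s y y' : rect f s r y y' = - rect f r s y y'.
Proof. by rewrite /rect /Ih ![cint _ s r]cintC; ring. Qed.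

Lemma rectCv f r s y y' : rect f r s y' y = - rect f r s y y'.
Proof. by rewrite /rect /Iv ![cint _ y' y]cintC; ring. Qed.

Lemma Ih_chasles f y lo hi r s t :
  (forall x, lo <= x <= hi -> ccont f (x, y)) ->
  lo <= r <= hi -> lo <= s <= hi -> lo <= t <= hi ->
  Ih f y r s + Ih f y s t = Ih f y r t.
Proof. by move=> cf; apply: cint_chasles => x /cf; exact: ccont_h. Qed.

Lemma Iv_chasles f x lo hi r s t :
  (forall y, lo <= y <= hi -> ccont f (x, y)) ->
  lo <= r <= hi -> lo <= s <= hi -> lo <= t <= hi ->
  Iv f x r s + Iv f x s t = Iv f x r t.
Proof. by move=> cf; apply: cint_chasles => y /cf; exact: ccont_v. Qed.

Lemma rect_split f r m s y n y' :
  (forall z, r <= z.1 <= s -> y <= z.2 <= y' -> ccont f z) ->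
  r <= m <= s -> y <= n <= y' ->
  rect f r s y y' = rect f r m y n + rect f m s y n +
    (rect f r m n y' + rect f m s n y').
Proof.
move=> cf /andP[rm ms] /andP[yn ny].
have rs := le_trans rm ms; have yy := le_trans yn ny.
have H u : y <= u <= y' -> Ih f u r m + Ih f u m s = Ih f u r s.
  by move=> uI; apply: (@Ih_chasles f u r s) => [x xI|||]; [exact: cf|..];
    rewrite ?lexx ?rm ?rs.
have V x : r <= x <= s -> Iv f x y n + Iv f x n y' = Iv f x y y'.
  by move=> xI; apply: (@Iv_chasles f x y y') => [u uI|||]; [exact: cf|..];
    rewrite ?lexx ?yn ?yy.
rewrite /rect -!H -?V ?lexx ?rs ?yy//.
by ring.
Qed.

End Rectangles.

(** * Goursat's lemma in polar coordinates *)

Section Goursat.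
Context {K : realType}.
Implicit Types (f F : ucover K -> K[i]) (z w : ucover K) (r s x y : K).

(** The supremum of the lower bounds works. Limits of sequences are obtained from it as well, with
    explicit errors, in [geometric_limit]. *)
Lemma nested_point (u v : nat -> K) : (forall k m, u k <= v m) ->
  exists l, forall k, u k <= l <= v k.
Proof.
move=> h; exists (sup (range u)) => k; apply/andP; split.
  apply: ub_le_sup; last by exists k.
  by exists (v 0%N) => _ [m _ <-].
by apply: ge_sup; [exists (u 0%N), 0%N|move=> _ [m _ <-]].
Qed.

Lemma nested_intervals (u l : nat -> K) :
  (forall k, u k <= u k.+1) -> (forall k, u k.+1 + l k.+1 <= u k + l k) ->
  (forall k, 0 <= l k) ->
  exists p, forall k, u k <= p <= u k + l k.
Proof.
move=> h1 h2 l0; apply: (@nested_point u (fun k => u k + l k)) => k m.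
have u_nd : {homo u : i j / (i <= j)%N >-> i <= j}.
  by apply: homo_leq => // a b c; exact: le_trans.
have v_ni : {homo (fun k => u k + l k) : i j / (i <= j)%N >-> j <= i}.
  by apply: (@homo_leq _ _ (fun a b => b <= a)) => // a b c ab /le_trans; apply.
apply: (le_trans (u_nd _ _ (leq_maxl k m))).
apply: le_trans (v_ni _ _ (leq_maxr k m)).
by rewrite lerDl.
Qed.

Lemma half_pow_small (x e : K) : 0 < e -> exists k, forall m, (k <= m)%N -> x / 2 ^+ m < e.
Proof.
move=> e0; exists (Num.bound `|x / e|) => m km.
rewrite ltr_pdivrMr ?exprn_gt0// mulrC -ltr_pdivrMr//.
apply: le_lt_trans (ler_norm _) _.
apply: lt_le_trans (archi_boundP (normr_ge0 _)) _.
rewrite -natrX ler_nat.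
rewrite (leq_trans _ (ltnW (ltn_expl m (ltnSn 1))))//.
Qed.

(** Bisecting both coordinates keeps a box with at least a quarter of the circulation. At the limit
    point f is an affine function of [cproj], which has a quadratic primitive, plus an error small
    compared with the diameter. Diameter times perimeter decays like 4^-k, so the initial
    circulation is arbitrarily small. *)
Lemma goursat f r s y y' : r <= s -> y <= y' ->
  (forall z, r <= z.1 <= s -> y <= z.2 <= y' -> exists d, cd f z d) ->
  rect f r s y y' = 0.
Proof.
move=> rs yy hf.
have cf z : r <= z.1 <= s -> y <= z.2 <= y' -> ccont f z.
  by move=> z1 z2; have [d] := hf _ z1 z2; exact: cd_ccont.
pose a := s - r; pose b := y' - y.
have a0 : 0 <= a by rewrite subr_ge0.
have b0 : 0 <= b by rewrite subr_ge0.
pose q k (p : ucover K) := normc (rect f p.1 (p.1 + a / 2 ^+ k) p.2 (p.2 + b / 2 ^+ k)).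
pose c := normc (rect f r s y y').
pose good k (p : ucover K) := [/\ r <= p.1, p.1 + a / 2 ^+ k <= s, y <= p.2,
  p.2 + b / 2 ^+ k <= y' & c / 4 ^+ k <= q k p].
pose nxt k (p p' : ucover K) := [/\ p.1 <= p'.1,
  p'.1 + a / 2 ^+ k.+1 <= p.1 + a / 2 ^+ k, p.2 <= p'.2 &
  p'.2 + b / 2 ^+ k.+1 <= p.2 + b / 2 ^+ k].
(* Stated for all pairs, with a dummy value when the box is not good, so that [choice] yields a
   total function to iterate. *)
have ex kp : exists p', good kp.1 kp.2 -> good kp.1.+1 p' /\ nxt kp.1 kp.2 p'.
  case: kp => k [p1 p2] /=.
  have [|ng] := pselect (good k (p1, p2)); last by exists (p1, p2).
  move=> [/= g1 g2 g3 g4 g5].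
  pose A := a / 2 ^+ k.+1; pose B := b / 2 ^+ k.+1.
  have A0 : 0 <= A by rewrite divr_ge0// exprn_ge0.
  have B0 : 0 <= B by rewrite divr_ge0// exprn_ge0.
  have AE : a / 2 ^+ k = A + A by rewrite /A exprS; field; rewrite expf_neq0.
  have BE : b / 2 ^+ k = B + B by rewrite /B exprS; field; rewrite expf_neq0.
  rewrite AE in g2; rewrite BE in g4.
  have CE : c / 4 ^+ k = 4 * (c / 4 ^+ k.+1) by rewrite exprS; field; rewrite expf_neq0.
  have sp := @rect_split _ f p1 (p1 + A) (p1 + (A + A)) p2 (p2 + B) (p2 + (B + B)).
  have {sp} E := sp ltac:(by move=> z z1 z2; apply: cf; lra) ltac:(lra) ltac:(lra).
  move: g5; rewrite /q/= AE BE E CE => g5.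
  have [R1|R1] := leP (c / 4 ^+ k.+1) (q k.+1 (p1, p2)).
    by exists (p1, p2) => _; split; split; rewrite /= -/A -/B ?AE ?BE//; clear -A0 B0 g1 g2 g3 g4; lra.
  have [R2|R2] := leP (c / 4 ^+ k.+1) (q k.+1 (p1 + A, p2)).
    by exists (p1 + A, p2) => _; split; split; rewrite /= -/A -/B ?AE ?BE//; clear -A0 B0 g1 g2 g3 g4; lra.
  have [R3|R3] := leP (c / 4 ^+ k.+1) (q k.+1 (p1, p2 + B)).
    by exists (p1, p2 + B) => _; split; split; rewrite /= -/A -/B ?AE ?BE//; clear -A0 B0 g1 g2 g3 g4; lra.
  have [R4|R4] := leP (c / 4 ^+ k.+1) (q k.+1 (p1 + A, p2 + B)).
    by exists (p1 + A, p2 + B) => _; split; split; rewrite /= -/A -/B ?AE ?BE//; clear -A0 B0 g1 g2 g3 g4; lra.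
  exfalso; move: R1 R2 R3 R4; rewrite /q/= -/A -/B -!addrA.
  set r1 := rect _ _ _ _ _; set r2 := rect _ _ _ _ _; set r3 := rect _ _ _ _ _.
  set r4 := rect _ _ _ _ _ => R1 R2 R3 R4.
  move: g5; rewrite -/r1 -/r2 -/r3 -/r4 => g5.
  have u1 := normcD (r1 + r2) (r3 + r4).
  have u2 := normcD r1 r2; have u3 := normcD r3 r4.
  rewrite addrA in g5.
  by move: g5 u1 u2 u3; rewrite -?addrA; clear -R1 R2 R3 R4; lra.
have [nx hnx] := choice ex.
pose P := fix P k : ucover K := if k is k'.+1 then nx (k', P k') else (r, y).
have gP k : good k (P k).
  elim: k => [|k IH]; last by have [] := hnx (k, P k) IH.
  by split; rewrite /= ?expr0 ?divr1 /q /= ?expr0 ?divr1 /a /b ?subrKC ?lexx.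
have nP k : nxt k (P k) (P k.+1) by have [] := hnx (k, P k) (gP k).
have [p1 hp1] : exists p, forall k, (P k).1 <= p <= (P k).1 + a / 2 ^+ k.
  by apply: nested_intervals => k; [case: (nP k)..|rewrite divr_ge0// exprn_ge0].
have [p2 hp2] : exists p, forall k, (P k).2 <= p <= (P k).2 + b / 2 ^+ k.
  by apply: nested_intervals => k; [case: (nP k)..|rewrite divr_ge0// exprn_ge0].
have p1I : r <= p1 <= s by have := hp1 0%N; rewrite /= expr0 divr1 /a; lra.
have p2I : y <= p2 <= y' by have := hp2 0%N; rewrite /= expr0 divr1 /b; lra.
have [d hd] := hf (p1, p2) p1I p2I.
pose M := `|r| + `|s|.
have M0 : 0 <= M by rewrite addr_ge0.
have xM x : r <= x <= s -> `|x| <= M.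
  move=> xI; rewrite /M ler_norml; have := ler_norm s; have := ler_norm (- r).
  have := normr_ge0 r; have := normr_ge0 s; rewrite normrN; lra.
apply: normc_small => e e0; rewrite -/c.
(* At scale 1 the perimeter is at most 2 (a + M b) and the distance to the limit point at most a + M
   b; adding 1 keeps W positive. *)
pose W := 2 * (a + M * b) * (a + M * b) + 1.
have W0 : 0 < W.
  by rewrite ltr_wpDl// !mulr_ge0// addr_ge0// mulr_ge0.
have eW : 0 < e / W by rewrite divr_gt0.
have /nbhs_ballP[dl dl0 hdl] := hd _ eW.
have {}dl0 : 0 < dl by exact: dl0.
have [k1 hk1] := half_pow_small a dl0.
have [k2 hk2] := half_pow_small b dl0.
pose k := maxn k1 k2.
have ak := hk1 k (leq_maxl _ _); have bk := hk2 k (leq_maxr _ _).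
have [g1 g2 g3 g4 g5] := gP k.
have := hp1 k; have := hp2 k.
set A := a / 2 ^+ k in ak g2 g5 *; set B := b / 2 ^+ k in bk g4 g5 *.
have A0 : 0 <= A by rewrite divr_ge0// exprn_ge0.
have B0 : 0 <= B by rewrite divr_ge0// exprn_ge0.
set u := (P k).1 in g1 g2 g5 *; set v := (P k).2 in g3 g4 g5 *.
move=> vI uI.
pose lin w := f (p1, p2) + d * (cproj w - cproj (p1, p2)).
have inR z : inrect u (u + A) v (v + B) z -> u <= z.1 <= u + A /\ v <= z.2 <= v + B.
  by rewrite /inrect !between_le ?lerDl// => /andP[].
have clin z : ccont lin z.
  apply: ccontD; first exact: ccont_cst.
  apply: ccontM; first exact: ccont_cst.
  by apply: ccontB; [exact: ccont_cproj|exact: ccont_cst].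
have lin0 : rect lin u (u + A) v (v + B) = 0.
  apply: (@rect_exact _ (fun w => (f (p1, p2) - d * cproj (p1, p2)) * cproj w
      + d / 2 * (cproj w * cproj w))) => z _.
  apply: cd_eq (cdD (cdZ _ (cd_cproj z)) (cdZ _ (cdM (cd_cproj z) (cd_cproj z)))) _.
  by rewrite /lin; field.
have cfR z : inrect u (u + A) v (v + B) z -> ccont f z.
  by move=> /inR[z1 z2]; apply: cf; clear -z1 z2 g1 g2 g3 g4; lra.
have RE : rect f u (u + A) v (v + B) = rect (fun w => f w - lin w) u (u + A) v (v + B).
  by rewrite rectB ?lin0 ?subr0// => z _; exact: clin.
have Rn : normc (rect f u (u + A) v (v + B)) <=
    2 * (e / W * (A + M * B)) * (A + M * B).
  rewrite RE.
  have -> : 2 * (e / W * (A + M * B)) * (A + M * B) =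
    2 * (e / W * (A + M * B)) * (`|u + A - u| + M * `|v + B - v|).
    by rewrite !(addrC _ (- _)) !addKr !ger0_norm.
  apply: rect_norm.
  - by move=> z zI; apply: ccontB; [exact: cfR|exact: clin].
  - move=> z /inR[z1 z2].
    have zb : ball (p1, p2) dl z.
      split; rewrite /ball/= ltr_norml; clear -z1 z2 uI vI ak bk; lra.
    have := hdl _ zb.
    have -> : f z - f (p1, p2) - d * (cproj z - cproj (p1, p2)) = f z - lin z.
      by rewrite /lin; ring.
    move=> /le_trans; apply; apply: ler_wpM2l; first exact: ltW.
    apply: le_trans (cproj_le _ _) _; rewrite /=; apply: lerD.
      by rewrite ler_norml; clear -z1 uI; lra.
    by apply: ler_pM => //; [exact: xM|rewrite ler_norml; clear -z2 vI; lra].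
  - by apply: xM; clear -g1 g2 A0; lra.
  - by apply: xM; clear -g1 g2 A0; lra.
have g5' : c / 4 ^+ k <= 2 * (e / W * (A + M * B)) * (A + M * B) by apply: le_trans Rn.
have E4 : 2 * (e / W * (A + M * B)) * (A + M * B) =
    e / W * (2 * (a + M * b) * (a + M * b)) / 4 ^+ k.
  rewrite /A /B (_ : 4 = 2 ^+ 2 :> K); last by rewrite expr2; ring.
  rewrite -exprM mulnC exprM; field.
  by rewrite expf_neq0//= gt_eqF.
move: g5'; rewrite E4 ler_pM2r ?invr_gt0 ?exprn_gt0// => /le_trans; apply.
rewrite mulrAC ler_pdivrMr// ler_pM2l// /W lerDl//.
Qed.

End Goursat.

(** * Primitives of closed forms *)

Section Primitive.
Context {K : realType}.
Implicit Types (f F : ucover K -> K[i]) (z w : ucover K) (D : set (ucover K)).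

(* Rectangles with vanishing circulation: Morera's condition, stable under locally uniform limits. *)
Definition closed_form D f : Prop := (forall z, D z -> ccont f z) /\
  (forall r s y y', (forall z, inrect r s y y' z -> D z) -> rect f r s y y' = 0).

Lemma closed_form_ordered D f : (forall z, D z -> ccont f z) ->
  (forall r s y y', r <= s -> y <= y' ->
    (forall z, r <= z.1 <= s -> y <= z.2 <= y' -> D z) -> rect f r s y y' = 0) ->
  closed_form D f.
Proof.
move=> cf hf; split=> //.
have hor r s y y' : r <= s ->
    (forall z, inrect r s y y' z -> D z) -> rect f r s y y' = 0.
  move=> rs hD; have [yy|/ltW yy] := leP y y'.
    by apply: hf => // z z1 z2; apply: hD; rewrite /inrect !between_le// z1 z2.
  rewrite rectCv hf ?oppr0// => z z1 z2; apply: hD.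
  by rewrite /inrect (betweenC y) !between_le// z1 z2.
move=> r s y y' hD; have [rs|/ltW rs] := leP r s; first exact: hor.
rewrite rectCh hor ?oppr0// => z zI; apply: hD.
by move: zI; rewrite /inrect (betweenC s).
Qed.

Lemma cd_closed_form D f : (forall z, D z -> exists d, cd f z d) -> closed_form D f.
Proof.
move=> hf; apply: closed_form_ordered => [z /hf[d]|r s y y' rs yy hD].
  exact: cd_ccont.
by apply: goursat => // z z1 z2; apply: hf; exact: hD.
Qed.

(* Any two points are joined by going out radially, along an arc and back in, inside [D]. *)
Record right_domain D : Prop := RightDomain {
  rd_open : open D;
  rd_right : forall x x' y, D (x, y) -> x <= x' -> D (x', y);
  rd_pos : forall z, D z -> 0 < z.1;
  rd_join : forall z z', D z -> D z' ->
    exists X, forall x y, X <= x -> between z.2 z'.2 y -> D (x, y) }.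

Lemma open_box D z : open D -> D z -> exists2 dl : K, 0 < dl &
  forall w, `|w.1 - z.1| <= dl -> `|w.2 - z.2| <= dl -> D w.
Proof.
move=> oD Dz; have /nbhs_ballP[e e0 he] := open_nbhs_nbhs (conj oD Dz).
have {}e0 : 0 < e by exact: e0.
exists (e / 2); first by rewrite divr_gt0.
move=> w w1 w2; apply: he; split; rewrite /ball/= distrC.
  by apply: le_lt_trans w1 _; lra.
by apply: le_lt_trans w2 _; lra.
Qed.

Lemma box_near z (dl : K) : 0 < dl ->
  \forall w \near z, `|w.1 - z.1| <= dl /\ `|w.2 - z.2| <= dl.
Proof.
move=> d0; apply/nbhs_ballP; exists dl => // w [w1 w2].
by rewrite !(distrC w.1, distrC w.2); split; exact: ltW.
Qed.

Lemma between_dist (s t x : K) : between s t x -> `|x - s| <= `|t - s|.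
Proof.
rewrite /between; have [st|ts] := leP s t => /andP[h1 h2].
  by rewrite !ger0_norm ?subr_ge0// lerD2r.
by rewrite !ler0_norm ?lerN2 ?lerD2r// subr_le0 ?(ltW ts).
Qed.

Lemma between_split (y0 lo y hi x : K) : lo <= y <= hi ->
  between y0 y x -> between y0 lo x \/ between y0 hi x.
Proof.
move=> /andP[loy yhi] /andP[h1 h2]; have [xy|yx] := leP x y0.
  left; apply/andP; split; last by rewrite le_max xy.
  by apply: le_trans h1; rewrite le_min !ge_min lexx loy orbT.
right; apply/andP; split; first by rewrite ge_min ltW.
by apply: le_trans h2 _; rewrite ge_max !le_max lexx yhi orbT.
Qed.

Section WithDomain.
Variables (D : set (ucover K)) (hD : right_domain D) (z0 : ucover K) (Dz0 : D z0).

Let good X z := [/\ z0.1 <= X, z.1 <= X &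
  forall x y, X <= x -> between z0.2 z.2 y -> D (x, y)].

Let path_prim f X z :=
  Ih f z0.2 z0.1 X + Iv f X z0.2 z.2 - Ih f z.2 z.1 X.

Let good_exists z : D z -> exists X, good X z.
Proof.
move=> Dz; have [X hX] := rd_join hD Dz0 Dz.
exists (Num.max X (Num.max z0.1 z.1)); split; rewrite ?le_max ?lexx ?orbT//.
by move=> x y; rewrite ge_max => /andP[+ _]; exact: hX.
Qed.

(* One [X] works for the whole box, by joining [z0] to its two extreme angles. *)
Let good_box z dl : 0 < dl ->
  (forall w, `|w.1 - z.1| <= dl -> `|w.2 - z.2| <= dl -> D w) ->
  exists X, forall w, `|w.1 - z.1| <= dl -> `|w.2 - z.2| <= dl -> good X w.
Proof.
move=> dl0 hdl.
have [X1 h1] : exists X, good X (z.1, z.2 - dl).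
  by apply: good_exists; apply: hdl; rewrite /= ler_norml; lra.
have [X2 h2] : exists X, good X (z.1, z.2 + dl).
  by apply: good_exists; apply: hdl; rewrite /= ler_norml; lra.
case: h1 => g1 _ g3; case: h2 => k1 _ k3.
exists (Num.max (Num.max X1 X2) (z.1 + dl)) => w w1 w2; split.
- by rewrite !le_max g1.
- by rewrite !le_max orbC; move: w1; rewrite ler_norml => ?; apply/orP; left; lra.
move=> x y; rewrite !ge_max => /andP[/andP[x1 x2] x3].
have wI : z.2 - dl <= w.2 <= z.2 + dl by move: w2; rewrite ler_norml; lra.
by move=> /(between_split wI)[]; [exact: g3|exact: k3].
Qed.

Let ray z x : D z -> z.1 <= x -> D (x, z.2).
Proof. by case: z => a b /=; exact: rd_right. Qed.

(** The two values differ by the circulation around the rectangle between the moduli X and X', which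
    lies in D by [good]. *)
Let path_primE f X X' z : closed_form D f -> D z -> good X z -> good X' z ->
  path_prim f X z = path_prim f X' z.
Proof.
move=> [cf hf] Dz [g1 g2 g3] [k1 k2 k3].
wlog XX : X X' g1 g2 g3 k1 k2 k3 / X <= X'.
  by move=> H; have [|/ltW] := leP X X' => h; [|apply/esym]; exact: H.
have R : rect f X X' z0.2 z.2 = 0.
  apply: hf => w; rewrite /inrect between_le// => /andP[/andP[w1 w2] w3].
  by rewrite [w]surjective_pairing; exact: g3.
have H1 : Ih f z0.2 z0.1 X + Ih f z0.2 X X' = Ih f z0.2 z0.1 X'.
  apply: (@Ih_chasles _ f _ z0.1 X'); rewrite ?lexx ?g1 ?k1 ?XX//.
  by move=> x /andP[x1 _]; apply: cf; exact: ray.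
have H2 : Ih f z.2 z.1 X + Ih f z.2 X X' = Ih f z.2 z.1 X'.
  apply: (@Ih_chasles _ f _ z.1 X'); rewrite ?lexx ?g2 ?k2 ?XX//.
  by move=> x /andP[x1 _]; apply: cf; exact: ray.
rewrite /path_prim -H1 -H2; apply/eqP; rewrite -subr_eq0; apply/eqP.
by rewrite -[RHS]oppr0 -R /rect; ring.
Qed.

(** Near z one X serves all points, so the increment of the path integral reduces to a radial
    segment and an arc inside a small box, where f is nearly the constant f z. *)
Lemma primitive_exists f : closed_form D f ->
  exists F, F z0 = 0 /\ forall z, D z -> cd F z (f z).
Proof.
move=> cff; have [cf hf] := cff.
have exX z : exists X, D z -> good X z.
  by have [/good_exists[X]|?] := pselect (D z); [exists X|exists 0].
have [XX hXX] := choice exX.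
exists (fun z => path_prim f (XX z) z); split.
  by rewrite /path_prim /Iv cint_refl addr0 subrr.
move=> z Dz e e0; have [dl dl0 hdl] := open_box (rd_open hD) Dz.
have [X hX] := good_box dl0 hdl.
(* With error e / 8 on f and w.1 at most 2 z.1, both pieces together are at most e / 4 times the
   left side of [cproj_ge], whose constant is 4. *)
have e8 : 0 < e / 8 by rewrite divr_gt0.
have z10 : 0 < z.1 := rd_pos hD Dz.
have /nbhs_ballP[d1 d10 hd1] := cf _ Dz _ e8.
have {}d10 : 0 < d1 by exact: d10.
pose d2 := Num.min (Num.min dl (d1 / 2)) z.1.
have d20 : 0 < d2 by rewrite !lt_min dl0 z10 divr_gt0.
near=> w.
have [w1 w2] : `|w.1 - z.1| <= d2 /\ `|w.2 - z.2| <= d2 by near: w; exact: box_near.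
have w3 : `|w.1 - z.1| + z.1 * `|w.2 - z.2| <= 4 * normc (cproj w - cproj z).
  by near: w; exact: cproj_ge.
have [d2dl d2d1 d2z] : [/\ d2 <= dl, d2 <= d1 / 2 & d2 <= z.1].
  by rewrite /d2; split; rewrite !ge_min lexx ?orbT.
have boxE u : `|u.1 - z.1| <= d2 -> `|u.2 - z.2| <= d2 ->
    D u /\ normc (f u - f z) <= e / 8.
  move=> u1 u2; split.
    by apply: hdl; [exact: le_trans u1 _|exact: le_trans u2 _].
  by apply: hd1; split; rewrite /ball/= distrC; [apply: le_lt_trans u1 _|apply: le_lt_trans u2 _]; lra.
have Dw : D w by have [] := boxE w w1 w2.
have gz : good X z by apply: hX; rewrite subrr normr0 ltW.
have gw : good X w by apply: hX; [exact: le_trans w1 _|exact: le_trans w2 _].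
rewrite (path_primE cff Dz (hXX _ Dz) gz) (path_primE cff Dw (hXX _ Dw) gw).
have [g1 g2 g3] := gz; have [k1 k2 k3] := gw.
have onh x : between z.1 w.1 x -> D (x, z.2) /\ normc (f (x, z.2) - f z) <= e / 8.
  move=> xI; apply: boxE; rewrite /= ?subrr ?normr0 ?(ltW d20)//.
  exact: le_trans (between_dist xI) _.
have onv y : between z.2 w.2 y -> D (w.1, y) /\ normc (f (w.1, y) - f z) <= e / 8.
  by move=> yI; apply: boxE => //=; exact: le_trans (between_dist yI) _.
have E : path_prim f X w - path_prim f X z = Ih f z.2 z.1 w.1 + Iv f w.1 z.2 w.2.
  have R : rect f w.1 X z.2 w.2 = 0.
    apply: hf => u; rewrite /inrect between_le// => /andP[/andP[u1 u2] u3].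
    have [+ _] := onv _ u3; rewrite [X in _ -> D X]surjective_pairing => h.
    exact: rd_right h u1.
  (* The arcs at modulus X from z0 to the two extreme angles of the box lie in D; together they
     contain all three angles. *)
  have V : Iv f X z0.2 z.2 + Iv f X z.2 w.2 = Iv f X z0.2 w.2.
    pose lo := Num.min z0.2 (z.2 - dl); pose hi := Num.max z0.2 (z.2 + dl).
    apply: (@Iv_chasles _ f X lo hi); rewrite /lo /hi.
    - move=> y yI; apply: cf.
      have [yy|yy] := leP y z0.2.
        have [_ _] : good X (z.1, z.2 - dl).
          by apply: hX; rewrite /= ler_norml; lra.
        apply; rewrite ?lexx//; apply/andP; split; last by rewrite le_max yy.
        by case/andP: yI.
      have [_ _] : good X (z.1, z.2 + dl).
        by apply: hX; rewrite /= ler_norml; lra.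
      apply; rewrite ?lexx//; apply/andP; split; first by rewrite ge_min ltW.
      by case/andP: yI.
    - by rewrite ge_min le_max lexx.
    - by rewrite ge_min le_max; apply/andP; split; apply/orP; right; lra.
    - move: (le_trans w2 d2dl); rewrite ler_norml => ?.
      by rewrite ge_min le_max; apply/andP; split; apply/orP; right; lra.
  have H : Ih f z.2 z.1 w.1 + Ih f z.2 w.1 X = Ih f z.2 z.1 X.
    apply: (@Ih_chasles _ f _ (Num.min z.1 w.1) X).
    - move=> x /andP[x1 x2]; apply: cf.
      have [h|h] := leP z.1 x; first exact: ray.
      have [] // := onh x; apply/andP; split => //.
      by rewrite le_max ltW.
    - by rewrite ge_min lexx.
    - by rewrite ge_min lexx orbT.
    - by rewrite ge_min g2 lexx.
  rewrite /path_prim -V -H; apply/eqP; rewrite -subr_eq0; apply/eqP.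
  by rewrite -[RHS]R /rect; ring.
rewrite E.
have Ec : f z * (cproj w - cproj z) =
    Ih (fun=> f z) z.2 z.1 w.1 + Iv (fun=> f z) w.1 z.2 w.2.
  have cl v : cd (fun u => f z * cproj u) v (f z).
    by apply: cd_eq (cdZ _ (cd_cproj v)) _; rewrite mulr1.
  rewrite (Ih_exact (F := fun u => f z * cproj u))// (Iv_exact (F := fun u => f z * cproj u))//.
  by rewrite -!surjective_pairing; ring.
rewrite Ec opprD addrACA -IhB; last 2 first.
  by move=> x /onh[? _]; exact: cf.
  by move=> x _; exact: ccont_cst.
rewrite -IvB; last 2 first.
  by move=> x /onv[? _]; exact: cf.
  by move=> x _; exact: ccont_cst.
apply: le_trans (normcD _ _) _.
have t1 : normc (Ih (fun u => f u - f z) z.2 z.1 w.1) <= e / 8 * `|w.1 - z.1|.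
  apply: Ih_norm => x /onh[? ?] //.
  by apply: ccontB; [exact: cf|exact: ccont_cst].
have t2 : normc (Iv (fun u => f u - f z) w.1 z.2 w.2) <= e / 8 * `|w.1| * `|w.2 - z.2|.
  apply: Iv_norm => x /onv[? ?] //.
  by apply: ccontB; [exact: cf|exact: ccont_cst].
have w12 : `|w.1| <= 2 * z.1.
  by move: (le_trans w1 d2z); rewrite !ler_norml; lra.
have t3 : e / 8 * `|w.1| * `|w.2 - z.2| <= e / 8 * (2 * z.1) * `|w.2 - z.2|.
  by rewrite ler_wpM2r// ler_wpM2l// ltW.
have t4 : e / 4 * (`|w.1 - z.1| + z.1 * `|w.2 - z.2|) <=
    e / 4 * (4 * normc (cproj w - cproj z)) by rewrite ler_wpM2l// divr_ge0 ?ltW.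
have t5 : 0 <= e / 8 * `|w.1 - z.1| by rewrite mulr_ge0// ltW.
lra.
Unshelve. all: by end_near. Qed.

End WithDomain.

End Primitive.

(** * Bounds for the Picard iteration *)

Section Picard.
Context {K : realType}.
Implicit Types (f F : ucover K -> K[i]) (z w : ucover K) (D : set (ucover K)).

Lemma rect_bounded f (r s y y' : K) :
  (forall z, r <= z.1 <= s -> y <= z.2 <= y' -> ccont f z) ->
  exists2 B : K, 0 <= B &
    forall z, r <= z.1 <= s -> y <= z.2 <= y' -> normc (f z) <= B.
Proof.
move=> cf.
have cpt : compact (`[r, s]%classic `*` `[y, y']%classic).
  by apply: compact_setX; exact: segment_compact.
have /compact_near_coveringP cov := cpt.
have := cov _ (pinfty_nbhs K) (fun M z => normc (f z) <= M) _.
case=> [z [/= z1 z2]|M [Mr hM]].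
  rewrite !in_itv/= in z1 z2.
  exists ([set w | normc (f w) <= normc (f z) + 1],
          [set M | normc (f z) + 1 < M]) => /=.
    by split; [exact: ccont_bnd (cf _ z1 z2)|exact: nbhs_pinfty_gt (num_real _)].
  by move=> [w M] /= [w1 /ltW]; exact: le_trans.
exists (`|M| + 1); first by rewrite addr_ge0.
move=> z z1 z2; apply: (hM (`|M| + 1)); last by split; rewrite /= in_itv.
by rewrite (le_lt_trans (ler_norm _))// ltrDl.
Qed.

Lemma rect_bounded_fam (n : nat) (A : 'I_n -> 'I_n -> ucover K -> K[i]) (r s y y' : K) :
  (forall i j z, r <= z.1 <= s -> y <= z.2 <= y' -> ccont (A i j) z) ->
  exists2 B : K, 0 <= B &
    forall i j z, r <= z.1 <= s -> y <= z.2 <= y' -> normc (A i j z) <= B.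
Proof.
move=> cA.
have /choice[B hB] (p : 'I_n * 'I_n) : exists B : K, 0 <= B /\
    forall z, r <= z.1 <= s -> y <= z.2 <= y' -> normc (A p.1 p.2 z) <= B.
  by have [B B0 hB] := rect_bounded (cA p.1 p.2); exists B.
exists (\sum_p B p); first by rewrite sumr_ge0// => p _; have [] := hB p.
move=> i j z z1 z2; rewrite (bigD1 (i, j))//=.
have [_ /(_ _ z1 z2)/= h] := hB (i, j).
by rewrite (le_trans h)// lerDl sumr_ge0// => p _; have [] := hB p.
Qed.

(** One parametrization for rays (d = 0) and arcs (b = 0) in both directions, so that the Picard
    estimate is proved once for all of them. *)
Lemma affine_path (a b c d x : K) :
  {for x, continuous (fun t : K => (a + b * t, c + d * t) : ucover K)} /\
  exists2 v, hasd (fun t => cproj (a + b * t, c + d * t)) x v &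
    normc v <= `|b| + `|a + b * x| * `|d|.
Proof.
have c1 (p q : K) : {for x, continuous (fun t : K => p + q * t)}.
  apply: cvgD; first exact: cvg_cst.
  by apply: cvgM; [exact: cvg_cst|exact: cvg_id].
split; first by apply: (@cvg_pair _ _ _ _ (nbhs (a + b * x)) (nbhs (c + d * x))); exact: c1.
have h1 : hasd (fun t => (a + b * t)%:C) x (b%:C).
  by split => /=; apply: is_derive_eq; rewrite /GRing.scale/=; ring.
have h2 : hasd (fun t => cis (c + d * t)) x (d%:C * ciscis (c + d * x)).
  split => /=; apply: is_derive_eq; rewrite /GRing.scale/=; ring.
exists (b%:C * cis (c + d * x) + (a + b * x)%:C * (d%:C * ciscis (c + d * x))).
  by apply: hasd_ext (hasdM h1 h2) => t; rewrite cprojE.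
apply: le_trans (normcD _ _) _.
by rewrite !normcM !normc_real normc_cis normc_ciscis !mulr1.
Qed.

Lemma local_mean_value F f z (dl B : K) :
  (forall w, `|w.1 - z.1| <= dl -> `|w.2 - z.2| <= dl ->
    [/\ cd F w (f w), ccont f w & normc (f w) <= B]) ->
  forall w, `|w.1 - z.1| <= dl -> `|w.2 - z.2| <= dl ->
  normc (F w - F z) <= B * `|w.1 - z.1| + B * `|w.1| * `|w.2 - z.2|.
Proof.
move=> h w w1 w2.
have dl0 : 0 <= dl := le_trans (normr_ge0 _) w1.
have hh x : between z.1 w.1 x ->
    [/\ cd F (x, z.2) (f (x, z.2)), ccont f (x, z.2) & normc (f (x, z.2)) <= B].
  move=> xI; apply: h; rewrite /= ?subrr ?normr0//.
  exact: le_trans (between_dist xI) _.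
have hv y : between z.2 w.2 y ->
    [/\ cd F (w.1, y) (f (w.1, y)), ccont f (w.1, y) & normc (f (w.1, y)) <= B].
  by move=> yI; apply: h => //=; exact: le_trans (between_dist yI) _.
have -> : F w - F z = Ih f z.2 z.1 w.1 + Iv f w.1 z.2 w.2.
  rewrite (Ih_exact (F := F)); last by move=> x /hh[].
  rewrite (Iv_exact (F := F)); last by move=> x /hv[].
  by rewrite -!surjective_pairing; ring.
apply: le_trans (normcD _ _) _; apply: lerD.
  by apply: Ih_norm => x /hh[].
by apply: Iv_norm => x /hv[].
Qed.

Section Iteration.
Variables (D : set (ucover K)) (n : nat) (A : 'I_n -> 'I_n -> ucover K -> K[i]).
Hypothesis cA : forall i j z, D z -> ccont (A i j) z.
(** The terms of the Picard series of y' = A y. *)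
Variable d : nat -> 'I_n -> ucover K -> K[i].
Hypothesis d0 : forall i z w, d 0 i z = d 0 i w.
Hypothesis dS : forall k i z, D z -> cd (d k.+1 i) z (\sum_j A i j z * d k j z).

(* The weight [expR (2 n B V (x - s))] makes one Picard step a contraction of ratio 1/2. *)
Lemma picard_segment (a b c e s t B V M : K) : s <= t -> 0 <= B -> 0 <= M -> 0 <= V ->
  (forall x, s <= x <= t -> [/\ D (a + b * x, c + e * x),
     `|b| + `|a + b * x| * `|e| <= V &
     forall i j, normc (A i j (a + b * x, c + e * x)) <= B]) ->
  (forall k i, normc (d k i (a + b * s, c + e * s)) <= M / 2 ^+ k) ->
  forall k i, normc (d k i (a + b * t, c + e * t)) <=
    M * expR (2 * n%:R * B * V * (t - s)) / 2 ^+ k.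
Proof.
move=> st B0 M0 V0 hg hs.
pose C := 2 * n%:R * B * V.
have C0 : 0 <= C by rewrite !mulr_ge0.
suff H k : forall i x, s <= x <= t ->
    normc (d k i (a + b * x, c + e * x)) <= M * expR (C * (x - s)) / 2 ^+ k.
  by move=> k i; apply: H; rewrite st lexx.
have one x : s <= x -> 1 <= expR (C * (x - s)).
  by move=> sx; rewrite -expR0 ler_expR mulr_ge0// subr_ge0.
elim: k => [i x /andP[sx xt]|k IH i x /andP[sx xt]].
  rewrite (d0 i _ (a + b * s, c + e * s)); apply: le_trans (hs 0%N i) _.
  by rewrite !expr0 !divr1 ler_peMr// one.
pose g x := M / 2 ^+ k.+1 * expR (C * (x - s)).
have hd u : s <= u <= x -> exists v,
    hasd (fun x => d k.+1 i (a + b * x, c + e * x)) u v /\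
    normc v <= n%:R * B * V * (M / 2 ^+ k * expR (C * (u - s))).
  move=> /andP[su ux].
  have uI : s <= u <= t by rewrite su (le_trans ux).
  have [Du Vu Bu] := hg _ uI; have [cu [v hv nv]] := affine_path a b c e u.
  exists (\sum_j A i j (a + b * u, c + e * u) * d k j (a + b * u, c + e * u) * v).
  rewrite -mulr_suml; split; first exact: (cd_chain cu hv (dS k i Du)).
  rewrite normcM [leRHS](_ : _ = n%:R * (B * (M / 2 ^+ k * expR (C * (u - s)))) * V); last by ring.
  apply: ler_pM; rewrite ?normc_ge0//; last exact: le_trans nv Vu.
  apply: le_trans (normc_sum _ _ _) _.
  rewrite -[n in n%:R]card_ord mulr_natl -sumr_const; apply: ler_sum => j _.
  rewrite normcM; apply: ler_pM; rewrite ?normc_ge0//.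
  by have := IH j _ uI; rewrite mulrAC.
have /choice[v hv] (u : K) : exists v, s <= u <= x ->
    hasd (fun x => d k.+1 i (a + b * x, c + e * x)) u v /\
    normc v <= n%:R * B * V * (M / 2 ^+ k * expR (C * (u - s))).
  by have [/hd[v]|] := pselect (s <= u <= x); [exists v|exists 0].
have := @mean_value_le K (fun x => d k.+1 i (a + b * x, c + e * x)) g v
  (fun u => n%:R * B * V * (M / 2 ^+ k * expR (C * (u - s)))) s x sx.
move=> /(_ (fun u uI => (hv u uI).1)) H.
have {}H := H _ (fun u uI => (hv u uI).2).
have {H} : normc (d k.+1 i (a + b * x, c + e * x) - d k.+1 i (a + b * s, c + e * s)) <=
    g x - g s.
  apply: H => u _; rewrite /g; apply: is_derive_eq.
  rewrite /GRing.scale/= /C exprS; field.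
  by rewrite expf_neq0.
rewrite {2}/g subrr mulr0 expR0 mulr1 => h.
have := normcD (d k.+1 i (a + b * x, c + e * x) - d k.+1 i (a + b * s, c + e * s))
  (d k.+1 i (a + b * s, c + e * s)).
rewrite subrK; have := hs k.+1 i; rewrite mulrAC -/(g x); lra.
Qed.

Hypothesis hD : right_domain D.
Variables (z0 : ucover K) (Dz0 : D z0).
Hypothesis dz0 : forall k i, d k.+1 i z0 = 0.

(** The decay starts at z0, where all terms but the first vanish, and is carried outwards to a
    common modulus X, along an arc, and back inwards to the rectangle. Each of the three legs costs
    an exponential factor independent of k. *)
Lemma picard_bound (r s y y' : K) : r <= s -> y <= y' ->
  (forall z, r <= z.1 <= s -> y <= z.2 <= y' -> D z) ->
  exists2 M : K, 0 <= M & forall k i z, r <= z.1 <= s -> y <= z.2 <= y' ->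
    normc (d k i z) <= M / 2 ^+ k.
Proof.
move=> rs yy hDR.
have Dry : D (r, y) by apply: hDR; rewrite /= lexx.
have Dry' : D (r, y') by apply: hDR; rewrite /= lexx// yy.
have [X1 hX1] := rd_join hD Dz0 Dry.
have [X2 hX2] := rd_join hD Dz0 Dry'.
pose X := Num.max (Num.max X1 X2) (Num.max z0.1 s).
have [XX1 XX2 Xz Xs] : [/\ X1 <= X, X2 <= X, z0.1 <= X & s <= X].
  by rewrite /X; split; rewrite !le_max lexx ?orbT.
have rX : r <= X := le_trans rs Xs.
have r0 : 0 < r := rd_pos hD Dry.
have z00 : 0 < z0.1 := rd_pos hD Dz0.
pose lo := Num.min z0.2 y; pose hi := Num.max z0.2 y'.
have D1 z : z0.1 <= z.1 <= X -> z0.2 <= z.2 <= z0.2 -> D z.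
  case: z => u v /= /andP[uz _] /le_anti <-; apply: rd_right uz => //.
  by rewrite -surjective_pairing.
have D2 z : X <= z.1 <= X -> lo <= z.2 <= hi -> D z.
  case: z => u v /= /le_anti <- /andP[v1 v2].
  have [vz|vz] := leP v z0.2.
    by apply: hX1 => //; rewrite /between v1/= le_max vz.
  by apply: hX2 => //; rewrite /between v2 andbT ge_min ltW.
have D3 z : r <= z.1 <= X -> y <= z.2 <= y' -> D z.
  case: z => u v /= /andP[ru _] vI; apply: rd_right ru => //.
  by apply: hDR; rewrite //= lexx.
have [B1 B10 hB1] := rect_bounded_fam (fun i j z h1 h2 => cA i j (D1 z h1 h2)).
have [B2 B20 hB2] := rect_bounded_fam (fun i j z h1 h2 => cA i j (D2 z h1 h2)).
have [B3 B30 hB3] := rect_bounded_fam (fun i j z h1 h2 => cA i j (D3 z h1 h2)).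
pose M0 := \sum_i normc (d 0 i z0).
have M00 : 0 <= M0 by rewrite sumr_ge0// => i _; exact: normc_ge0.
have b0 k i : normc (d k i z0) <= M0 / 2 ^+ k.
  case: k => [|k]; last by rewrite dz0 normc0 divr_ge0// exprn_ge0.
  rewrite expr0 divr1 /M0 (bigD1 i)//= lerDl sumr_ge0// => j _; exact: normc_ge0.
pose M1 := M0 * expR (2 * n%:R * B1 * 1 * (X - z0.1)).
have M10 : 0 <= M1 by rewrite mulr_ge0// expR_ge0.
have b1 k i : normc (d k i (X, z0.2)) <= M1 / 2 ^+ k.
  have := @picard_segment 0 1 z0.2 0 z0.1 X B1 1 M0 Xz B10 M00 ler01.
  rewrite !mul1r !mul0r !addr0 !add0r -surjective_pairing => /(_ _ b0); apply.
  move=> x xI; rewrite mul0r mul1r add0r addr0 normr1 normr0 mulr0 addr0; split => //.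
    by apply: D1; rewrite //= lexx.
  by move=> i' j; apply: hB1; rewrite //= lexx.
pose M2 := M1 * expR (2 * n%:R * B2 * X * (hi - lo)).
have M20 : 0 <= M2 by rewrite mulr_ge0// expR_ge0.
have X0 : 0 < X := lt_le_trans z00 Xz.
have b2 k i v : y <= v <= y' -> normc (d k i (X, v)) <= M2 / 2 ^+ k.
  move=> /andP[v1 v2].
  have lohi x : between z0.2 v x -> lo <= x <= hi.
    move=> /andP[h1 h2]; apply/andP; split.
      by apply: le_trans h1; rewrite le_min !ge_min lexx v1 orbT.
    by apply: le_trans h2 _; rewrite ge_max !le_max lexx v2 orbT.
  have mono L : L <= hi - lo -> M1 * expR (2 * n%:R * B2 * X * L) / 2 ^+ k <= M2 / 2 ^+ k.
    move=> hL; rewrite ler_wpM2r ?invr_ge0 ?exprn_ge0// ler_wpM2l// ler_expR.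
    by rewrite ler_wpM2l// !mulr_ge0// ltW.
  have := lohi v (betweenr _ _); have := lohi z0.2 (betweenl _ _) => zl vl.
  have [zv|/ltW vz] := leP z0.2 v.
    have := @picard_segment X 0 0 1 z0.2 v B2 X M1 zv B20 M10 (ltW X0).
    rewrite !mul0r !mul1r !addr0 !add0r => H.
    apply: le_trans (H _ b1 k i) (mono _ _); last by lra.
    move=> x xI; rewrite mul0r mul1r add0r addr0 normr0 normr1 add0r mulr1 gtr0_norm//.
    have xb : lo <= x <= hi by apply: lohi; rewrite between_le.
    by split=> // [|i' j]; [apply: D2|apply: hB2]; rewrite //= lexx.
  (* A decreasing angle is parametrized by its opposite, since [picard_segment] runs forwards; the
     last leg treats the decreasing modulus likewise. *)
  have nvz : - z0.2 <= - v by rewrite lerN2.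
  have := @picard_segment X 0 0 (-1) (- z0.2) (- v) B2 X M1 nvz B20 M10 (ltW X0).
  rewrite !mul0r !mulN1r !opprK !addr0 !add0r => H.
  apply: le_trans (H _ b1 k i) (mono _ _); last by lra.
  move=> x xI; rewrite mul0r mulN1r add0r addr0 normr0 normrN1 add0r mulr1 gtr0_norm//.
  have xb : lo <= - x <= hi by apply: lohi; rewrite betweenC between_le//; lra.
  by split=> // [|i' j]; [apply: D2|apply: hB2]; rewrite //= lexx.
exists (M2 * expR (2 * n%:R * B3 * 1 * (X - r))).
  by rewrite mulr_ge0// expR_ge0.
move=> k i [u v] /= /andP[ru us] vI.
have uX : - X <= - u by rewrite lerN2 (le_trans us).
have := @picard_segment 0 (-1) v 0 (- X) (- u) B3 1 M2 uX B30 M20 ler01.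
rewrite !mul0r !mulN1r !opprK !addr0 !add0r => H.
apply: le_trans (H _ (fun k i => b2 k i v vI) k i) _.
  move=> x xI; rewrite mul0r mulN1r add0r addr0 normrN1 normr0 mulr0 addr0.
  by split=> // [|i' j]; [apply: D3|apply: hB3]; rewrite //=; lra.
rewrite ler_wpM2r ?invr_ge0 ?exprn_ge0// ler_wpM2l// ler_expR.
by rewrite ler_wpM2l ?mulr_ge0//; lra.
Qed.

End Iteration.

End Picard.

(** * Global solutions of linear systems *)

Section LinearSystem.
Context {K : realType}.
Implicit Types (f F : ucover K -> K[i]) (z w : ucover K) (D : set (ucover K)).

(** Real and imaginary parts are located by [nested_point]; the factor 2 adds their errors. *)
Lemma geometric_limit (u : nat -> K[i]) (B : nat -> K) :
  (forall k m, normc (u k - u m) <= B k + B m) ->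
  exists l, forall k, normc (u k - l) <= 2 * B k.
Proof.
move=> h.
have [p hp] : exists p, forall k, complex.Re (u k) - B k <= p <= complex.Re (u k) + B k.
  apply: nested_point => k m; have := le_trans (normc_Re _) (h k m).
  by rewrite ReD ReN ler_norml; lra.
have [q hq] : exists p, forall k, complex.Im (u k) - B k <= p <= complex.Im (u k) + B k.
  apply: nested_point => k m; have := le_trans (normc_Im _) (h k m).
  by rewrite ImD ImN ler_norml; lra.
exists (p +i* q) => k; apply: le_trans (normc_le_ReIm _) _.
rewrite ReD ImD ReN ImN/= mulr2n mulrDl mul1r; apply: lerD.
  by have := hp k; rewrite ler_norml; lra.
by have := hq k; rewrite ler_norml; lra.
Qed.

(** The subtracted term makes the induction on m close: it drops by exactly M / 2^(N + m) at each
    step. *)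
Lemma geometric_partial_sums (d : nat -> K[i]) (M : K) : 0 <= M ->
  (forall k, normc (d k) <= M / 2 ^+ k) ->
  forall N m, normc (\sum_(k < N + m) d k - \sum_(k < N) d k) <= 2 * M / 2 ^+ N - 2 * M / 2 ^+ (N + m).
Proof.
move=> M0 hd N; elim=> [|m IH]; first by rewrite addn0 !subrr normc0.
rewrite addnS big_ord_recr/= addrAC; apply: le_trans (normcD _ _) _.
have := hd (N + m)%N; set x := normc (d _) => hx.
have -> : 2 * M / 2 ^+ (N + m).+1 = M / 2 ^+ (N + m).
  by rewrite exprS; field; rewrite expf_neq0.
have := IH; lra.
Qed.

(** The Picard sums converge uniformly on rectangles of D. Vanishing circulation passes to uniform
    limits, so A Y has a primitive for the limit Y, and Y differs from this primitive locally by a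
    constant. *)
Lemma linear_system_exists D (n : nat) (A : 'I_n -> 'I_n -> ucover K -> K[i])
    z0 (c : 'I_n -> K[i]) :
  right_domain D -> (forall i j z, D z -> exists d, cd (A i j) z d) -> D z0 ->
  exists y : 'I_n -> ucover K -> K[i], (forall i, y i z0 = c i) /\
    forall i z, D z -> cd (y i) z (\sum_j A i j z * y j z).
Proof.
move=> hD hA Dz0.
have cA i j z : D z -> ccont (A i j) z by move=> /hA-/(_ i j)[d]; exact: cd_ccont.
pose good (g : 'I_n -> ucover K -> K[i]) := forall i z, D z -> exists d, cd (g i) z d.
have hAg g : good g -> forall i z, D z ->
    exists d, cd (fun w => \sum_j A i j w * g j w) z d.
  move=> gg i z Dz.
  have /choice[p hp] j : exists d, cd (fun w => A i j w * g j w) z d.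
    have [a ha] := hA i j z Dz; have [b hb] := gg j z Dz.
    by eexists; exact: cdM ha hb.
  by exists (\sum_j p j); exact: cd_sum.
have /choice[nx hnx] (g : 'I_n -> ucover K -> K[i]) : exists G : 'I_n -> ucover K -> K[i],
    good g -> forall i, G i z0 = 0 /\ forall z, D z -> cd (G i) z (\sum_j A i j z * g j z).
  have [gg|] := pselect (good g); last by exists (fun _ _ => 0).
  have /choice[G hG] i : exists F, F z0 = 0 /\ forall z, D z -> cd F z (\sum_j A i j z * g j z).
    by apply: (primitive_exists hD Dz0); apply: cd_closed_form => z; exact: hAg.
  by exists G.
pose d := fix d k : 'I_n -> ucover K -> K[i] := if k is k'.+1 then nx (d k') else fun i _ => c i.
have gd k : good (d k).
  elim: k => [|k IH] i z Dz; first by exists 0; exact: cd_cst.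
  by have [_ /(_ z Dz) h] := hnx _ IH i; eexists; exact: h.
have dS k i z : D z -> cd (d k.+1 i) z (\sum_j A i j z * d k j z).
  by have [_] := hnx _ (gd k) i; exact.
have dz0 k i : d k.+1 i z0 = 0 by have [] := hnx _ (gd k) i.
pose S N i z := \sum_(k < N) d k i z.
have dS' N i z : D z -> cd (S N.+1 i) z (\sum_j A i j z * S N j z).
  move=> Dz; rewrite /S.
  have -> : (fun z => \sum_(k < N.+1) d k i z) =
      fun z => d 0%N i z + \sum_(k < N) d k.+1 i z.
    by apply/funext => w; rewrite big_ord_recl.
  rewrite -[X in cd _ _ X]add0r; apply: cdD; first exact: cd_cst.
  rewrite (_ : \sum_j _ = \sum_(k < N) \sum_j A i j z * d k j z).
    by apply: cd_sum => k; exact: dS.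
  by rewrite exchange_big/=; apply: eq_bigr => j _; rewrite mulr_sumr.
have bnd r s y y' : r <= s -> y <= y' ->
    (forall z, r <= z.1 <= s -> y <= z.2 <= y' -> D z) ->
    exists2 M : K, 0 <= M & forall N m i z, r <= z.1 <= s -> y <= z.2 <= y' ->
      normc (S (N + m)%N i z - S N i z) <= 2 * M / 2 ^+ N.
  move=> rs yy hR.
  have d0E : forall i z w, d 0%N i z = d 0%N i w by [].
  have [M M0 hM] := picard_bound cA d0E dS hD Dz0 dz0 rs yy hR.
  exists M => // N m i z z1 z2.
  apply: le_trans (geometric_partial_sums M0 (fun k => hM k i z z1 z2) N m) _.
  by rewrite gerBl divr_ge0 ?exprn_ge0// mulr_ge0.
have /choice[y hy] (iz : 'I_n * ucover K) : exists l, D iz.2 ->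
    forall e : K, 0 < e -> exists N0, forall N, (N0 <= N)%N -> normc (S N iz.1 iz.2 - l) <= e.
  case: iz => i z; have [Dz|] := pselect (D z); last by exists 0.
  (* The rectangle reduced to the point z gives convergence at z. *)
  have [//|//|//|M M0 hM] := bnd z.1 z.1 z.2 z.2.
    move=> w /le_anti w1 /le_anti w2.
    by rewrite [w]surjective_pairing -w1 -w2 -surjective_pairing.
  have B0 k : 0 <= 2 * M / 2 ^+ k by rewrite divr_ge0 ?exprn_ge0// mulr_ge0.
  have cau k m : normc (S k i z - S m i z) <= 2 * M / 2 ^+ k + 2 * M / 2 ^+ m.
    wlog km : k m / (k <= m)%N.
      move=> H; have [/H//|/ltnW/H] := leqP k m.
      by move=> h; rewrite normc_subC [leRHS]addrC.
    rewrite normc_subC -{1}(subnKC km).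
    by apply: le_trans (hM _ _ _ _ _ _) _; rewrite ?lexx// lerDl.
  have [l hl] := @geometric_limit (fun N => S N i z) _ cau.
  exists l => /= _ e e0.
  have [N0 hN0] := half_pow_small (2 * (2 * M)) e0.
  exists N0 => N hN; apply: le_trans (hl N) _.
  by rewrite mulrA; apply: ltW; exact: hN0.
pose Y i z := y (i, z).
have unif r s u u' : r <= s -> u <= u' ->
    (forall z, r <= z.1 <= s -> u <= z.2 <= u' -> D z) ->
    forall e : K, 0 < e -> exists N1, forall N i z, (N1 <= N)%N -> r <= z.1 <= s -> u <= z.2 <= u' ->
      normc (S N i z - Y i z) <= e.
  move=> rs uu hR; have [M M0 hM] := bnd _ _ _ _ rs uu hR.
  move=> e e0; have e2 : 0 < e / 2 by rewrite divr_gt0.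
  have [N1 hN] := half_pow_small (2 * M) e2.
  exists N1 => N i z NN z1 z2; have [N0 hN0] := hy (i, z) (hR z z1 z2) _ e2.
  have h1 : normc (S (N + N0)%N i z - Y i z) <= e / 2 := hN0 _ (leq_addl _ _).
  have h2 := hM N N0 i z z1 z2; have h3 := hN N NN.
  have := normcB_tri (S N i z) (S (N + N0)%N i z) (Y i z).
  by rewrite (normc_subC (S N i z) (S (N + N0)%N i z)); lra.
have box z : D z -> exists2 dl : K, 0 < dl & forall w,
    z.1 - dl <= w.1 <= z.1 + dl -> z.2 - dl <= w.2 <= z.2 + dl -> D w.
  move=> Dz; have [dl dl0 h] := open_box (rd_open hD) Dz; exists dl => // w w1 w2.
  by apply: h; rewrite ler_norml; lra.
have cS N i z : D z -> ccont (S N i) z.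
  by move=> Dz; apply: ccont_sum => k; have [e] := gd k i z Dz; exact: cd_ccont.
have cY i z : D z -> ccont (Y i) z.
  move=> Dz e e0; have e3 : 0 < e / 3 by rewrite divr_gt0.
  have [dl dl0 hdl] := box z Dz.
  have [||N hN] := unif _ _ _ _ _ _ hdl _ e3; [lra|lra|].
  near=> w.
  have [w1 w2] : `|w.1 - z.1| <= dl /\ `|w.2 - z.2| <= dl by near: w; exact: box_near.
  have h1 : normc (S N i w - S N i z) <= e / 3 by near: w; exact: cS.
  have h2 : normc (S N i z - Y i z) <= e / 3 by apply: hN; rewrite ?leqnn//; lra.
  have h3 : normc (S N i w - Y i w) <= e / 3.
    by move: w1 w2; rewrite !ler_norml => w1 w2; apply: hN; rewrite ?leqnn//; lra.
  have := normcB_tri (Y i w) (S N i w) (Y i z).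
  have := normcB_tri (S N i w) (S N i z) (Y i z).
  by rewrite (normc_subC (Y i w) (S N i w)); lra.
pose f N i z := \sum_j A i j z * S N j z.
pose g i z := \sum_j A i j z * Y j z.
have cf N i z : D z -> ccont (f N i) z.
  by move=> Dz; apply: ccont_sum => j; apply: ccontM; [exact: cA|exact: cS].
have cg i z : D z -> ccont (g i) z.
  by move=> Dz; apply: ccont_sum => j; apply: ccontM; [exact: cA|exact: cY].
have unifg r s u u' : r <= s -> u <= u' ->
    (forall z, r <= z.1 <= s -> u <= z.2 <= u' -> D z) ->
    forall e : K, 0 < e -> exists N1, forall N i z, (N1 <= N)%N -> r <= z.1 <= s -> u <= z.2 <= u' ->
      normc (g i z - f N i z) <= e.
  move=> rs uu hR e e0.
  have [B B0 hB] := rect_bounded_fam (fun i j z h1 h2 => cA i j z (hR z h1 h2)).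
  pose W := n%:R * B + 1; have W0 : 0 < W by rewrite ltr_wpDl// mulr_ge0.
  have [N1 hN] := unif _ _ _ _ rs uu hR (e / W) (divr_gt0 e0 W0).
  exists N1 => N i z NN z1 z2; rewrite /g /f -sumrB.
  apply: le_trans (normc_sum _ _ _) _.
  apply: (@le_trans _ _ (\sum_(j < n) B * (e / W))).
    apply: ler_sum => j _; rewrite -mulrBr normcM.
    by apply: ler_pM; rewrite ?normc_ge0//; [exact: hB|rewrite normc_subC hN].
  rewrite sumr_const card_ord -mulr_natl -[leRHS](@divfK _ W) ?gt_eqF//.
  rewrite [leLHS](_ : _ = e / W * (W - 1)); last by rewrite /W; ring.
  by apply: ler_wpM2l; [rewrite divr_ge0 ?ltW|rewrite gerBl].
(* Each [f N] is exact, with primitive [S N.+1], so the circulation of g is that of g - [f N], which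
   is as small as desired. *)
have clg i : closed_form D (g i).
  apply: closed_form_ordered => [z|r s u u' rs uu hR]; first exact: cg.
  apply: normc_small => e e0.
  pose M := `|r| + `|s|.
  pose W := 2 * (`|s - r| + M * `|u' - u|) + 1.
  have W0 : 0 < W by rewrite ltr_wpDl// mulr_ge0// addr_ge0// mulr_ge0// addr_ge0.
  have [N hN] := unifg _ _ _ _ rs uu hR (e / W) (divr_gt0 e0 W0).
  have inR z : inrect r s u u' z -> r <= z.1 <= s /\ u <= z.2 <= u'.
    by rewrite /inrect !between_le// => /andP.
  have inD z : inrect r s u u' z -> D z by move=> /inR[]; exact: hR.
  have -> : rect (g i) r s u u' = rect (fun z => g i z - f N i z) r s u u'.
    rewrite rectB; last 2 first.
      by move=> z /inD; exact: cg.
      by move=> z /inD; exact: cf.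
    rewrite (_ : rect (f N i) _ _ _ _ = 0) ?subr0//.
    apply: (@rect_exact _ (S N.+1 i)) => z /inD; exact: dS'.
  apply: le_trans (@rect_norm _ _ _ _ _ _ (e / W) M _ _ _ _) _.
  - by move=> z /inD Dz; apply: ccontB; [exact: cg|exact: cf].
  - by move=> z /inR[z1 z2]; exact: hN.
  - by rewrite lerDl.
  - by rewrite lerDr.
  rewrite -[leRHS](@divfK _ W) ?gt_eqF//.
  rewrite [leLHS](_ : _ = e / W * (W - 1)); last by rewrite /W; ring.
  by apply: ler_wpM2l; [rewrite divr_ge0 ?ltW|rewrite gerBl].
exists Y; split=> [i|i z Dz].
  apply/eqP; rewrite -subr_eq0; apply/eqP; apply: normc_small => e e0.
  have [N0 hN0] := hy (i, z0) Dz0 e e0.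
  have E : S N0.+1 i z0 = c i.
    by rewrite /S big_ord_recl big1 ?addr0// => k _; exact: dz0.
  by rewrite normc_subC -E; exact: (hN0 _ (leqnSn _)).
have [F [_ hF]] := primitive_exists hD Dz0 (clg i).
have [dl dl0 hdl] := box z Dz.
(* On the box, F - [S N.+1] has derivative g - [f N], which tends to 0 uniformly, so its increments
   tend to 0. The constant W below adds the errors of the sums at z and w and the two terms of
   [local_mean_value]. *)
have E w : `|w.1 - z.1| <= dl -> `|w.2 - z.2| <= dl -> Y i w - Y i z = F w - F z.
  move=> w1 w2; apply/eqP; rewrite -subr_eq0; apply/eqP; apply: normc_small => e e0.
  pose W := 2 + dl + `|w.1| * dl.
  have W0 : 0 < W by rewrite /W !ltr_wpDr// ?mulr_ge0// ltW.
  have eW : 0 < e / W by rewrite divr_gt0.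
  have [||N1 hN1] := unifg _ _ _ _ _ _ hdl _ eW; [lra|lra|].
  have wI : z.1 - dl <= w.1 <= z.1 + dl /\ z.2 - dl <= w.2 <= z.2 + dl.
    by move: w1 w2; rewrite !ler_norml => w1 w2; split; lra.
  have inD u : `|u.1 - z.1| <= dl -> `|u.2 - z.2| <= dl ->
      z.1 - dl <= u.1 <= z.1 + dl /\ z.2 - dl <= u.2 <= z.2 + dl.
    by rewrite !ler_norml => u1 u2; split; lra.
  have [Nz hNz] := hy (i, z) Dz _ eW.
  have Dw : D w by apply: hdl; case: wI.
  have [Nw hNw] := hy (i, w) Dw _ eW.
  pose N := maxn N1 (maxn Nz Nw).
  have NN1 : (N1 <= N)%N := leq_maxl _ _.
  have NNz : (Nz <= N.+1)%N by rewrite leqW// /N !leq_max leqnn orbT.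
  have NNw : (Nw <= N.+1)%N by rewrite leqW// /N !leq_max leqnn !orbT.
  have := @local_mean_value _ (fun u => F u - S N.+1 i u) (fun u => g i u - f N i u) z dl (e / W) _ w w1 w2.
  move=> /(_ _)/wrap[u u1 u2|h3].
    have [i1 i2] := inD u u1 u2; have Du := hdl u i1 i2.
    split; last exact: hN1.
      by apply: cdB; [exact: hF|exact: dS'].
    by apply: ccontB; [exact: cg|exact: cf].
  have h1 : normc (S N.+1 i z - Y i z) <= e / W := hNz _ NNz.
  have h2 : normc (S N.+1 i w - Y i w) <= e / W := hNw _ NNw.
  rewrite /= in h3.
  have h4 : e / W * `|w.1 - z.1| <= e / W * dl by rewrite ler_wpM2l// ltW.
  have h5 : e / W * `|w.1| * `|w.2 - z.2| <= e / W * `|w.1| * dl.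
    by rewrite ler_wpM2l// mulr_ge0// ltW.
  have h6 : e = e / W * W by rewrite divfK// gt_eqF.
  have -> : Y i w - Y i z - (F w - F z) = (S N.+1 i z - Y i z)
    - (S N.+1 i w - Y i w) - (F w - S N.+1 i w - (F z - S N.+1 i z)) by ring.
  have t1 := normcB (S N.+1 i z - Y i z - (S N.+1 i w - Y i w)) (F w - S N.+1 i w - (F z - S N.+1 i z)).
  have t2 := normcB (S N.+1 i z - Y i z) (S N.+1 i w - Y i w).
  rewrite h6 /W; move: h1 h2 h3 h4 h5; rewrite /W; lra.
by move=> e e0; near=> w; rewrite (E w); [near: w; exact: hF| |]; near: w;
  apply: filterS (box_near z dl0) => u [].
Unshelve. all: by end_near. Qed.

End LinearSystem.

(** * Paths in the sector, path integrals and transport of bounds *)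

Section Paths.
Context {K : realType}.
Implicit Types (f F : ucover K -> K[i]) (z w : ucover K) (D : set (ucover K)).

Lemma is_derive_continuous (f : K -> K) x d :
  is_derive x (1 : K) f d -> {for x, continuous f}.
Proof.
by move=> h; apply: differentiable_continuous; apply/derivable1_diffP; case: h.
Qed.

Lemma C1_of_C2 (f f' f'' : K -> K) : (forall x, is_derive x (1 : K) f (f' x)) ->
  (forall x, is_derive x (1 : K) f' (f'' x)) ->
  (forall x, derivable f x 1) /\ continuous (derive1 f).
Proof.
move=> h1 h2; split=> [x|]; first by case: (h1 x).
have -> : derive1 f = f' by apply/funext => x; rewrite derive1E; case: (h1 x).
by move=> x; exact: is_derive_continuous (h2 x).
Qed.

(** The point at height rho tau on the line at distance rho from the origin. In the coordinates phi,
    rho, tau the union of the half-planes is convex: phi runs over an interval, rho is at least [a],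
    tau is free. *)
Lemma Hsector_polar (phi a rho tau : K) : a <= rho ->
  Hsector phi a (rho * Num.sqrt (1 + tau ^+ 2), phi + atan tau).
Proof.
move=> arho; have := atan_gtNpi2 tau; have := atan_ltpi2 tau => h1 h2.
split => /=; first by lra.
rewrite opprD addNKr cosN cos_atan invrK.
by rewrite ler_wpM2r// sqrtr_ge0.
Qed.

Lemma Hsector_polarP (phi a : K) z : Hsector phi a z ->
  exists rho tau, a <= rho /\ z = (rho * Num.sqrt (1 + tau ^+ 2), phi + atan tau).
Proof.
case: z => r th [/= thI rI].
have thI' : - (pi / 2) < th - phi < pi / 2 by lra.
have c0 := cos_gt0_pihalf thI'.
have cE : cos (phi - th) = cos (th - phi) by rewrite -cosN opprB.
rewrite cE in rI.
exists (r * cos (th - phi)), (tan (th - phi)); split.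
  by rewrite -ler_pdivrMr.
rewrite tanK ?in_itv// subrKC; congr pair.
rewrite -(cos2_tan2 (lt0r_neq0 c0)) -exprVn sqrtr_sqr ger0_norm ?invr_ge0 ?ltW//.
by rewrite mulfK// gt_eqF.
Qed.

(** The path is affine in the coordinates phi, rho, tau of [Hsector_polar]. *)
Lemma C1_path_exists (p q a : K) z0 z1 : 
  Hunion `]p, q[%classic a z0 -> Hunion `]p, q[%classic a z1 ->
  exists g, C1_path (Hunion `]p, q[%classic a) z0 z1 g.
Proof.
move=> [ph0 /= I0 /Hsector_polarP[r0 [t0 [ar0 ->]]]] [ph1 /= I1 /Hsector_polarP[r1 [t1 [ar1 ->]]]].
rewrite in_itv/= in I0; rewrite in_itv/= in I1.
pose aff (u v x : K) := u + (v - u) * x.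
have aff_d u v x : is_derive x (1 : K) (aff u v) (v - u).
  by rewrite /aff; apply: is_derive_eq; rewrite /GRing.scale/=; ring.
pose s x := Num.sqrt (1 + aff t0 t1 x ^+ 2).
have s0 x : s x != 0 by rewrite gt_eqF// sqrtr_gt0 ltr_pwDl ?sqr_ge0.
have s_d x : is_derive x (1 : K) s ((t1 - t0) * aff t0 t1 x * (s x)^-1).
  have h : 0 < 1 + aff t0 t1 x ^+ 2 by rewrite ltr_pwDl ?sqr_ge0.
  have hq : is_derive x (1 : K) (fun x => 1 + aff t0 t1 x ^+ 2) (2 * aff t0 t1 x * (t1 - t0)).
    by apply: is_derive_eq; rewrite /GRing.scale/=; ring.
  have hs : is_derive x (1 : K) s ((2 * s x)^-1 * (2 * aff t0 t1 x * (t1 - t0))).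
    exact: (@is_derive1_comp K Num.sqrt (fun x => 1 + aff t0 t1 x ^+ 2) x _ _
      (is_derive1_sqrt h) hq).
  suff -> : (t1 - t0) * aff t0 t1 x / s x = (2 * s x)^-1 * (2 * aff t0 t1 x * (t1 - t0)) by [].
  by field; exact: s0.
have sV_d x : is_derive x (1 : K) (fun x => (s x)^-1)
    (- (s x) ^- 2 *: ((t1 - t0) * aff t0 t1 x * (s x)^-1)).
  exact: is_deriveV.
pose q0 x := 1 + aff t0 t1 x ^+ 2.
have q00 x : q0 x != 0 by rewrite gt_eqF// ltr_pwDl ?sqr_ge0.
exists (fun x => (aff r0 r1 x * s x, aff ph0 ph1 x + atan (aff t0 t1 x))); split.
- have [d1 c1] := @C1_of_C2 (fun x => aff r0 r1 x * s x)
    (fun x => aff r0 r1 x * ((t1 - t0) * aff t0 t1 x * (s x)^-1) + s x * (r1 - r0)) _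
    (fun x => is_deriveM (aff_d r0 r1 x) (s_d x))
    ltac:(move=> x; exact: (is_deriveD (is_deriveM (aff_d r0 r1 x)
       (is_deriveM (is_deriveM (is_derive_cst (t1 - t0) x (1 : K)) (aff_d t0 t1 x)) (sV_d x)))
       (is_deriveM (s_d x) (is_derive_cst (r1 - r0) x (1 : K))))).
  have [d2 c2] := @C1_of_C2 (fun x => aff ph0 ph1 x + atan (aff t0 t1 x))
    (fun x => (ph1 - ph0) + (q0 x)^-1 * (t1 - t0)) _
    ltac:(move=> x; exact: (is_deriveD (aff_d ph0 ph1 x)
      (is_derive1_comp (is_derive1_atan (aff t0 t1 x)) (aff_d t0 t1 x))))
    ltac:(move=> x; exact: (is_deriveD (is_derive_cst (ph1 - ph0) x (1 : K))
      (is_deriveM (is_deriveV (q00 x) (is_deriveD (is_derive_cst (1 : K) x (1 : K)) (is_deriveX 2 (aff_d t0 t1 x))))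
       (is_derive_cst (t1 - t0) x (1 : K))))).
  by split; [exact: d1|exact: c1|exact: d2|exact: c2].
- by rewrite /s /aff !mulr0 !addr0.
- by rewrite /s /aff !mulr1 !subrKC.
move=> x /andP[x0 x1].
have conv u v lo : lo <= u -> lo <= v -> lo <= aff u v x.
  move=> hu hv; have -> : aff u v x = u * (1 - x) + v * x by rewrite /aff; ring.
  have t2 : lo * (1 - x) <= u * (1 - x) by rewrite ler_wpM2r// subr_ge0.
  have t3 : lo * x <= v * x by rewrite ler_wpM2r.
  lra.
exists (aff ph0 ph1 x) => /=; last by apply: Hsector_polar; exact: conv.
rewrite in_itv/=; apply/andP; split.
  by apply: (@lt_le_trans _ _ (Num.min ph0 ph1));
    [rewrite lt_min; lra|apply: conv; rewrite ge_min lexx ?orbT].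
have -> : aff ph0 ph1 x = - aff (- ph0) (- ph1) x by rewrite /aff; ring.
rewrite ltrNl; apply: (@lt_le_trans _ _ (Num.min (- ph0) (- ph1))).
  by rewrite lt_min; lra.
by apply: conv; rewrite ge_min lexx ?orbT.
Qed.

Lemma C1_path_derive D z0 z1 g : C1_path D z0 z1 g -> forall x,
  {for x, continuous g} /\
  hasd (fun t => cproj (g t)) x ((derive1 (fun x => complex.Re (cproj (g x))) x
                        +i* derive1 (fun x => complex.Im (cproj (g x))) x)).
Proof.
move=> [[d1 c1 d2 c2] _ _ _] x.
have cf (h : K -> K) : derivable h x 1 -> {for x, continuous h}.
  by move=> hd; apply: differentiable_continuous; apply/derivable1_diffP.
split.
  have -> : g = fun t => ((fst \o g) t, (snd \o g) t).
    by apply/funext => t; exact: surjective_pairing.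
  by apply: (@cvg_pair _ _ _ _ (nbhs (g x).1) (nbhs (g x).2)); apply: cf.
have i1 : is_derive x (1 : K) (fun t => (g t).1) ('D_1 (fst \o g) x) by split.
have i2 : is_derive x (1 : K) (fun t => (g t).2) ('D_1 (snd \o g) x) by split.
split => /=.
  have h : is_derive x (1 : K) (fun t => (g t).1 * cos (g t).2) _ := is_deriveM i1 (is_derive1_comp (is_derive_cos (g x).2) i2).
  by rewrite derive1E; apply: DeriveDef => //; case: h.
have h : is_derive x (1 : K) (fun t => (g t).1 * sin (g t).2) _ := is_deriveM i1 (is_derive1_comp (is_derive_sin (g x).2) i2).
by rewrite derive1E; apply: DeriveDef => //; case: h.
Qed.

Lemma C1_path_velocity D z0 z1 g x : C1_path D z0 z1 g ->
  ccont (fun x => (derive1 (fun x => complex.Re (cproj (g x))) x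
                        +i* derive1 (fun x => complex.Im (cproj (g x))) x) : K[i]) x.
Proof.
move=> hg; have [[d1 c1 d2 c2] _ _ _] := hg.
have cf (h : K -> K) y : derivable h y 1 -> {for y, continuous h}.
  by move=> hd; apply: differentiable_continuous; apply/derivable1_diffP.
have cc : ccont (fun t => cis (g t).2) x.
  apply/ccontP; split => /=.
    by apply: (continuous_comp (f := snd \o g) (g := cos)); [exact: cf|exact: continuous_cos].
  by apply: (continuous_comp (f := snd \o g) (g := sin)); [exact: cf|exact: continuous_sin].
have cs : ccont (fun t => ciscis (g t).2) x.
  apply/ccontP; split => /=.
    apply: continuousN.
    by apply: (continuous_comp (f := snd \o g) (g := sin)); [exact: cf|exact: continuous_sin].
  by apply: (continuous_comp (f := snd \o g) (g := cos)); [exact: cf|exact: continuous_cos].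
have cr (h : K -> K) : {for x, continuous h} -> ccont (fun t => (h t)%:C) x.
  by move=> ch; apply/ccontP; split => //=; exact: cst_continuous.
rewrite (_ : (fun _ => _) = fun t => (derive1 (fst \o g) t)%:C * cis (g t).2 +
   (g t).1%:C * ((derive1 (snd \o g) t)%:C * ciscis (g t).2)).
  apply: ccontD; apply: ccontM => //.
  - by apply: cr; exact: c1.
  - by apply: (cr (fst \o g)); exact: cf.
  - by apply: ccontM => //; apply: cr; exact: c2.
apply/funext => t.
have i1 : is_derive t (1 : K) (fun t => (g t).1) (derive1 (fst \o g) t) by rewrite derive1E; split.
have i2 : is_derive t (1 : K) (fun t => (g t).2) (derive1 (snd \o g) t) by rewrite derive1E; split.
have h1 : is_derive t (1 : K) (fun t => (g t).1 * cos (g t).2) _ := is_deriveM i1 (is_derive1_comp (is_derive_cos (g t).2) i2).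
have h2 : is_derive t (1 : K) (fun t => (g t).1 * sin (g t).2) _ := is_deriveM i1 (is_derive1_comp (is_derive_sin (g t).2) i2).
apply: eqc; rewrite ?(ReD, ImD, Re_prod, Im_prod)/= derive1E.
  by rewrite (@derive_val _ _ _ _ _ _ _ h1) /GRing.scale/=; ring.
by rewrite (@derive_val _ _ _ _ _ _ _ h2) /GRing.scale/=; ring.
Qed.

Lemma Rintegral_derivative (f F : K -> K) (s t : K) : s <= t ->
  (forall x, s <= x <= t -> is_derive x (1 : K) F (f x)) ->
  (forall x, s <= x <= t -> {for x, continuous f}) ->
  \int[lebesgue_measure]_(x in `[s, t]) f x = F t - F s.
Proof.
rewrite le_eqVlt => /predU1P[<- _ _|st hF cf].
  by rewrite set_itv1 Rintegral_set1 subrr.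
rewrite /Rintegral (@continuous_FTC2 _ f F)//=.
- apply: continuous_in_subspaceT => x; rewrite inE/= in_itv/= => xI; exact: cf.
- have cF x : s <= x <= t -> {for x, continuous F}.
    by move=> /hF[hd _]; apply: differentiable_continuous; apply/derivable1_diffP.
  split.
  + by move=> x; rewrite in_itv/= => /andP[/ltW sx /ltW xt]; case: (hF x); rewrite ?sx.
  + by apply: cvg_at_right_filter; apply: cF; rewrite lexx ltW.
  + by apply: cvg_at_left_filter; apply: cF; rewrite lexx ltW.
- move=> x; rewrite in_itv/= => /andP[/ltW sx /ltW xt].
  by rewrite derive1E; case: (hF x); rewrite ?sx.
Qed.

(** Replaces the Lebesgue integrals in [path_int] by increments of a primitive, both for C^1 paths
    from the base point and for the arc-length parametrization of a line. *)
Lemma path_int_primitive f F (g : K -> ucover K) (s t : K) : s <= t ->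
  (forall x, s <= x <= t -> [/\ {for x, continuous g},
    hasd (fun t => cproj (g t)) x (derive1 (fun x => complex.Re (cproj (g x))) x
                        +i* derive1 (fun x => complex.Im (cproj (g x))) x),
    ccont (fun x => (derive1 (fun x => complex.Re (cproj (g x))) x
                        +i* derive1 (fun x => complex.Im (cproj (g x))) x) : K[i]) x,
    cd F (g x) (f (g x)) & ccont f (g x)]) ->
  path_int f g s t = F (g t) - F (g s).
Proof.
move=> st h.
have hd x : s <= x <= t -> hasd (fun t => F (g t)) x (f (g x) *
   (derive1 (fun x => complex.Re (cproj (g x))) x +i* derive1 (fun x => complex.Im (cproj (g x))) x)).
  by move=> /h[cg hg _ hF _]; exact: cd_chain.
have hc x : s <= x <= t -> ccont (fun x => f (g x) *
   (derive1 (fun x => complex.Re (cproj (g x))) x +i* derive1 (fun x => complex.Im (cproj (g x))) x)) x.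
  by move=> /h[cg _ cv _ cf]; apply: ccontM => //; exact: ccont_comp.
have hR := Rintegral_derivative st (fun x xI => (hd x xI).1)
  (fun x xI => ((ccontP _ _).1 (hc x xI)).1).
have hI := Rintegral_derivative st (fun x xI => (hd x xI).2)
  (fun x xI => ((ccontP _ _).1 (hc x xI)).2).
by apply: eqc; rewrite ?(ReD, ReN, ImD, ImN); [exact: hR|exact: hI].
Qed.

Lemma fam_max (n : nat) (h : 'I_n -> K -> K) (s t : K) (i0 : 'I_n) : s <= t ->
  (forall i x, s <= x <= t -> {for x, continuous (h i)}) ->
  exists i x, s <= x <= t /\ forall j y, s <= y <= t -> h j y <= h i x.
Proof.
move=> st ch.
have /choice[c hc] i : exists c, s <= c <= t /\ forall y, s <= y <= t -> h i y <= h i c.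
  have [|c cI hc] := @EVT_max K (h i) s t st.
    by apply: continuous_in_subspaceT => x; rewrite inE/= in_itv/=; exact: ch.
  by exists c; rewrite in_itv/= in cI; split=> // y yI; apply: hc; rewrite in_itv.
have [i Hi] : exists i, forall j, h j (c j) <= h i (c i).
  exists [arg max_(i > i0) h i (c i)]%O.
  by case: arg_maxP => //= i _ hi j; exact: hi.
exists i, (c i); split; first by have [] := hc i.
by move=> j y yI; apply: le_trans (Hi j); have [_] := hc j; exact.
Qed.

Lemma real_bounded (f : K -> K) (s t : K) : s <= t ->
  (forall x, s <= x <= t -> {for x, continuous f}) ->
  exists2 B : K, 0 <= B & forall x, s <= x <= t -> f x <= B.
Proof.
move=> st cf; have [|c cI hc] := @EVT_max K f s t st.
  by apply: continuous_in_subspaceT => x; rewrite inE/= in_itv/=; exact: cf.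
exists `|f c| => // x xI; apply: le_trans (ler_norm _); apply: hc.
by rewrite in_itv.
Qed.

(** A form of Gronwall's inequality. Let M be the maximum over components and times of the modulus
    weighted by [expR (- (C * x))]. For C = 2nBV the equation contributes at most half of the value
    at the maximum, hence M <= 2 m. The factor G depends on A and the path but not on the
    solution. *)
Lemma transfer D (n : nat) (A : 'I_n -> 'I_n -> ucover K -> K[i]) z0 z1 g :
  (forall i j z, D z -> ccont (A i j) z) -> C1_path D z0 z1 g ->
  exists2 G : K, 0 <= G & forall y : 'I_n -> ucover K -> K[i],
    (forall i z, D z -> cd (y i) z (\sum_j A i j z * y j z)) ->
    forall m, (forall i, normc (y i z0) <= m) -> forall i, normc (y i z1) <= G * m.
Proof.
move=> cA hg.
pose v x : K[i] := derive1 (fun x => complex.Re (cproj (g x))) x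
                        +i* derive1 (fun x => complex.Im (cproj (g x))) x.
have cv x : ccont v x := C1_path_velocity x hg.
have gd x := C1_path_derive hg x.
have [_ g0 g1 gD] := hg.
have [V V0 hV] : exists2 V : K, 0 <= V & forall x, 0 <= x <= 1 -> normc (v x) <= V.
  by apply: real_bounded => // x _; exact: ccont_normc.
have [B B0 hB] : exists2 B : K, 0 <= B & forall i j x, 0 <= x <= 1 -> normc (A i j (g x)) <= B.
  have /choice[b hb] (p : 'I_n * 'I_n) : exists B : K, 0 <= B /\
      forall x, 0 <= x <= 1 -> normc (A p.1 p.2 (g x)) <= B.
    have [|B B0 hB] := @real_bounded (fun x => normc (A p.1 p.2 (g x))) 0 1 ler01.
      move=> x xI; apply: ccont_normc; apply: ccont_comp; first by have [] := gd x.
      by apply: cA; exact: gD.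
    by exists B.
  exists (\sum_p b p); first by rewrite sumr_ge0// => p _; have [] := hb p.
  move=> i j x xI; rewrite (bigD1 (i, j))//=.
  have [_ /(_ _ xI)/= h] := hb (i, j).
  by rewrite (le_trans h)// lerDl sumr_ge0// => p _; have [] := hb p.
pose C := 2 * (n%:R * B * V).
have C0 : 0 <= C by rewrite /C !mulr_ge0.
exists (2 * expR C); first by rewrite mulr_ge0// expR_ge0.
move=> y hy m hm i.
have cy i' x : 0 <= x <= 1 -> ccont (fun x => y i' (g x)) x.
  move=> xI; apply: ccont_comp; first by have [] := gd x.
  by have := hy i' _ (gD _ xI); exact: cd_ccont.
have m0 : 0 <= m := le_trans (normc_ge0 _) (hm i).
have [i1 [x1 [x1I hmax]]] : exists i x, 0 <= x <= 1 /\ forall j u, 0 <= u <= 1 ->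
    normc (y j (g u)) * expR (- (C * u)) <= normc (y i (g x)) * expR (- (C * x)).
  apply: (@fam_max n (fun i x => normc (y i (g x)) * expR (- (C * x))) 0 1 i ler01).
  move=> j x xI; apply: cvgM; first exact: ccont_normc (cy _ _ xI).
  have h : is_derive x (1 : K) (fun x => expR (- (C * x))) (- C * expR (- (C * x))).
    by apply: is_derive_eq; rewrite /GRing.scale/=; ring.
  exact: is_derive_continuous h.
set M := normc (y i1 (g x1)) * expR (- (C * x1)) in hmax.
have M0 : 0 <= M by rewrite mulr_ge0 ?normc_ge0 ?expR_ge0.
have hMx j u : 0 <= u <= 1 -> normc (y j (g u)) <= M * expR (C * u).
  move=> uI; have := hmax j u uI; rewrite expRN -ler_pdivlMr ?invr_gt0 ?expR_gt0//.
  by rewrite invrK.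
have [x10 x11] := andP x1I.
have key : normc (y i1 (g x1) - y i1 (g 0)) <= M / 2 * expR (C * x1) - M / 2 * expR (C * 0).
  apply: (@mean_value_le _ (fun x => y i1 (g x)) (fun x => M / 2 * expR (C * x))
    (fun x => (\sum_j A i1 j (g x) * y j (g x)) * v x)
    (fun x => n%:R * B * V * (M * expR (C * x)))) => //.
  - move=> x /andP[xx0 xx1]; have xI : 0 <= x <= 1 by rewrite xx0 (le_trans xx1).
    have [cg hv] := gd x; exact: (cd_chain cg hv (hy i1 _ (gD _ xI))).
  - by move=> x _; apply: is_derive_eq; rewrite /GRing.scale/= /C; field.
  - move=> x /andP[xx0 xx1]; have xI : 0 <= x <= 1 by rewrite xx0 (le_trans xx1).
    rewrite normcM [leRHS](_ : _ = n%:R * (B * (M * expR (C * x))) * V); last by ring.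
    apply: ler_pM; rewrite ?normc_ge0//; last exact: hV.
    apply: le_trans (normc_sum _ _ _) _.
    rewrite -[n in n%:R]card_ord mulr_natl -sumr_const; apply: ler_sum => j _.
    by rewrite normcM; apply: ler_pM; rewrite ?normc_ge0//; [exact: hB|exact: hMx].
rewrite mulr0 expR0 mulr1 g0 in key.
have E1 : 1 <= expR (C * x1) by rewrite -expR0 ler_expR mulr_ge0.
have E : normc (y i1 (g x1)) = M * expR (C * x1).
  by rewrite /M -mulrA -expRD addNr expR0 mulr1.
have := normcD (y i1 (g x1) - y i1 z0) (y i1 z0); rewrite subrK E => h1.
have h2 := hm i1.
have M2 : M <= 2 * m.
  have h3 : m <= m * expR (C * x1) by rewrite ler_peMr.
  have : M * expR (C * x1) <= 2 * m * expR (C * x1) by lra.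
  by rewrite ler_pM2r ?expR_gt0.
have := hMx i 1; rewrite ler01 lexx => /(_ isT); rewrite mulr1 g1 => h4.
by apply: le_trans h4 _; rewrite [leRHS]mulrAC; apply: ler_wpM2r; rewrite ?expR_ge0.
Qed.

End Paths.

(** * Geometry of the sectors and of the curves *)

Section Geometry.
Context {K : realType}.
Implicit Types (z w : ucover K) (p q a b s t phi r th : K).

(** The increasing affine bijection from ]p - pi/2, q + pi/2[ onto ]p, q[ moves every point by less
    than pi/2. It chooses, continuously in the angle y, a half-plane that contains y. *)
Lemma cos_gt0_strip p q y (x := (y - p + pi / 2) / (q - p + pi)) : p < q ->
  p - pi / 2 < y < q + pi / 2 ->
  p < p + (q - p) * x < q /\ - (pi / 2) < y - (p + (q - p) * x) < pi / 2.
Proof.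
move=> pq yI; have pi0 := pi_gt0 K.
have d0 : 0 < q - p + pi by lra.
have x0 : 0 < x by rewrite divr_gt0//; lra.
have x1 : x < 1 by rewrite /x ltr_pdivrMr//; lra.
have E : x * (q - p + pi) = y - p + pi / 2 by rewrite /x divfK// gt_eqF.
have h1 : 0 < (q - p) * x by rewrite mulr_gt0//; lra.
have h2 : (q - p) * x < q - p by rewrite gtr_pMr//; lra.
have h3 : 0 < pi * x by rewrite mulr_gt0.
have h4 : pi * x < pi by rewrite gtr_pMr.
by split; lra.
Qed.

(** On the compact range of angles, the cosine of the distance to the chosen direction has a
    positive minimum; X is [a] divided by it. *)
Lemma Hunion_far p q a lo hi : 0 < a -> p < q ->
  p - pi / 2 < lo -> hi < q + pi / 2 ->
  exists X, forall x y, X <= x -> lo <= y <= hi -> Hunion `]p, q[%classic a (x, y).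
Proof.
move=> a0 pq plo hiq; have pi0 := pi_gt0 K.
have [hilo|lohi] := ltP hi lo; first by exists 0 => x y _ /andP[ly yh]; lra.
pose f y := p + (q - p) * ((y - p + pi / 2) / (q - p + pi)).
have strip y : lo <= y <= hi -> p < f y < q /\ - (pi / 2) < y - f y < pi / 2.
  by move=> yI; apply: cos_gt0_strip => //; lra.
have fE y : is_derive y (1 : K) (fun y => y - f y) (1 - (q - p) / (q - p + pi)).
  by rewrite /f; apply: is_derive_eq; rewrite /GRing.scale/=; ring.
have [|c cI hc] := @EVT_min K (fun y => cos (y - f y)) lo hi lohi.
  apply: continuous_subspaceT => y.
  apply: (continuous_comp (f := fun y => y - f y)); last exact: continuous_cos.
  exact: is_derive_continuous (fE y).
rewrite in_itv/= in cI.
have k0 : 0 < cos (c - f c) by apply: cos_gt0_pihalf; have [] := strip c cI.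
exists (a / cos (c - f c)) => x y xX yI.
have [fI yf] := strip y yI.
exists (f y); first by rewrite /= in_itv.
split => /=; first by lra.
apply: le_trans xX; rewrite ler_wpM2l ?(ltW a0)// -cosN opprB.
rewrite lef_pV2 ?posrE//; first by apply: hc; rewrite in_itv.
exact: cos_gt0_pihalf.
Qed.

Lemma Hsector_right phi a r r' th : Hsector phi a (r, th) -> r <= r' ->
  Hsector phi a (r', th).
Proof. by move=> [h1 h2] rr; split=> //=; exact: le_trans rr. Qed.

Lemma Hsector_gt0 phi a z : 0 < a -> Hsector phi a z -> 0 < z.1 /\ a <= z.1.
Proof.
move=> a0 [zI az]; have c0 : 0 < cos (phi - z.2) by apply: cos_gt0_pihalf; lra.
suff : a <= z.1 by split=> //; exact: lt_le_trans a0 _.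
by apply: le_trans az; rewrite ler_pdivlMr// ger_pMr// cos_le1.
Qed.

Lemma Hunion_le I a a' : a <= a' -> Hunion I a' `<=` Hunion (K := K) I a.
Proof.
move=> aa z [phi Iphi [zI az]]; exists phi => //; split=> //.
apply: le_trans az; rewrite ler_wpM2r// invr_ge0.
by apply: ltW; apply: cos_gt0_pihalf; lra.
Qed.

(** Outside the sector U may have holes. D consists of the points whose whole outward ray has a
    neighbourhood of positive angular width inside U, which makes it stable under increasing the
    modulus. *)
Lemma right_domain_exists p q a (U : set (ucover K)) : 0 < a -> p < q ->
  open U -> Hunion `]p, q[%classic a `<=` U -> U `<=` [set z | 0 < z.1] ->
  exists D, [/\ right_domain D, Hunion `]p, q[%classic a `<=` D & D `<=` U].
Proof.
move=> a0 pq oU HU U0.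
pose D := [set z : ucover K | p - pi / 2 < z.2 < q + pi / 2 /\
  exists2 dl : K, 0 < dl & forall w, z.1 - dl < w.1 -> `|w.2 - z.2| < dl -> U w].
have DU : D `<=` U.
  by move=> z [_ [dl dl0]]; apply; [lra|rewrite subrr normr0].
exists D; split=> //; first split.
- rewrite openE => z [zI [dl dl0 hdl]]; apply/nbhs_ballP.
  pose m := Num.min (dl / 2) (Num.min (z.2 - (p - pi / 2)) (q + pi / 2 - z.2)).
  exists m; first by rewrite /= !lt_min divr_gt0//=; lra.
  have [m1 m2 m3] : [/\ m <= dl / 2, m <= z.2 - (p - pi / 2) & m <= q + pi / 2 - z.2].
    by rewrite /m; split; rewrite !ge_min lexx ?orbT.
  move=> w [/= w1 w2]; move: w1 w2; rewrite /ball/= !ltr_norml => w1 w2.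
  split; first by lra.
  exists (dl / 2); first by rewrite divr_gt0.
  move=> u u1; rewrite ltr_norml => u2; apply: hdl; first by lra.
  by rewrite ltr_norml; lra.
- move=> x x' y [yI [dl dl0 hdl]] xx; split=> //; exists dl => // w w1 w2.
  by apply: hdl => //=; move: w1 => /=; lra.
- by move=> z /DU /U0.
- move=> z z' [zI _] [zI' _].
  pose lo := Num.min z.2 z'.2; pose hi := Num.max z.2 z'.2.
  have lo1 : p - pi / 2 < lo by rewrite lt_min; lra.
  have hi1 : hi < q + pi / 2 by rewrite gt_max; lra.
  pose m := Num.min ((lo - (p - pi / 2)) / 2) ((q + pi / 2 - hi) / 2).
  have m0 : 0 < m by rewrite lt_min; lra.
  have m1 : m <= (lo - (p - pi / 2)) / 2 by rewrite ge_min lexx.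
  have m2 : m <= (q + pi / 2 - hi) / 2 by rewrite ge_min lexx orbT.
  have [X hX] := @Hunion_far p q a (lo - m) (hi + m) a0 pq ltac:(lra) ltac:(lra).
  exists (X + m) => x y xX /andP[y1 y2]; rewrite -/lo -/hi in y1 y2.
  split => /=; first by lra.
  exists m => // w /= w1; rewrite ltr_norml => w2; apply: HU.
  by rewrite [w]surjective_pairing; apply: hX; lra.
move=> z Hz; have [phi phiI Hphi] := Hz; have [zI az] := Hphi.
have /= := phiI; rewrite in_itv/= => phiI'.
have [z0 _] := Hsector_gt0 a0 Hphi.
split; first by lra.
have c0 : 0 < cos (phi - z.2) by apply: cos_gt0_pihalf; lra.
have [d1 d10 hd1] := open_box oU (HU _ Hz).
(* From modulus z.1 + 1 on, the half-plane of phi itself contains the rays of nearby angle. So the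
   tube argument is only needed on the compact segment [z.1, z.1 + 1]. *)
have far : \forall y \near z.2, phi - pi / 2 < y < phi + pi / 2 /\ a / cos (phi - y) <= z.1 + 1.
  have h1 : \forall y \near z.2, phi - pi / 2 < y by apply: lt_nbhsr; lra.
  have h2 : \forall y \near z.2, y < phi + pi / 2 by apply: lt_nbhsl; lra.
  have h3 : \forall y \near z.2, a / cos (phi - y) <= z.1 + 1.
    have cv : {for z.2, continuous (fun y => a / cos (phi - y))}.
      apply: cvgM; first exact: cvg_cst.
      apply: cvgV; first exact: lt0r_neq0.
      apply: (continuous_comp (f := fun y => phi - y)); last exact: continuous_cos.
      by apply: cvgB; [exact: cvg_cst|exact: cvg_id].
    have lt1 : a / cos (phi - z.2) < z.1 + 1 by lra.
    have h : nbhs z.2 [set y | a / cos (phi - y) < z.1 + 1] := cv _ (lt_nbhsl lt1).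
    by apply: filterS h => y; exact: ltW.
  by near=> y; split; [apply/andP; split|]; near: y.
have cov : \forall y \near z.2, `[z.1, z.1 + 1]%classic `<=` (fun x => U (x, y)).
  have /compact_near_coveringP := @segment_compact K z.1 (z.1 + 1).
  move=> /(_ _ (nbhs z.2) (fun y x => U (x, y)) _); apply=> x /=.
  rewrite in_itv/= => /andP[zx _].
  have Ux : U (x, z.2).
    by apply: HU; exists phi => //; apply: Hsector_right zx; rewrite -surjective_pairing.
  have [[P Q] /= [hP hQ] sub] := open_nbhs_nbhs (conj oU Ux).
  by exists (P, Q) => // -[u v]; exact: sub.
have /nbhs_ballP[d2 d20 hd2] : \forall y \near z.2,
    (phi - pi / 2 < y < phi + pi / 2 /\ a / cos (phi - y) <= z.1 + 1) /\
    `[z.1, z.1 + 1]%classic `<=` (fun x => U (x, y)) by near=> y; split; near: y.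
have {}d20 : 0 < d2 by exact: d20.
exists (Num.min d1 d2); first by rewrite lt_min d10.
move=> w w1; rewrite lt_min => /andP[w21 w22].
have wd1 : Num.min d1 d2 <= d1 by rewrite ge_min lexx.
have [|[f1 f2] f3] := hd2 w.2; first by rewrite /ball/= distrC.
have [wz|zw] := leP w.1 z.1.
  by apply: hd1; rewrite ?(ltW w21)// ler_norml; lra.
have [wz1|z1w] := leP w.1 (z.1 + 1).
  by rewrite [w]surjective_pairing; apply: f3; rewrite /= in_itv/= wz1 ltW.
apply: HU; exists phi => //; split=> //; apply: le_trans f2 _; exact: ltW.
Unshelve. all: by end_near. Qed.

(** The signed distance b and the arc length s of the line of direction phi through a given point;
    the window of width 2 pi is made of the three sheets in [line]. *)
Lemma line_polar phi r th : 0 < r -> phi - 3 * pi / 2 < th < phi + pi / 2 ->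
  line phi (r * cos (th - phi)) (r * sin (phi - th)) = (r, th).
Proof.
move=> r0 thI; have pi0 := pi_gt0 K.
have cE : cos (th - phi) = cos (phi - th) by rewrite -cosN opprB.
have sq : Num.sqrt ((r * cos (th - phi)) ^+ 2 + (r * sin (phi - th)) ^+ 2) = r.
  by rewrite cE !exprMn -mulrDr cos2Dsin2 mulr1 sqrtr_sqr gtr0_norm.
have tE : cos (phi - th) != 0 ->
    r * sin (phi - th) / (r * cos (th - phi)) = tan (phi - th).
  by move=> c0; rewrite cE /tan; field; rewrite c0 gt_eqF.
rewrite /line sq; have [h|h|h] := ltgtP (th - phi) (- (pi / 2)).
- have c0 : 0 < cos (phi - th - pi) by apply: cos_gt0_pihalf; lra.
  have c1 : cos (th - phi) < 0.
    by move: c0; rewrite [cos (_ - pi)]cosB cospi sinpi cE; lra.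
  have b0 : r * cos (th - phi) < 0 by rewrite pmulr_rlt0.
  rewrite (lt_eqF b0) (lt_gtF b0) tE -?cE ?lt_eqF//.
  rewrite -[phi - th](subrK pi) tanDpi tanK ?in_itv/=; last by lra.
  by congr pair; ring.
- have c0 : 0 < cos (phi - th) by apply: cos_gt0_pihalf; lra.
  have b0 : 0 < r * cos (th - phi) by rewrite cE mulr_gt0.
  rewrite (gt_eqF b0) b0 tE ?gt_eqF//.
  rewrite tanK ?in_itv/=; last by lra.
  by congr pair; ring.
- rewrite h cosN cos_pihalf mulr0 eqxx.
  have -> : phi - th = pi / 2 by lra.
  by rewrite sin_pihalf mulr1; congr pair; lra.
Qed.

Lemma le_asin (x y : K) : -1 <= y <= 1 -> - (pi / 2) <= x <= pi / 2 ->
  sin x <= y -> x <= asin y.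
Proof.
move=> yI xI sxy; rewrite leNgt; apply/negP => h.
have := asin_geNpi2 yI; have := asin_lepi2 yI => h1 h2.
have : sin (asin y) < sin x.
  by rewrite ltr_sin// in_itv/=; lra.
by rewrite asinK ?in_itv//; lra.
Qed.

Lemma asin_le (x y : K) : -1 <= y <= 1 -> - (pi / 2) <= x <= pi / 2 ->
  y <= sin x -> asin y <= x.
Proof.
move=> yI xI sxy; rewrite leNgt; apply/negP => h.
have := asin_geNpi2 yI; have := asin_lepi2 yI => h1 h2.
have : sin x < sin (asin y).
  by rewrite ltr_sin// in_itv/=; lra.
by rewrite asinK ?in_itv//; lra.
Qed.

Lemma iota_polar phi a r th : 0 < a -> 0 < r ->
  phi - 3 * pi / 2 < th < phi + pi / 2 ->
  a <= r * `|cos (th - phi)| \/ 0 <= sin (phi - th) /\ a <= r ->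
  iota_curve phi a (r * cos (th - phi)) (r, th).
Proof.
move=> a0 r0 thI H; have pi0 := pi_gt0 K.
have cE : cos (th - phi) = cos (phi - th) by rewrite -cosN opprB.
set b := r * cos (th - phi).
have z1 : cos (phi - th) != 0 -> r = b / cos (phi - th).
  by move=> c0; rewrite /b cE mulfK.
have sE : cos (phi - th) = sin (th - phi + pi / 2) by rewrite sinDpihalf cE.
have small : `|b| < a -> [/\ 0 <= sin (phi - th), a <= r & -1 <= b / a <= 1].
  move=> ba; have [h|[h1 h2]] := H.
    by move: ba; rewrite /b normrM gtr0_norm// ltNge h.
  split=> //; move: ba; rewrite ltr_norml => ba.
  by rewrite ler_pdivlMr// ler_pdivrMr//; lra.
rewrite /iota_curve /=; have [h|h|h] := ltgtP (th - phi) (- (pi / 2)).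
- have c0 : 0 < cos (phi - th - pi) by apply: cos_gt0_pihalf; lra.
  have c1 : cos (phi - th) < 0.
    by move: c0; rewrite [cos (_ - pi)]cosB cospi sinpi; lra.
  have b0 : b < 0 by rewrite /b cE pmulr_rlt0.
  have /orP[ab|ab] : (b <= - a) || (- a < b) by case: lerP.
    by apply: Or33; apply: Or33; split=> //=; [lra|apply: z1; rewrite lt_eqF].
  have [|s0 ar baI] := small; first by rewrite ltr0_norm//; lra.
  apply: Or33; apply: Or32; split; [by rewrite ab|rewrite /=|by apply: z1; rewrite lt_eqF].
  have th1 : phi - pi <= th.
    rewrite leNgt; apply/negP => h2.
    have : 0 < sin (phi - th - pi) by apply: sin_gt0_pi; lra.
    by rewrite sinB cospi sinpi; lra.
  have := @asin_le (th - phi + pi / 2) (b / a) baI ltac:(lra).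
  rewrite -sE ler_pdivrMr// /b cE => /(_ _)/wrap[|]; last by lra.
  by rewrite mulrC ler_nM2l.
- have c1 : 0 < cos (phi - th) by apply: cos_gt0_pihalf; lra.
  have b0 : 0 < b by rewrite /b cE mulr_gt0.
  have /orP[ab|ab] : (a <= b) || (b < a) by case: lerP.
    by apply: Or31; split=> //=; [lra|apply: z1; rewrite gt_eqF].
  have [|s0 ar baI] := small; first by rewrite gtr0_norm.
  apply: Or32; split; [by rewrite b0|rewrite /=|by apply: z1; rewrite gt_eqF].
  have th1 : th <= phi.
    rewrite leNgt; apply/negP => h2.
    have : 0 < sin (th - phi) by apply: sin_gt0_pi; lra.
    by rewrite -opprB sinN; lra.
  have := @le_asin (th - phi + pi / 2) (b / a) baI ltac:(lra).
  rewrite -sE ler_pdivlMr// /b cE => /(_ _)/wrap[|]; last by lra.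
  by rewrite mulrC ler_pM2r.
- have b0 : b = 0 by rewrite /b h cosN cos_pihalf mulr0.
  have [|s0 ar _] := small; first by rewrite b0 normr0.
  by apply: Or33; apply: Or31; split=> //=; lra.
Qed.

(** A whole line lies in the half-plane of direction phi, or phi - pi when b is negative. A point of
    a cut line has modulus at least [a], so it lies in the half-plane of its own argument. *)
Lemma iota_sub phi a b z p q : 0 < a -> p < phi < q ->
  iota_curve phi a b z -> Hunion `]p - pi, q[%classic a z.
Proof.
move=> a0 phiI; have pi0 := pi_gt0 K.
have mk th : p - pi < th < q -> th = z.2 -> a <= z.1 -> Hunion `]p - pi, q[%classic a z.
  move=> thI thE az; exists th; first by rewrite /= in_itv.
  by split; [lra|rewrite thE subrr cos0 divr1].
have sE : cos (phi - z.2) = sin (z.2 - phi + pi / 2).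
  by rewrite sinDpihalf -cosN opprB.
move=> [[ab zI z1]|[bI zI z1]|[[b0 az zI]|[bI zI z1]|[ab zI z1]]].
- exists phi; first by rewrite /= in_itv/=; lra.
  split=> //; rewrite z1 ler_wpM2r// invr_ge0.
  by apply: ltW; apply: cos_gt0_pihalf; lra.
- have [b0 ba] := andP bI.
  have baI : -1 <= b / a <= 1 by rewrite ler_pdivlMr// ler_pdivrMr//; lra.
  have h1 : asin (b / a) < pi / 2.
    by apply: asin_ltpi2; rewrite ltr_pdivrMr// ler_pdivlMr//; lra.
  apply: (mk z.2) => //; first by lra.
  have c0 : 0 < cos (phi - z.2) by apply: cos_gt0_pihalf; lra.
  rewrite z1 ler_pdivlMr// mulrC -ler_pdivlMr// sE.
  have h2 : z.2 - phi + pi / 2 <= asin (b / a) by lra.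
  rewrite leNgt; apply/negP; rewrite -{1}[b / a]asinK ?in_itv// ltr_sin; first by lra.
    by rewrite in_itv/=; have := asin_geNpi2 baI; lra.
  by rewrite in_itv/=; lra.
- by apply: (mk z.2) => //; rewrite zI; lra.
- have [ab b0] := andP bI.
  have baI : -1 <= b / a <= 1 by rewrite ler_pdivlMr// ler_pdivrMr//; lra.
  have h1 : - (pi / 2) < asin (b / a).
    by apply: asin_gtNpi2; rewrite ltr_pdivlMr// ler_pdivrMr//; lra.
  apply: (mk z.2) => //; first by lra.
  have c0 : 0 < cos (phi - z.2 - pi) by apply: cos_gt0_pihalf; lra.
  have c1 : cos (phi - z.2) < 0.
    by move: c0; rewrite [cos (_ - pi)]cosB cospi sinpi; lra.
  rewrite z1 ler_ndivlMr// mulrC -ler_pdivrMr// sE.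
  have h2 : asin (b / a) <= z.2 - phi + pi / 2 by lra.
  rewrite leNgt; apply/negP; rewrite -{1}[b / a]asinK ?in_itv// ltr_sin; first by lra.
    by rewrite in_itv/=; lra.
  by rewrite in_itv/=; have := asin_lepi2 baI; lra.
- exists (phi - pi); first by rewrite /= in_itv/=; lra.
  have c0 : 0 < cos (phi - pi - z.2) by apply: cos_gt0_pihalf; lra.
  split; first by lra.
  have E : cos (phi - pi - z.2) = - cos (phi - z.2).
    have -> : phi - pi - z.2 = phi - z.2 - pi by ring.
    by rewrite [LHS]cosB cospi sinpi; ring.
  rewrite z1 E; rewrite E in c0.
  rewrite invrN mulrN -mulNr ler_wnM2r ?invr_le0; lra.
Qed.

(** The disc only removes an initial part of a line, the argument being monotone along it. Hence a
    segment lies on the curve as soon as its first point does, which suits estimates that run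
    backwards. *)
Lemma iota_up phi a b s t : 0 < a -> s <= t ->
  iota_curve phi a b (line phi b s) -> iota_curve phi a b (line phi b t).
Proof.
move=> a0 st; have pi0 := pi_gt0 K; rewrite /iota_curve /=.
have := atan_ltpi2 (t / b); have := atan_gtNpi2 (t / b) => t1 t2.
have z1 c : b != 0 -> cos (phi - c) = `|b|^-1 * b * cos (atan (t / b)) ->
    Num.sqrt (b ^+ 2 + t ^+ 2) = b / cos (phi - c).
  move=> b0 ->; rewrite cos_atan.
  have -> : Num.sqrt (b ^+ 2 + t ^+ 2) = `|b| * Num.sqrt (1 + (t / b) ^+ 2).
    rewrite -sqrtr_sqr -sqrtrM ?sqr_ge0//; congr Num.sqrt; field; exact: b0.
  field; rewrite normr_eq0 b0/= gt_eqF// sqrtr_gt0 ltr_pwDl ?sqr_ge0//.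
have z1p : 0 < b -> Num.sqrt (b ^+ 2 + t ^+ 2) = b / cos (phi - (phi - atan (t / b))).
  move=> b0; apply: z1; rewrite ?gt_eqF// gtr0_norm// mulVf ?gt_eqF// mul1r.
  by congr cos; ring.
have z1n : b < 0 -> Num.sqrt (b ^+ 2 + t ^+ 2) = b / cos (phi - (phi - pi - atan (t / b))).
  move=> b0; apply: z1; rewrite ?lt_eqF// ltr0_norm// invrN mulNr mulVf ?lt_eqF// mulN1r.
  have -> : phi - (phi - pi - atan (t / b)) = atan (t / b) + pi by ring.
  by rewrite cosD cospi sinpi; ring.
rewrite /line; move=> [[ab zI _]|[bI zI _]|[[b0 az zI]|[bI zI _]|[ab zI _]]].
- have b0 : 0 < b by exact: lt_le_trans ab.
  rewrite gt_eqF// b0 /=; apply: Or31; split=> //; [lra|exact: z1p].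
- have [b0 ba] := andP bI.
  move: zI; rewrite gt_eqF// b0 /= => zI; apply: Or32; split=> //; last exact: z1p.
  have : atan (s / b) <= atan (t / b) by apply: le_atan; rewrite ler_pM2r ?invr_gt0.
  lra.
- move: az; rewrite b0 eqxx /= => az; apply: Or33; apply: Or31; split=> //; lra.
- have [ab b0] := andP bI.
  move: zI; rewrite lt_eqF// (lt_gtF b0) /= => zI; apply: Or33; apply: Or32; split=> //; last exact: z1n.
  have : atan (t / b) <= atan (s / b) by apply: le_atan; rewrite ler_nM2r ?invr_lt0.
  lra.
- have b0 : b < 0 by lra.
  rewrite lt_eqF// (lt_gtF b0) /=; apply: Or33; apply: Or33; split=> //; [lra|exact: z1n].
Qed.

Lemma line_continuous phi b : continuous (line phi b).
Proof.
move=> s; rewrite /line; case: eqVneq => [b0|b0].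
  exact: cont_pair1.
apply: (@cvg_pair _ _ _ _ (nbhs (Num.sqrt (b ^+ 2 + s ^+ 2)))
  (nbhs ((if 0 < b then phi else phi - pi) - atan (s / b)))).
  apply: (continuous_comp (f := fun s => b ^+ 2 + s ^+ 2)); last exact: sqrt_continuous.
  by apply: cvgD; [exact: cvg_cst|exact: exprn_continuous].
apply: cvgB; first exact: cvg_cst.
apply: (continuous_comp (f := fun s => s / b)); last exact: continuous_atan.
by apply: cvgM; [exact: cvg_id|exact: cvg_cst].
Qed.

Lemma line_hasd phi b s :
  hasd (fun s => cproj (line phi b s)) s (cexp ((phi - pi / 2) *i)).
Proof.
apply: (hasd_ext (f := fun s => (s - 0)%:C * cexp ((phi - pi / 2) *i) + b%:C * cexp (phi *i))).
  by move=> t; rewrite cproj_line subr0 addrC.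
rewrite -[X in hasd _ _ X]addr0; apply: hasdD; [exact: hasd_real|exact: hasd_cst].
Qed.

Lemma normc_cexp_i (x : K) : normc (cexp (x *i)) = 1.
Proof. by rewrite normc_cexp/= expR0. Qed.

End Geometry.

(** * Arbitrary matrix norms and the L1 norm along a curve *)

Section MatrixNorm.
Context {K : realType} (n : nat) (N : 'M[K[i]]_n -> K).
Hypothesis hN : is_norm N.
Implicit Types A B : 'M[K[i]]_n.

Lemma mnormZ c A : N (c *: A) = normc c * N A.
Proof.
have [_ h _] := hN; apply: (@complexI K); rewrite [RHS]rmorphM; exact: h.
Qed.

Lemma mnormD A B : N (A + B) <= N A + N B.
Proof. by have [h _ _] := hN. Qed.

Lemma mnorm0 : N 0 = 0.
Proof. by rewrite -(scale0r (0 : 'M[K[i]]_n)) mnormZ normc0 mul0r. Qed.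

Lemma mnormN A : N (- A) = N A.
Proof. by rewrite -scaleN1r mnormZ normcN normc1 mul1r. Qed.

Lemma mnorm_ge0 A : 0 <= N A.
Proof. by have := mnormD A (- A); rewrite subrr mnorm0 mnormN; lra. Qed.

Lemma mnorm_le_entries A :
  N A <= \sum_i \sum_j normc (A i j) * N (delta_mx i j).
Proof.
have sumle (I : finType) (F : I -> 'M[K[i]]_n) : N (\sum_i F i) <= \sum_i N (F i).
  elim/big_rec2: _ => [|i x y _ h]; first by rewrite mnorm0.
  by apply: le_trans (mnormD _ _) _; rewrite lerD2l.
rewrite {1}(matrix_sum_delta A); apply: le_trans (sumle _ _) _.
apply: ler_sum => i _; apply: le_trans (sumle _ _) _.
by apply: ler_sum => j _; rewrite mnormZ.
Qed.

Lemma mnorm_dist A B : `|N A - N B| <= N (A - B).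
Proof.
have h1 := mnormD (A - B) B; have h2 := mnormD (B - A) A.
rewrite !subrK in h1 h2.
have : N (B - A) = N (A - B) by rewrite -mnormN opprB.
by rewrite ler_norml; lra.
Qed.

Lemma mnorm_small (A : 'M[K[i]]_n) (d : K) : 0 <= d -> (forall i j, normc (A i j) <= d) ->
  N A <= d * \sum_i \sum_j N (delta_mx i j).
Proof.
move=> d0 h; apply: le_trans (mnorm_le_entries A) _.
rewrite mulr_sumr; apply: ler_sum => i _; rewrite mulr_sumr.
by apply: ler_sum => j _; rewrite ler_wpM2r// mnorm_ge0.
Qed.

Lemma mnorm_continuous (T : topologicalType) (F : T -> 'M[K[i]]_n) x :
  (forall i j, ccont (fun w => F w i j) x) -> {for x, continuous (fun w => N (F w))}.
Proof.
move=> cF; apply/cvgrPdist_le => e e0.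
pose S := \sum_i \sum_j N (delta_mx i j : 'M[K[i]]_n) + 1.
have S0 : 0 < S.
  by rewrite ltr_wpDl// sumr_ge0// => i _; rewrite sumr_ge0// => j _; exact: mnorm_ge0.
have eS : 0 < e / S by rewrite divr_gt0.
have h : \forall w \near x, forall p : 'I_n * 'I_n, normc (F w p.1 p.2 - F x p.1 p.2) <= e / S.
  by apply: filter_forall => p; exact: cF.
apply: filterS h => w h; rewrite distrC.
apply: le_trans (mnorm_dist _ _) _.
apply: le_trans (@mnorm_small _ (e / S) (ltW eS) _) _.
  by move=> i j; have := h (i, j); rewrite !mxE.
by rewrite -[leRHS](@divfK _ S) ?gt_eqF// ler_wpM2l ?(ltW eS)// /S lerDl.
Qed.

Lemma rV_entry_le m (v : 'rV[K]_m) i : `|v ord0 i| <= `|v|.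
Proof.
have /mapP[j Hj ->] : `|v ord0 i| \in [seq `|v x.1 x.2| | x : 'I_1 * 'I_m].
  by apply/mapP; exists (ord0, i) => //=; rewrite mem_enum.
by rewrite [leRHS]/Num.Def.normr /= mx_normrE; apply/bigmax_geP; right => /=; exists j.
Qed.

(* All norms are equivalent: [N] attains its minimum on the compact unit sphere of the real coordinates. *)
Lemma mnorm_entry : exists2 C : K, 0 < C & forall A i j, normc (A i j) <= C * N A.
Proof.
pose I : finType := (bool * ('I_n * 'I_n))%type.
pose dec (v : 'rV[K]_#|I|) : 'M[K[i]]_n := \matrix_(i, j)
  (v ord0 (enum_rank ((true, (i, j)) : I)) +i* v ord0 (enum_rank ((false, (i, j)) : I))).
pose enc (A : 'M[K[i]]_n) : 'rV[K]_#|I| := \row_k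
  (let: (b, (i, j)) := enum_val k in if b then complex.Re (A i j) else complex.Im (A i j)).
have encK A : dec (enc A) = A.
  by apply/matrixP => i j; rewrite !mxE !enum_rankK; case: (A i j).
have decZ (c : K) v : dec (c *: v) = c%:C *: dec v.
  by apply/matrixP => i j; rewrite !mxE; apply: eqc; rewrite ?Re_prod ?Im_prod/=; ring.
have dec0 v : dec v = 0 -> v = 0.
  move=> /matrixP h; apply/rowP => k; rewrite mxE -(enum_valK k).
  case: (enum_val k) => b [i j]; have := h i j; rewrite !mxE => -[h1 h2].
  by case: b.
have cdec v : {for v, continuous (fun v => N (dec v))}.
  apply: mnorm_continuous => i j; apply/ccontP; split.
    rewrite (_ : (fun w => _) = fun w : 'rV[K]_#|I| => w ord0 (enum_rank ((true, (i, j)) : I))).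
      exact: coord_continuous.
    by apply/funext => w; rewrite mxE.
  rewrite (_ : (fun w => _) = fun w : 'rV[K]_#|I| => w ord0 (enum_rank ((false, (i, j)) : I))).
    exact: coord_continuous.
  by apply/funext => w; rewrite mxE.
pose S := [set v : 'rV[K]_#|I| | `|v| = 1].
have cS : compact S.
  apply: bounded_closed_compact.
    by exists 1; split; [exact: num_real|move=> x x1 v /= ->; exact: ltW].
  rewrite (_ : S = (fun v => `|v|) @^-1` [set 1])//.
  by apply: closed_comp => [v _|]; [exact: norm_continuous|exact: closed_eq].
have entry A i j : normc (A i j) <= 2 * `|enc A|.
  apply: le_trans (normc_le_ReIm _) _; rewrite mulr2n mulrDl mul1r; apply: lerD.
    apply: le_trans (rV_entry_le _ (enum_rank ((true, (i, j)) : I))).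
    by rewrite mxE enum_rankK.
  apply: le_trans (rV_entry_le _ (enum_rank ((false, (i, j)) : I))).
  by rewrite mxE enum_rankK.
have [S0|nS] := pselect (S !=set0); last first.
  exists 1 => // A i j; rewrite mul1r.
  suff -> : A = 0 by rewrite mxE normc0 mnorm0.
  rewrite -[A]encK; have [->|vn0] := eqVneq (enc A) 0.
    by apply/matrixP => i' j'; rewrite !mxE.
  exfalso; apply: nS; exists (`|enc A|^-1 *: enc A).
  by rewrite /S /= normrZ normfV normr_id mulVf// normr_eq0.
have [c cS' hc] := EVT_min_rV S0 cS (continuous_subspaceT cdec).
have c1 : `|c| = 1 by move: cS'; rewrite inE.
have Nc0 : 0 < N (dec c).
  rewrite lt_neqAle mnorm_ge0 andbT eq_sym; apply/eqP => h.
  have [_ _ /(_ _ h)/dec0 c0] := hN.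
  by move: c1; rewrite c0 normr0 => /eqP; rewrite eq_sym oner_eq0.
exists (2 / N (dec c)); first by rewrite divr_gt0.
move=> A i j; apply: le_trans (entry A i j) _.
rewrite -mulrA ler_wpM2l// mulrC ler_pdivlMr//.
have [->|vn0] := eqVneq (enc A) 0; first by rewrite normr0 mul0r mnorm_ge0.
have v0 : 0 < `|enc A| by rewrite normr_gt0.
have h : (`|enc A|^-1 *: enc A) \in S.
  by rewrite inE /S /= normrZ normfV normr_id mulVf// normr_eq0.
have := hc _ h; rewrite decZ mnormZ normc_real encK normfV normr_id.
by rewrite mulrC ler_pdivlMr// mulrC.
Qed.

(** The L1 norm is used through an antiderivative of the norm of R along the line, in the form
    required by [mean_value_le]: its increment over a segment is at most the integral over the whole
    curve. *)
Lemma L1_antiderivative (R : ucover K -> 'M[K[i]]_n) (a phi b s t : K) :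
  0 < a -> s <= t -> iota_curve phi a b (line phi b s) ->
  (forall z, iota_curve phi a b z -> forall i j, ccont (fun w => R w i j) z) ->
  exists G : K -> K,
    (forall x, s <= x <= t -> is_derive x (1 : K) G (N (R (line phi b x)))) /\
    ((G t - G s)%:E <= L1_iota N R phi a b)%E.
Proof.
move=> a0 st sI cR.
pose f x := N (R (line phi b x)).
have cf x : iota_curve phi a b (line phi b x) -> {for x, continuous f}.
  move=> xI; apply: mnorm_continuous => i j.
  by apply: (ccont_comp (f := fun w => R w i j)); [exact: line_continuous|exact: cR].
have inI x : s <= x -> iota_curve phi a b (line phi b x).
  by move=> sx; apply: iota_up sI.
have [|G hG] := @antiderivative K (fun x => (f x)%:C) s t st.
  move=> x /andP[sx _]; apply/ccontP; split => /=; first by apply: cf; exact: inI.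
  exact: cst_continuous.
exists (fun x => complex.Re (G x)); split=> [x /hG[]//|].
have fin : (\int[lebesgue_measure]_(x in `[s, t]) (f x)%:E =
    (complex.Re (G t) - complex.Re (G s))%:E)%E.
  move: st; rewrite le_eqVlt => /predU1P[<-|st].
    by rewrite set_itv1 integral_set1 subrr.
  rewrite (@continuous_FTC2 _ f (fun x => complex.Re (G x)))//.
  - apply: continuous_in_subspaceT => x; rewrite inE/= in_itv/= => /andP[sx _].
    by apply: cf; exact: inI.
  - have cG x : s <= x <= t -> {for x, continuous (fun x => complex.Re (G x))}.
      by move=> /hG[h _]; exact: is_derive_continuous h.
    split.
    + by move=> x; rewrite in_itv/= => /andP[/ltW sx /ltW xt]; case: (hG x) => [|[]]; rewrite ?sx.
    + by apply: cvg_at_right_filter; apply: cG; rewrite lexx ltW.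
    + by apply: cvg_at_left_filter; apply: cG; rewrite lexx ltW.
  - move=> x; rewrite in_itv/= => /andP[/ltW sx /ltW xt].
    by rewrite derive1E; case: (hG x) => [|[]]; rewrite ?sx.
rewrite -fin /L1_iota; apply: ge0_subset_integral => //=.
- apply: is_interval_measurable => x y /= xI _ z /andP[xz _]; exact: iota_up xI.
- apply/measurable_EFinP; apply: subspace_continuous_measurable_fun.
    apply: is_interval_measurable => x y /= xI _ z /andP[xz _]; exact: iota_up xI.
  by apply: continuous_in_subspaceT => x; rewrite inE/=; exact: cf.
- by move=> x _; rewrite lee_fin mnorm_ge0.
by move=> x /=; rewrite in_itv/= => /andP[sx _]; exact: inI.
Qed.

End MatrixNorm.

(** * The Volterra estimate on a segment *)

Section Volterra.
Context {K : realType}.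

(* The variation of constants formula, with the homogeneous propagators backwards bounded by [kappa = expR (- K2)]. *)
Lemma volterra_segment (n : nat) (p dp u : 'I_n -> K -> K[i])
    (r : 'I_n -> 'I_n -> K -> K[i]) (G rho : K -> K) (s t K2 m : K) :
  let kappa := expR (- K2) in
  s <= t ->
  (forall i x, s <= x <= t -> hasd (p i) x (dp i x)) ->
  (forall i x, s <= x <= t ->
    hasd (u i) x (dp i x * u i x + \sum_j r i j x * u j x)) ->
  (forall x, s <= x <= t -> is_derive x (1 : K) G (rho x)) ->
  (forall i j x, s <= x <= t -> n%:R * normc (r i j x) <= rho x) ->
  (forall i x y, s <= x -> x <= y -> y <= t -> K2 <= complex.Re (p i y - p i x)) ->
  kappa * (G t - G s) <= 2^-1 ->
  (forall i, normc (u i t) <= m) ->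
  forall i, normc (u i s) <= 2 * kappa * m /\
    normc (u i s - cexp (p i s - p i t) * u i t) <= 2 * kappa ^+ 2 * (G t - G s) * m.
Proof.
move=> kappa st hp hu hG hr hK hsmall hm i0.
have k0 : 0 < kappa by rewrite expR_gt0.
have n0 : 0 < n%:R :> K by rewrite ltr0n (leq_ltn_trans _ (ltn_ord i0)).
have cu i x : s <= x <= t -> ccont (u i) x by move=> /(hu i)/hasd_ccont.
have rho0 x : s <= x <= t -> 0 <= rho x.
  by move=> xI; apply: le_trans (hr i0 i0 x xI); rewrite mulr_ge0 ?normc_ge0.
have [i1 [c [cI hmax]]] := @fam_max K n (fun i x => normc (u i x)) s t i0 st
  (fun i x xI => ccont_normc (cu i x xI)).
set M := normc (u i1 c) in hmax.
have M0 : 0 <= M by exact: normc_ge0.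
have key i y : s <= y <= t ->
    normc (u i y - cexp (p i y - p i t) * u i t) <= kappa * M * (G t - G y).
  move=> /andP[sy yt].
  (* The propagated component: its derivative contains only the perturbation r, whose effect is at
     most kappa M [rho]. *)
  pose v x := cexp (p i y - p i x) * u i x.
  have sub x : y <= x <= t -> s <= x <= t.
    by move=> /andP[yx xt]; rewrite (le_trans sy yx).
  have hv x : y <= x <= t -> hasd v x (cexp (p i y - p i x) * \sum_j r i j x * u j x).
    move=> /sub xI.
    have h1 := hasd_cexp (hasdB (hasd_cst (p i y) x) (hp i x xI)).
    by apply: hasd_eq (hasdM h1 (hu i x xI)) _; ring.
  have := @mean_value_le K v (fun x => kappa * M * G x) _ (fun x => kappa * M * rho x) y t yt hv.
  rewrite /v subrr cexp0 mul1r normc_subC mulrBr; apply.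
    by move=> x /sub xI; apply: is_derive_eq; [exact: is_deriveZ (hG x xI)|].
  move=> x xI; have xI' := sub x xI; have /andP[yx xt] := xI.
  rewrite normcM -mulrA; apply: ler_pM; rewrite ?normc_ge0//.
    rewrite normc_cexp ler_expR; have := hK i y x sy yx xt.
    by rewrite !ReD !ReN; lra.
  apply: le_trans (normc_sum _ _ _) _.
  apply: (@le_trans _ _ (\sum_(j < n) rho x / n%:R * M)).
    apply: ler_sum => j _; rewrite normcM; apply: ler_pM; rewrite ?normc_ge0//.
      by rewrite ler_pdivlMr// mulrC; exact: hr.
    exact: hmax.
  rewrite sumr_const card_ord (_ : _ *+ n = M * rho x)//.
  by rewrite -[LHS]mulr_natl; field; rewrite gt_eqF.
have mono y : s <= y <= t -> G t - G y <= G t - G s /\ 0 <= G t - G y.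
  move=> /andP[sy yt].
  have inc x1 x2 : s <= x1 -> x1 <= x2 -> x2 <= t -> G x1 <= G x2.
    move=> h1 h2 h3; have := @mean_value_le K (fun=> 0) G (fun=> 0) rho x1 x2 h2.
    move=> /(_ (fun x _ => hasd_cst 0 x)) H.
    rewrite -subr_ge0; apply: le_trans (H _ _).
    - exact: normc_ge0.
    - by move=> x /andP[x1x xx2]; apply: hG; rewrite (le_trans h1)//= (le_trans xx2).
    - by move=> x /andP[x1x xx2]; rewrite normc0 rho0// (le_trans h1)//= (le_trans xx2).
  have := inc s y (lexx _) sy yt; have := inc y t sy yt (lexx _); lra.
have prop i y : s <= y <= t -> normc (cexp (p i y - p i t) * u i t) <= kappa * m.
  move=> /andP[sy yt]; rewrite normcM; apply: ler_pM; rewrite ?normc_ge0//.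
  rewrite normc_cexp ler_expR; have := hK i y t sy yt (lexx _).
  by rewrite !ReD !ReN; lra.
(* At the point where the maximum M is attained, [hsmall] bounds the integral term by M / 2, which
   is absorbed. *)
have M2 : M <= 2 * kappa * m.
  have h1 := key i1 c cI; have h2 := prop i1 c cI; have [h3 h3'] := mono c cI.
  have := normcD (u i1 c - cexp (p i1 c - p i1 t) * u i1 t) (cexp (p i1 c - p i1 t) * u i1 t).
  rewrite subrK -/M => h4.
  have h5 : kappa * M * (G t - G c) <= M * 2^-1.
    rewrite mulrAC mulrC ler_wpM2l//; apply: le_trans hsmall.
    by rewrite ler_wpM2l// ltW.
  lra.
have sI : s <= s <= t by rewrite lexx.
split; first by apply: le_trans M2; exact: hmax.
apply: le_trans (key i0 s sI) _.
have [_ G0] := mono s sI.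
have -> : 2 * kappa ^+ 2 * (G t - G s) * m = kappa * (2 * kappa * m) * (G t - G s) by ring.
by rewrite ler_wpM2r// ler_wpM2l// ltW.
Qed.

End Volterra.

(** * Matrix derivatives by entries, and complex Cauchy sequences *)

Section MatrixDerivative.
Context {K : realType}.

(** At positive modulus [cproj] separates z from its neighbours, so the quotient can be cleared. *)
Lemma is_cderive_cd (m n : nat) (f : ucover K -> 'M[K[i]]_(m, n)) z d :
  0 < z.1 -> is_cderive f z d <-> forall i j, cd (fun w => f w i j) z (d i j).
Proof.
move=> z0.
have qE (w : ucover K) i j : cproj w != cproj z ->
    normc (d i j - ((cproj w - cproj z)^-1 *: (f w - f z)) i j) * normc (cproj w - cproj z)
    = normc (f w i j - f z i j - d i j * (cproj w - cproj z)).
  move=> wz; rewrite -normcM !mxE mulrBl mulrAC mulVf ?subr_eq0// mul1r.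
  by rewrite normc_subC.
split=> [/cvg_ballP h i j e e0|h].
  have e0' : 0 < e%:C :> K[i] by rewrite ltcR.
  have := h _ e0'; rewrite near_withinE => h'.
  near=> w.
  have [->|wz] := eqVneq w z; first by rewrite !subrr mulr0 subrr normc0 mulr0.
  have cwz : cproj w != cproj z.
    by move: wz; near: w; exact: cproj_neq.
  rewrite -qE// ler_wpM2r ?normc_ge0//.
  have hb : @mx_ball m n K[i] K[i]^o d e%:C ((cproj w - cproj z)^-1 *: (f w - f z)).
    by move: wz; near: w; exact: h'.
  have [_ hb'] := hb.
  have hij : (normc (d i j - ((cproj w - cproj z)^-1 *: (f w - f z)) i j))%:C < e%:C := hb' i j.
  by move: hij; rewrite ltcR => /ltW.
apply/cvg_ballP => e; rewrite ltcE/= => /andP[/eqP eIm e0].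
have eE : e = (complex.Re e)%:C by apply: eqc; rewrite //= eIm.
have e2 : 0 < complex.Re e / 2 by rewrite divr_gt0.
have h' : \forall w \near z, forall p : 'I_m * 'I_n,
    normc (f w p.1 p.2 - f z p.1 p.2 - d p.1 p.2 * (cproj w - cproj z)) <=
    complex.Re e / 2 * normc (cproj w - cproj z).
  apply: (@filter_forall _ ('I_m * 'I_n)%type (fun p w =>
    normc (f w p.1 p.2 - f z p.1 p.2 - d p.1 p.2 * (cproj w - cproj z)) <=
    complex.Re e / 2 * normc (cproj w - cproj z)) (nbhs z)) => p.
  exact: h.
rewrite near_withinE; near=> w => wz; split=> [|i j]; first by rewrite eE ltcR.
have cwz : cproj w != cproj z by move: wz; near: w; exact: cproj_neq.
have n0 : 0 < normc (cproj w - cproj z).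
  rewrite lt_neqAle normc_ge0 andbT eq_sym; apply: contra cwz => /eqP/normc_eq0/eqP.
  by rewrite subr_eq0.
suff hij : (normc (d i j - ((cproj w - cproj z)^-1 *: (f w - f z)) i j))%:C < (complex.Re e)%:C.
  by rewrite -eE in hij; exact: hij.
rewrite ltcR.
have : forall p : 'I_m * 'I_n,
    normc (f w p.1 p.2 - f z p.1 p.2 - d p.1 p.2 * (cproj w - cproj z)) <=
    complex.Re e / 2 * normc (cproj w - cproj z) by near: w.
move=> /(_ (i, j))/=; rewrite -qE// ler_pM2r// => /le_lt_trans; apply.
by rewrite ltr_pdivrMr// ltr_pMr// ltr1n.
Unshelve. all: by end_near. Qed.

Lemma cauchy_complex (u : nat -> K[i]) :
  (forall e : K, 0 < e -> exists k0, forall k m, (k0 <= k)%N -> (k0 <= m)%N ->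
    normc (u k - u m) <= e) ->
  exists l, forall e : K, 0 < e -> exists k0, forall k, (k0 <= k)%N -> normc (u k - l) <= e.
Proof.
move=> h.
have h2 j : 0 < 2 ^- j :> K by rewrite invr_gt0 exprn_gt0.
have /choice[N hN] j := h _ (h2 j).
have [|l hl] := @geometric_limit K (fun j => u (N j)) (fun j => 2 ^- j).
  move=> j m; have hj := hN j (N j) (maxn (N j) (N m)) (leqnn _) (leq_maxl _ _).
  have hm := hN m (maxn (N j) (N m)) (N m) (leq_maxr _ _) (leqnn _).
  by apply: le_trans (normcB_tri _ (u (maxn (N j) (N m))) _) _; rewrite lerD.
(* 3 is 1 for comparing u k with the subsequence plus 2 from [geometric_limit]. *)
exists l => e e0; have [j hj] := half_pow_small 3 e0.
exists (N j) => k Nk; have h3 := hj j (leqnn j).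
have h4 := hN j k (N j) Nk (leqnn _); have h5 := hl j.
have := normcB_tri (u k) (u (N j)) l; lra.
Qed.

Lemma hasd_derive1 (h : K -> K[i]) x v : hasd h x v ->
  derive1 (fun t => complex.Re (h t)) x +i* derive1 (fun t => complex.Im (h t)) x = v.
Proof.
by move=> [h1 h2]; apply: eqc; rewrite /= derive1E; [case: h1|case: h2].
Qed.

End MatrixDerivative.

(** * The subdominant solution: estimates, construction and asymptotics *)

Section Levinson.
Context {K : realType} (n : nat) (a phimin phimax : K).
Hypothesis ha : 0 < a.
Variables (N : 'M[K[i]]_n -> K) (Lambda R : ucover K -> 'M[K[i]]_n) (jo : 'I_n).
Hypothesis hN : is_norm N.
Let I : set K := `]phimin, phimax[%classic.
Let It : set K := `]phimin - pi, phimax[%classic.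
Let H := Hunion It a.
Variable D : set (ucover K).
Hypotheses (hD : right_domain D) (HD : H `<=` D).
Hypothesis dLambda : forall i j z, D z -> exists d, cd (fun w => Lambda w i j) z d.
Hypothesis dR : forall i j z, D z -> exists d, cd (fun w => R w i j) z d.
Hypothesis diag : forall z, H z -> is_diag_mx (Lambda z).
Hypothesis subdom : subdominant I a Lambda jo.
Hypothesis decay : S_decay N I a R.
Variable prim : 'I_n -> ucover K -> K[i].
Hypothesis hprim : forall i z, D z -> cd (prim i) z (Lambda z i i).

Let e (i : 'I_n) : K[i] := (i == jo)%:R.
Let w (T phi : K) : ucover K := (T, phi - pi / 2).
Definition sol (S : set (ucover K)) (y : 'I_n -> ucover K -> K[i]) :=
  forall i z, S z -> cd (y i) z (\sum_j (Lambda z i j + R z i j) * y j z).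
(** The vector u with y = exp (int Lambda_jj) u. *)
Definition nrm (y : 'I_n -> ucover K -> K[i]) i z := cexp (- prim jo z) * y i z.

Lemma nrmK y i z : y i z = cexp (prim jo z) * nrm y i z.
Proof. by rewrite /nrm mulrA -cexpD subrr cexp0 mul1r. Qed.

Lemma solB S y y' : sol S y -> sol S y' -> sol S (fun i z => y i z - y' i z).
Proof.
move=> h h' i z Sz; apply: cd_eq (cdB (h i z Sz) (h' i z Sz)) _.
by rewrite -sumrB; apply: eq_bigr => j _; rewrite mulrBr.
Qed.

Lemma solW y : sol D y -> sol H y.
Proof. by move=> h i z /HD; exact: h. Qed.

Lemma normc_e i : normc (e i) <= 1.
Proof. by rewrite /e; case: eqP; rewrite ?normc1 ?normc0. Qed.

Lemma subI c d : phimin < c -> d < phimax -> `[c, d]%classic `<=` I.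
Proof. by move=> h1 h2 x; rewrite /I /= !in_itv/=; lra. Qed.

Lemma iotaH phi b z a' : a <= a' -> phimin < phi < phimax -> iota_curve phi a' b z -> H z.
Proof.
move=> aa phiI zI; apply: (Hunion_le aa); apply: (iota_sub (p := phimin)) zI => //.
exact: lt_le_trans aa.
Qed.

(** Two radii occur: smallness comes from the L1 norm over the curve cut at a large [a'], whereas
    subdominance is assumed on curves cut at [a]. The first point must lie on both curves. It
    matters that kappa is fixed before eta: errors of size eta / kappa can then be propagated once
    more. *)
Lemma segment_estimate c d : phimin < c -> c <= d -> d < phimax ->
  exists2 kappa : K, 0 < kappa & forall eta : K, 0 < eta ->
  exists2 a0 : K, a <= a0 & forall a' phi b s t, a0 <= a' -> c <= phi <= d -> s <= t ->
    iota_curve phi a' b (line phi b s) -> iota_curve phi a b (line phi b s) ->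
    forall y m, sol H y -> (forall i, normc (nrm y i (line phi b t)) <= m) ->
    forall i, normc (nrm y i (line phi b s)) <= kappa * m /\
      ((forall i, i != jo -> nrm y i (line phi b t) = 0) ->
       normc (nrm y i (line phi b s) - nrm y i (line phi b t)) <= eta * m).
Proof.
move=> cI cd' dI.
have [K2 hK2] := subdom cd' (subI cI dI).
have [_ hM] := decay cd' (subI cI dI).
have [C C0 hC] := mnorm_entry hN.
pose kappa := expR (- K2).
have k0 : 0 < kappa by rewrite expR_gt0.
have n0 : 0 < n%:R :> K by rewrite ltr0n (leq_ltn_trans _ (ltn_ord jo)).
exists (2 * kappa); first by rewrite mulr_gt0.
move=> eta eta0.
(* The first entry of the minimum gives the smallness required by [volterra_segment], the second
   turns its error into eta m; n C passes from entries to the norm N. *)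
pose dl := Num.min (2 * kappa)^-1 (eta / (2 * kappa ^+ 2)) / (n%:R * C).
have nC0 : 0 < n%:R * C by rewrite mulr_gt0.
have dl0 : 0 < dl.
  by rewrite divr_gt0// lt_min invr_gt0 mulr_gt0//= divr_gt0// mulr_gt0// exprn_gt0.
have [A1 [_ hA1]] : \forall a' \near +oo, (Mtilde N R a' `[c, d] < dl%:E)%E.
  have /hM : nbhs (0%E : \bar K) [set x | (x < dl%:E)%E].
    by apply: open_ereal_lt'; rewrite lte_fin.
  exact.
exists (Num.max a (A1 + 1)); first by rewrite le_max lexx.
move=> a' phi b s t; rewrite ge_max => /andP[aa A1a] phiI st sI' sI y m hy hm i.
have phiI' : phimin < phi < phimax by lra.
have a'0 : 0 < a' := lt_le_trans ha aa.
have inH x : s <= x -> H (line phi b x).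
  by move=> sx; apply: (iotaH (lexx a) phiI'); exact: iota_up ha sx sI.
have [G [hG GL]] := @L1_antiderivative K n N hN R a' phi b s t a'0 st sI' (fun z zI i j =>
  let: ex_intro d h := dR i j (HD (iotaH aa phiI' zI)) in cd_ccont h).
have Gdl : G t - G s <= dl.
  rewrite -lee_fin; apply: le_trans GL _; apply: le_trans (ltW (hA1 a' _)); last by lra.
  by apply: ereal_sup_ubound; exists phi; rewrite /= ?in_itv//; exists b.
pose ep := cexp ((phi - pi / 2) *i) : K[i].
have chain f x d' : cd f (line phi b x) d' -> hasd (fun t => f (line phi b t)) x (d' * ep).
  move=> h; exact: cd_chain (@line_continuous K phi b x) (line_hasd phi b x) h.
pose p i' x := prim i' (line phi b x) - prim jo (line phi b x).
pose dp i' x := (Lambda (line phi b x) i' i' - Lambda (line phi b x) jo jo) * ep.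
pose r i' j x := ep * R (line phi b x) i' j.
have hp i' x : s <= x <= t -> hasd (p i') x (dp i' x).
  move=> /andP[sx _]; apply: (chain (fun z => prim i' z - prim jo z)).
  by apply: cdB; apply: hprim; apply: HD; exact: inH.
have hu i' x : s <= x <= t -> hasd (fun x => nrm y i' (line phi b x)) x
    (dp i' x * nrm y i' (line phi b x) + \sum_j r i' j x * nrm y j (line phi b x)).
  move=> /andP[sx _]; have Hx := inH x sx.
  have h1 := hasd_cexp (hasdN (chain _ _ _ (hprim jo (HD Hx)))).
  apply: hasd_eq (hasdM h1 (chain _ _ _ (hy i' _ Hx))) _.
  have -> : \sum_j (Lambda (line phi b x) i' j + R (line phi b x) i' j) * y j (line phi b x) =
     Lambda (line phi b x) i' i' * y i' (line phi b x) + \sum_j R (line phi b x) i' j * y j (line phi b x).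
    under eq_bigr do rewrite mulrDl.
    rewrite big_split/= (bigD1 i')//= big1 ?addr0// => j ji.
    have /is_diag_mxP/(_ i' j) -> := diag Hx; first by rewrite mul0r.
    by rewrite eq_sym in ji; apply: contra ji => /eqP/val_inj ->.
  rewrite /dp /nrm /r.
  have -> : \sum_j ep * R (line phi b x) i' j * (cexp (- prim jo (line phi b x)) * y j (line phi b x))
    = ep * cexp (- prim jo (line phi b x)) * \sum_j R (line phi b x) i' j * y j (line phi b x).
    by rewrite mulr_sumr; apply: eq_bigr => j _; ring.
  by ring.
have hG' x : s <= x <= t -> is_derive x (1 : K) (fun x => n%:R * C * G x) (n%:R * C * N (R (line phi b x))).
  by move=> xI; have h := hG x xI; apply: is_derive_eq; rewrite /GRing.scale/=; ring.
have hr i' j x : s <= x <= t -> n%:R * normc (r i' j x) <= n%:R * C * N (R (line phi b x)).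
  by move=> xI; rewrite -mulrA ler_wpM2l// /r normcM normc_cexp_i mul1r hC.
have hK i' x x' : s <= x -> x <= x' -> x' <= t -> K2 <= complex.Re (p i' x' - p i' x).
  move=> sx xx x't; have := hK2 i' phi b x x' phiI xx (iota_up ha sx sI) (iota_up ha (le_trans sx xx) sI).
  have der u := hasd_derive1 (line_hasd phi b u).
  rewrite (@path_int_primitive K _ (fun z => prim i' z - prim jo z)) //.
  move=> u /andP[xu _]; have Du := HD (inH u (le_trans sx xu)).
  split.
  - exact: line_continuous.
  - by rewrite der; exact: line_hasd.
  - by rewrite (funext der); exact: ccont_cst.
  - by apply: cdB; exact: hprim.
  - have [? /cd_ccont h1] := dLambda i' i' Du; have [? /cd_ccont h2] := dLambda jo jo Du.
    exact: ccontB.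
have dlE : n%:R * C * dl = Num.min (2 * kappa)^-1 (eta / (2 * kappa ^+ 2)).
  by rewrite mulrC divfK// gt_eqF.
have Gs : n%:R * C * (G t - G s) <= Num.min (2 * kappa)^-1 (eta / (2 * kappa ^+ 2)).
  by rewrite -dlE ler_wpM2l// ltW.
have small : kappa * (n%:R * C * G t - n%:R * C * G s) <= 2^-1.
  rewrite -mulrBr; apply: (@le_trans _ _ (kappa * (2 * kappa)^-1)).
    by rewrite ler_wpM2l ?(ltW k0)// (le_trans Gs)// ge_min lexx.
  by rewrite invfM mulrCA divff ?mulr1// gt_eqF.
have m0 : 0 <= m := le_trans (normc_ge0 _) (hm i).
have [h1 h2] := volterra_segment st hp hu hG' hr hK small hm i.
(* The propagator of the component [jo] is 1 and the other components vanish at t, so the value at t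
   is its own propagation. *)
split=> // ht; have -> : nrm y i (line phi b t) =
    cexp (p i s - p i t) * nrm y i (line phi b t).
  have [->|ij] := eqVneq i jo; last by rewrite ht// mulr0.
  by rewrite /p !subrr cexp0 mul1r.
apply: le_trans h2 _; rewrite ler_wpM2r// -mulrBr -/kappa.
rewrite mulrC -ler_pdivlMr ?mulr_gt0 ?exprn_gt0//.
by apply: le_trans Gs _; rewrite ge_min lexx orbT.
Qed.

Lemma wline T phi : w T phi = line phi 0 T.
Proof. by rewrite /line eqxx. Qed.

Lemma w_iota (T phi a' : K) : a' <= T -> iota_curve phi a' 0 (line phi 0 T).
Proof. by move=> aT; apply: Or33; apply: Or31; rewrite /line eqxx; split. Qed.

Lemma w_H T phi : phimin < phi < phimax -> a <= T -> H (w T phi).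
Proof. by move=> phiI aT; rewrite wline; apply: (iotaH (lexx a) phiI); exact: w_iota. Qed.

(** It lets vanishing and convergence be checked at a single point of the sector. *)
Lemma transferH z1 z2 : H z1 -> H z2 -> exists2 G : K, 0 <= G &
  forall y, sol H y -> forall m, (forall i, normc (y i z1) <= m) ->
  forall i, normc (y i z2) <= G * m.
Proof.
move=> H1 H2; have [g hg] := C1_path_exists H1 H2.
have [|G G0 hG] := @transfer K H n (fun i j z => Lambda z i j + R z i j) z1 z2 g _ hg.
  move=> i j z /HD Dz; have [? /cd_ccont h1] := dLambda i j Dz.
  by have [? /cd_ccont h2] := dR i j Dz; exact: ccontD.
by exists G.
Qed.

Lemma sol_exists z1 (c : 'I_n -> K[i]) : D z1 -> exists y, (forall i, y i z1 = c i) /\ sol D y.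
Proof.
move=> Dz1; apply: linear_system_exists => // i j z Dz.
have [d1 h1] := dLambda i j Dz; have [d2 h2] := dR i j Dz.
by exists (d1 + d2); exact: cdD.
Qed.

(** The bound at a far point of the ray is as small as desired, and going back to the point of
    modulus [a0] costs only the fixed factor kappa. So y vanishes there, and hence everywhere by
    [transferH]. *)
Lemma ray_unique phi y : phimin < phi < phimax -> sol H y ->
  (forall e : K, 0 < e -> exists T0, forall T, T0 <= T -> forall i, normc (nrm y i (w T phi)) <= e) ->
  forall i z, H z -> y i z = 0.
Proof.
move=> /andP[p1 p2] hy h0 i z Hz.
have [kappa k0 /(_ 1 ltr01)[a0 aa0 hseg]] := segment_estimate p1 (lexx phi) p2.
have Hw : H (w a0 phi) by apply: w_H => //; rewrite p1.
have phiI' : phi <= phi <= phi by rewrite lexx.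
have z0 j : y j (w a0 phi) = 0.
  rewrite nrmK; suff -> : nrm y j (w a0 phi) = 0 by rewrite mulr0.
  apply: normc_small => ep ep0.
  have [T0 hT0] := h0 (ep / kappa) (divr_gt0 ep0 k0).
  pose T := Num.max T0 a0.
  have hT : a0 <= T by rewrite le_max lexx orbT.
  have hm : forall j, normc (nrm y j (line phi 0 T)) <= ep / kappa.
    by move=> j'; rewrite -wline; apply: hT0; rewrite le_max lexx.
  have [+ _] := hseg a0 phi 0 a0 T (lexx _) phiI' hT (w_iota _ (lexx _)) (w_iota _ aa0) y _ hy hm j.
  rewrite -wline [_ * (_ / _)]mulrC divfK ?gt_eqF//.
have [G G0 hG] := transferH Hw Hz.
apply: normc_eq0; apply/eqP; rewrite eq_le normc_ge0 andbT.
have := hG y hy 0 _ i; rewrite mulr0; apply.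
by move=> j; rewrite z0 normc0.
Qed.

(* [y] is the limit of the solutions taking the value [cexp (prim jo) e_jo] at the point [w T phi], as [T] tends to infinity. *)
Definition ray_solution phi (y : 'I_n -> ucover K -> K[i]) := sol D y /\
  forall z, H z -> forall ep : K, 0 < ep -> exists T0, forall T, T0 <= T ->
  forall y', sol H y' -> (forall i, nrm y' i (w T phi) = e i) ->
  forall i, normc (y' i z - y i z) <= ep.

(** For T' <= T, the solution normalized at T is still close to e_jo at T', where the other one
    equals e_jo. Their difference is small at T' and is then carried back to modulus [a1] with the
    factor kappa. This gives a Cauchy criterion at the single point [zs]. *)
Lemma ray_solution_exists phi : phimin < phi < phimax -> exists y, ray_solution phi y.
Proof.
move=> phiI; have /andP[p1 p2] := phiI.
have [kappa k0 hseg] := segment_estimate p1 (lexx phi) p2.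
have phiI' : phi <= phi <= phi by rewrite lexx.
have [a1 aa1 hseg1] := hseg 1 ltr01.
pose zs := w a1 phi.
have Hzs : H zs by exact: w_H.
have cauchy eta : 0 < eta -> exists2 T0 : K, a1 <= T0 & forall T T' y y', T0 <= T' -> T' <= T ->
    sol H y -> sol H y' -> (forall i, nrm y i (w T phi) = e i) ->
    (forall i, nrm y' i (w T' phi) = e i) -> forall i, normc (nrm y i zs - nrm y' i zs) <= eta.
  move=> eta0; have [a2 aa2 hseg2] := hseg (eta / kappa) (divr_gt0 eta0 k0).
  exists (Num.max a1 a2); first by rewrite le_max lexx.
  move=> T T' y y'; rewrite ge_max => /andP[a1T a2T] TT hy hy' ye ye' i.
  have h1 j : normc (nrm (fun i z => y i z - y' i z) j (line phi 0 T')) <= eta / kappa.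
    have hm : forall j, normc (nrm y j (line phi 0 T)) <= 1.
      by move=> j'; rewrite -wline ye normc_e.
    have [_] := hseg2 a2 phi 0 T' T (lexx _) phiI' TT (w_iota _ a2T)
       (w_iota _ (le_trans aa2 a2T)) y 1 hy hm j.
    rewrite -!wline !ye mulr1 => /(_ _)/wrap[j' jj|h].
      by rewrite ye /e (negbTE jj).
    by rewrite /nrm mulrBr -/(nrm y j _) -/(nrm y' j _) ye'.
  have [+ _] := hseg1 a1 phi 0 a1 T' (lexx _) phiI' a1T (w_iota _ (lexx _))
     (w_iota _ aa1) _ _ (solB hy hy') h1 i.
  by rewrite -wline /nrm mulrBr [_ * (_ / _)]mulrC divfK ?gt_eqF.
(* A sequence suffices to define the limit; [cauchy] compares it with every real T afterwards. *)
have /choice[Y hY] (k : nat) : exists y, sol D y /\ forall i, nrm y i (w (a1 + k%:R) phi) = e i.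
  have Dk : D (w (a1 + k%:R) phi) by apply: HD; apply: w_H => //; rewrite (le_trans aa1)// lerDl.
  have [y [y0 hy]] := sol_exists (fun i => cexp (prim jo (w (a1 + k%:R) phi)) * e i) Dk.
  by exists y; split=> // i; rewrite /nrm y0 mulrA cexpN_mul mul1r.
have nat_above (x : K) : exists k0 : nat, forall k, (k0 <= k)%N -> x <= a1 + k%:R.
  exists (Num.bound `|x - a1|) => k kk.
  rewrite -lerBlDl; apply: le_trans (ler_norm _) _.
  by apply: le_trans (ltW (archi_boundP (normr_ge0 _))) _; rewrite ler_nat.
have /choice[l hl] i : exists l, forall ep : K, 0 < ep -> exists k0, forall k, (k0 <= k)%N ->
    normc (nrm (Y k) i zs - l) <= ep.
  apply: cauchy_complex => ep ep0; have [T0 aT0 hT0] := cauchy ep ep0.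
  have [k1 hk1] := nat_above T0; exists k1 => k m kk km.
  wlog mk : k m kk km / (m <= k)%N.
    by move=> HH; have [|/ltnW] := leqP m k => ?; [|rewrite normc_subC]; exact: HH.
  apply: (hT0 (a1 + k%:R) (a1 + m%:R)); rewrite ?lerD2l ?ler_nat//; first exact: hk1.
  - by apply: solW; have [] := hY k.
  - by apply: solW; have [] := hY m.
  - by have [] := hY k.
  - by have [] := hY m.
have [y [yz hy]] := sol_exists (fun i => cexp (prim jo zs) * l i) (HD Hzs).
exists y; split=> // z Hz ep ep0.
have [G G0 hG] := transferH Hzs Hz.
pose W := 2 * (G * normc (cexp (prim jo zs))) + 1.
have GW0 : 0 <= G * normc (cexp (prim jo zs)) by rewrite mulr_ge0 ?normc_ge0.
have W0 : 0 < W by rewrite ltr_wpDl// mulr_ge0.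
have eW : 0 < ep / W by rewrite divr_gt0.
have [T0 aT0 hT0] := cauchy _ eW.
exists T0 => T T0T y' hy' ye' i.
have near_l j : normc (nrm y' j zs - l j) <= 2 * (ep / W).
  have [k1 hk1] := nat_above T; have [k2 hk2] := hl j _ eW.
  pose k := maxn k1 k2; have [hYk Yk] := hY k.
  have h1 : normc (nrm (Y k) j zs - nrm y' j zs) <= ep / W.
    by apply: (hT0 (a1 + k%:R) T) => //; [exact: hk1 (leq_maxl _ _)|exact: solW].
  have h2 := hk2 k (leq_maxr _ _).
  have := normcB_tri (nrm y' j zs) (nrm (Y k) j zs) (l j).
  by rewrite (normc_subC (nrm y' j zs) (nrm (Y k) j zs)); lra.
have hm j : normc (y' j zs - y j zs) <= normc (cexp (prim jo zs)) * (2 * (ep / W)).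
  rewrite yz nrmK -mulrBr normcM ler_wpM2l ?normc_ge0//.
apply: le_trans (hG _ (solB hy' (solW hy)) _ hm i) _.
rewrite -[leRHS](@divfK _ W) ?gt_eqF//.
rewrite [leLHS](_ : _ = ep / W * (W - 1)); last by rewrite /W; ring.
by rewrite ler_wpM2l ?(ltW eW)// gerBl.
Qed.

(* The segment from [(r, th)] to [w T phi] lies on a line [line phi' b] with [phi'] close to [phi] when [T] is large, so it is controlled by the hypotheses for [phi']. *)
Lemma ray_solution_estimate c d : phimin < c -> c < d -> d < phimax -> forall ep : K, 0 < ep ->
  exists2 a0 : K, a <= a0 & forall phi y, c < phi < d -> ray_solution phi y ->
  forall a' r th, a0 <= a' -> 0 < r -> phi - 3 * pi / 2 < th < phi + pi / 2 ->
  a' < r * `|cos (th - phi)| \/ 0 < sin (phi - th) /\ a' <= r ->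
  forall i, normc (nrm y i (r, th) - e i) <= ep.
Proof.
move=> c1 cd' d1 ep ep0; have pi0 := pi_gt0 K.
have [kappa k0 hseg] := segment_estimate c1 (ltW cd') d1.
have ep2 : 0 < ep / 2 by rewrite divr_gt0.
have [a0 aa0 {}hseg] := hseg _ ep2.
exists a0 => // phi y phiI [hy hlim] a' r th a0a r0 thI cond i.
have a'0 : 0 < a' by exact: lt_le_trans ha (le_trans aa0 a0a).
have cls : {for (0 : K), continuous (@atan K)} by exact: continuous_atan.
have catan (f : K -> K) : continuous f -> {for (0 : K), continuous (fun t => f (atan t))}.
  by move=> cf; apply: (continuous_comp (f := @atan K)); [exact: continuous_atan|exact: cf].
have nearlt (f : K -> K) x : continuous f -> x < f 0 -> \forall t \near (0 : K), x < f (atan t).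
  move=> /catan cf xf; rewrite -atan0 in xf; exact: (cf _ (lt_nbhsr xf)).
have cl (x : K) : continuous (fun dl : K => x + dl).
  by move=> t; apply: cvgD; [exact: cvg_cst|exact: cvg_id].
have clN (x : K) : continuous (fun dl : K => x - dl).
  by move=> t; apply: cvgB; [exact: cvg_cst|exact: cvg_id].
(* Six conditions that survive a rotation of the line by a small angle [atan t]: the direction stays
   in ]c, d[ (1, 2), th stays in its window (3, 4), the cosine exceeds 1/2 (5), and the point stays
   on the curve cut at [a'] (6). The strict inequalities in [cond] serve the last one. *)
have near1 : \forall t \near (0 : K), c < phi + atan t by apply: (nearlt (fun dl => phi + dl)); [exact: cl|lra].
have near2 : \forall t \near (0 : K), - d < - phi - atan t by apply: (nearlt (fun dl => - phi - dl)); [exact: clN|lra].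
have near3 : \forall t \near (0 : K), phi - th - 3 * pi / 2 < 0 - atan t by apply: (nearlt (fun dl => 0 - dl)); [exact: clN|lra].
have near4 : \forall t \near (0 : K), th - phi - pi / 2 < 0 + atan t by apply: (nearlt (fun dl => 0 + dl)); [exact: cl|lra].
have near5 : \forall t \near (0 : K), 2^-1 < cos (atan t).
  by apply: nearlt; [exact: continuous_cos|rewrite cos0; lra].
have near6 : \forall t \near (0 : K), a' <= r * `|cos (th - (phi + atan t))| \/
    0 <= sin (phi + atan t - th) /\ a' <= r.
  case: cond => [h|[h1 h2]].
    have cf : continuous (fun dl : K => r * `|cos (th - phi - dl)|).
      move=> t; apply: cvgM; first exact: cvg_cst.
      apply: cvg_norm; apply: (continuous_comp (f := fun dl => th - phi - dl)).
        exact: clN.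
      exact: continuous_cos.
    have h' : a' < r * `|cos (th - phi - 0)| by rewrite subr0.
    by apply: filterS (nearlt _ _ cf h') => t; rewrite opprD addrA => /ltW; left.
  have cf : continuous (fun dl : K => sin (phi - th + dl)).
    move=> t; apply: (continuous_comp (f := fun dl => phi - th + dl)); first exact: cl.
    exact: continuous_sin.
  have h' : 0 < sin (phi - th + 0) by rewrite addr0.
  by apply: filterS (nearlt _ _ cf h') => t; rewrite addrAC => /ltW; right.
have /nbhs_ballP[rho rho0 hrho] : \forall t \near (0 : K),
  [/\ c < phi + atan t, - d < - phi - atan t, phi - th - 3 * pi / 2 < 0 - atan t,
     th - phi - pi / 2 < 0 + atan t & 2^-1 < cos (atan t)] /\
  (a' <= r * `|cos (th - (phi + atan t))| \/ 0 <= sin (phi + atan t - th) /\ a' <= r).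
  by near=> t; split; [split|]; near: t.
have {}rho0 : 0 < rho by exact: rho0.
clear cls catan nearlt cl clN near1 near2 near3 near4 near5 near6.
(* First [(r, th)] itself lies in [H]: take [t = 0]. *)
have Hz : H (r, th).
  have [[t1 t2 t3 t4 t5] t6] := hrho 0 (ballxx _ rho0).
  rewrite atan0 addr0 in t1 t6.
  by apply: (iotaH (le_trans aa0 a0a)) (iota_polar a'0 r0 thI t6); lra.
have cL0 : 0 < normc (cexp (- prim jo (r, th)) : K[i]) by rewrite normc_cexp expR_gt0.
have [T0 hT0] := hlim _ Hz (ep / 2 / normc (cexp (- prim jo (r, th)) : K[i])) (divr_gt0 ep2 cL0).
(* T >= 2 r makes [den] positive and places the ray point after (r, th); the last entry makes [tau]
   smaller than [rho]. *)
pose T := Num.max (Num.max T0 a) (Num.max (2 * r) (r + 2 * r / rho)).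
have [TT0 Ta Tr Trho] : [/\ T0 <= T, a <= T, 2 * r <= T & r + 2 * r / rho <= T].
  by rewrite /T; split; rewrite !le_max lexx ?orbT.
have cm : `|cos (th - phi)| <= 1 by exact: cos_max.
have sm : `|sin (th - phi)| <= 1 by exact: sin_max.
have T0' : 0 < T by lra.
have rsin : - r <= r * sin (th - phi).
  have := lerNnormlW sm; rewrite -(ler_pM2l r0); lra.
have den : 0 < T + r * sin (th - phi) by lra.
(* The tangent of the rotation after which (r, th) and w T phi lie on one line: [key] says that
   their signed distances b agree in the direction phi + dl. *)
pose tau := - (r * cos (th - phi)) / (T + r * sin (th - phi)).
have taurho : ball (0 : K) rho tau.
  rewrite /ball/= sub0r normrN /tau normrM normfV normrN normrM (gtr0_norm r0) (gtr0_norm den).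
  rewrite ltr_pdivrMr//.
  have h1 : r * `|cos (th - phi)| <= r by rewrite ger_pMr.
  have h2 : rho * (2 * r / rho) <= rho * (T + r * sin (th - phi)) by rewrite ler_wpM2l ?(ltW rho0)//; lra.
  by move: h2; rewrite mulrC divfK ?gt_eqF//; lra.
have [[t1 t2 t3 t4 t5] t6] := hrho _ taurho.
set dl := atan tau in t1 t2 t3 t4 t5 t6.
have cdl : 0 < cos dl by lra.
have key : - (T * sin dl) = r * cos (th - (phi + dl)).
  have h1 : sin dl = tau * cos dl by rewrite -[tau]atanK -/dl /tan divfK// gt_eqF.
  have h2 : tau * (T + r * sin (th - phi)) = - (r * cos (th - phi)).
    by rewrite /tau divfK// gt_eqF.
  rewrite opprD addrA cosB.
  have h3 : tau * (T + r * sin (th - phi)) * cos dl = - (r * cos (th - phi)) * cos dl by rewrite h2.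
  rewrite h1; move: h3; lra.
pose phi' := phi + dl.
have phi'I : c <= phi' <= d by rewrite /phi'; lra.
have thI' : phi' - 3 * pi / 2 < th < phi' + pi / 2 by rewrite /phi'; lra.
pose b := r * cos (th - phi').
pose s := r * sin (phi' - th).
pose t := T * cos dl.
have zE : line phi' b s = (r, th) by exact: line_polar.
have dlI : - (pi / 2) < dl < pi / 2 by rewrite atan_gtNpi2 atan_ltpi2.
have wI : phi' - 3 * pi / 2 < phi - pi / 2 < phi' + pi / 2 by rewrite /phi'; lra.
have wE : line phi' b t = w T phi.
  have := @line_polar K phi' T (phi - pi / 2) T0' wI.
  have -> : phi - pi / 2 - phi' = - (dl + pi / 2) by rewrite /phi'; ring.
  have -> : phi' - (phi - pi / 2) = dl + pi / 2 by rewrite /phi'; ring.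
  rewrite cosN cosDpihalf sinDpihalf mulrN key -/phi' -/b -/t.
  exact.
have st : s <= t.
  have h1 : s <= r by rewrite /s ger_pMr// sin_le1.
  have h2 : 2 * r * 2^-1 <= T * cos dl.
    by apply: ler_pM => //; [rewrite mulr_ge0// ltW|exact: ltW].
  by apply: le_trans h1 (le_trans _ h2); rewrite mulrAC divff// mul1r.
have si' : iota_curve phi' a' b (line phi' b s) by rewrite zE; exact: iota_polar.
have si : iota_curve phi' a b (line phi' b s).
  rewrite zE; apply: iota_polar => //.
  have aa' := le_trans aa0 a0a.
  case: t6 => [h|[h1 h2]]; [left; exact: le_trans aa' h|right; split=> //; exact: le_trans aa' h2].
have phiI' : phimin < phi < phimax by lra.
have [y' [y0 hy']] := sol_exists (fun i => cexp (prim jo (w T phi)) * e i) (HD (w_H phiI' Ta)).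
have ye j : nrm y' j (w T phi) = e j by rewrite /nrm y0 mulrA cexpN_mul mul1r.
have hm j : normc (nrm y' j (line phi' b t)) <= 1 by rewrite wE ye normc_e.
have [_] := hseg a' phi' b s t a0a phi'I st si' si y' 1 (solW hy') hm i.
rewrite zE wE ye mulr1 => /(_ _)/wrap[j jj|h1]; first by rewrite ye /e (negbTE jj).
have h2 := hT0 T TT0 y' (solW hy') ye i.
have h3 : normc (nrm y' i (r, th) - nrm y i (r, th)) <= ep / 2.
  by rewrite /nrm -mulrBr normcM mulrC -ler_pdivlMr.
have := normcB_tri (nrm y i (r, th)) (nrm y' i (r, th)) (e i).
by rewrite (normc_subC (nrm y i (r, th)) (nrm y' i (r, th))); lra.
Unshelve. all: by end_near. Qed.

(** Both solutions are close to e_jo on the ray of phi'. For y this holds because |phi - phi'| < 1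
    <= pi/2 puts that ray after the foot of the perpendicular on the lines of direction phi. *)
Lemma ray_solution_close phi phi' y y' : phimin < phi < phimax -> phimin < phi' < phimax ->
  `|phi - phi'| < 1 -> ray_solution phi y -> ray_solution phi' y' ->
  forall i z, H z -> y i z = y' i z.
Proof.
move=> p1 p2 close hy hy' i z Hz; have pi1 := pihalf_ge1 K; have pi2 := pihalf_lt2 K.
apply/eqP; rewrite -subr_eq0; apply/eqP.
apply: (@ray_unique phi' (fun i z => y i z - y' i z)) => //.
  by apply: solB; apply: solW; [have [] := hy|have [] := hy'].
move=> ep ep0; have ep2 : 0 < ep / 2 by rewrite divr_gt0.
pose c := (phimin + Num.min phi phi') / 2; pose d := (phimax + Num.max phi phi') / 2.
have m1 : phimin < Num.min phi phi' by rewrite lt_min; lra.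
have m2 : Num.max phi phi' < phimax by rewrite gt_max; lra.
have [m3 m4] : Num.min phi phi' <= phi /\ Num.min phi phi' <= phi'.
  by rewrite !ge_min !lexx orbT.
have [m5 m6] : phi <= Num.max phi phi' /\ phi' <= Num.max phi phi'.
  by rewrite !le_max !lexx orbT.
have [||| a0 aa0 est] := @ray_solution_estimate c d _ _ _ _ ep2; [rewrite /c; lra|rewrite /c /d; lra|rewrite /d; lra|].
exists a0 => T a0T j; have T0 : 0 < T by exact: lt_le_trans ha (le_trans aa0 a0T).
move: close; rewrite ltr_norml => close.
have h1 : normc (nrm y j (w T phi') - e j) <= ep / 2.
  apply: (est phi y _ hy T) => //; [rewrite /c /d; lra|lra|right; split=> //].
  have -> : phi - (phi' - pi / 2) = phi - phi' + pi / 2 by ring.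
  by rewrite sinDpihalf; apply: cos_gt0_pihalf; lra.
have h2 : normc (nrm y' j (w T phi') - e j) <= ep / 2.
  apply: (est phi' y' _ hy' T) => //; [rewrite /c /d; lra|lra|right; split=> //].
  have -> : phi' - (phi' - pi / 2) = pi / 2 by ring.
  by rewrite sin_pihalf.
rewrite /nrm mulrBr -/(nrm y j _) -/(nrm y' j _).
have := normcB_tri (nrm y j (w T phi')) (e j) (nrm y' j (w T phi')).
by rewrite (normc_subC (e j)); lra.
Qed.

Lemma ray_solution_all phi phi' y : phimin < phi < phimax -> phimin < phi' < phimax ->
  ray_solution phi y -> ray_solution phi' y.
Proof.
move=> p1 p2 hy.
have step k : forall psi y', phimin < psi < phimax -> `|phi - psi| < k.+1%:R ->
    ray_solution psi y' -> forall i z, H z -> y i z = y' i z.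
  elim: k => [|k IH] psi y' psiI close hy'; first exact: ray_solution_close close hy hy'.
  (* The last of k + 2 equal steps from phi to psi: it is shorter than 1, and the remaining distance
     is less than k + 1. *)
  pose mid := psi + (phi - psi) / k.+2%:R.
  have k2 : 0 < k.+2%:R :> K by [].
  have q0 : 0 < k.+2%:R^-1 :> K by rewrite invr_gt0.
  have q1 : k.+2%:R^-1 <= 1 :> K by rewrite invf_le1// ler1n.
  have midI : phimin < mid < phimax.
    have -> : mid = psi * (1 - k.+2%:R^-1) + phi * k.+2%:R^-1 by rewrite /mid; ring.
    have h1 (q lo u v : K) : 0 < q -> q <= 1 -> lo < u -> lo < v -> lo < u * (1 - q) + v * q.
      move=> q0' q1' lu lv.
      have t1 : lo * (1 - q) <= u * (1 - q) by rewrite ler_wpM2r ?subr_ge0// ltW.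
      have t2 : lo * q < v * q by rewrite ltr_pM2r.
      lra.
    have [/andP[u1 u2] /andP[v1 v2]] := (psiI, p1).
    apply/andP; split; first exact: h1.
    by rewrite -ltrN2 opprD -!mulNr; apply: h1; rewrite ?ltrN2.
  have [ym hym] := ray_solution_exists midI.
  have d1 : `|phi - mid| < k.+1%:R.
    have -> : phi - mid = (phi - psi) * (k.+1%:R / k.+2%:R).
      rewrite /mid; have -> : k.+1%:R = k.+2%:R - 1 :> K by rewrite [k.+2%:R]mulrSr addrK.
      by field; rewrite gt_eqF.
    rewrite normrM (@ger0_norm _ (_ / _)) ?divr_ge0// mulrA ltr_pdivrMr// mulrC.
    by rewrite ltr_pM2l.
  have d2 : `|mid - psi| < 1.
    by rewrite /mid addrC addKr normrM (gtr0_norm q0) ltr_pdivrMr// mul1r.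
  move=> i z Hz; rewrite (IH mid ym midI d1 hym i z Hz).
  exact: (ray_solution_close midI psiI d2 hym hy').
have [y' hy'] := ray_solution_exists p2.
have E i z : H z -> y i z = y' i z.
  apply: (step (Num.bound `|phi - phi'|) phi') => //.
  by apply: lt_le_trans (archi_boundP (normr_ge0 _)) _; rewrite ler_nat.
split; first by have [] := hy.
move=> z Hz ep ep0; have [_ h] := hy'; have [T0 hT0] := h z Hz ep ep0.
by exists T0 => T TT y'' hy'' ye i; rewrite (E i z Hz); exact: (hT0 T TT y'' hy'' ye).
Qed.

(** Directions between [phim] and [phip] suffice, where phim < c + pi and d < phip.
    [ray_solution_estimate] is uniform over this compact range, and y is the limit for each of its
    directions. *)
Lemma ray_solution_vanishes y (c d : K) : phimin < phimax -> (forall phi, phimin < phi < phimax -> ray_solution phi y) ->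
  phimin - pi < c -> c <= d -> d < phimax -> forall ep : K, 0 < ep ->
  exists M : K, forall z, Hunion `[c, d] a z -> M < z.1 -> forall i, normc (nrm y i z - e i) <= ep.
Proof.
move=> pq hy c1 cd' d1 ep ep0; have pi0 := pi_gt0 K; have pi1 := pihalf_ge1 K.
pose phim := (phimin + Num.min phimax (c + pi)) / 2.
pose phip := (phimax + Num.max d phim) / 2.
have [phim1 phim2 phim3] : [/\ phimin < phim, phim < phimax & phim < c + pi].
  have m1 : phimin < Num.min phimax (c + pi) by rewrite lt_min; lra.
  have m2 : Num.min phimax (c + pi) <= phimax by rewrite ge_min lexx.
  have m3 : Num.min phimax (c + pi) <= c + pi by rewrite ge_min lexx orbT.
  by rewrite /phim; split; lra.
have [phip1 phip2 phip3] : [/\ d < phip, phim < phip & phip < phimax].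
  have m1 : Num.max d phim < phimax by rewrite gt_max; lra.
  have m2 : d <= Num.max d phim by rewrite le_max lexx.
  have m3 : phim <= Num.max d phim by rewrite le_max lexx orbT.
  by rewrite /phip; split; lra.
clearbody phim phip.
(* In the sector over [c, d], th exceeds [phip] by at most [xp] and falls short of phim - pi by at
   most [xm]. Both are less than pi/2, so the cosines stay above a positive constant; the half in
   [kap] makes this strict. *)
pose xp := Num.max 0 (d + pi / 2 - phip); pose xm := Num.max 0 (phim - pi / 2 - c).
have [xp1 xp2 xp3] : [/\ 0 <= xp, d + pi / 2 - phip <= xp & xp < pi / 2].
  by rewrite /xp; split; rewrite ?le_max ?lexx ?orbT// gt_max; lra.
have [xm1 xm2 xm3] : [/\ 0 <= xm, phim - pi / 2 - c <= xm & xm < pi / 2].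
  by rewrite /xm; split; rewrite ?le_max ?lexx ?orbT// gt_max; lra.
pose kap := Num.min (cos xp) (cos xm) / 2.
have [kap0 kap1 kapp kapm] : [/\ 0 < kap, kap <= 1, kap < cos xp & kap < cos xm].
  have p0 : 0 < cos xp by apply: cos_gt0_pihalf; lra.
  have p1 : 0 < cos xm by apply: cos_gt0_pihalf; lra.
  have m1 : 0 < Num.min (cos xp) (cos xm) by rewrite lt_min p0.
  have m2 : Num.min (cos xp) (cos xm) <= cos xp by rewrite ge_min lexx.
  have m3 : Num.min (cos xp) (cos xm) <= cos xm by rewrite ge_min lexx orbT.
  have := cos_le1 xp.
  by rewrite /kap; split; lra.
clearbody kap xp xm.
have [||| a0 aa0 est] := @ray_solution_estimate ((phimin + phim) / 2) ((phimax + phip) / 2) _ _ _ _ ep0; try lra.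
(* Chosen so that the radius r kap at which the curves are cut is at least [a0]. *)
exists (a0 / kap) => -[r th] [psi]; rewrite /= in_itv/= => psiI [/= thI _].
rewrite ltr_pdivrMr// => Mr i.
have a00 : 0 < a0 by exact: lt_le_trans ha aa0.
have r0 : 0 < r by rewrite -(pmulr_lgt0 _ kap0); exact: lt_trans Mr.
have rk : r * kap <= r by rewrite ger_pMr.
have key phi : phim <= phi <= phip -> phi - 3 * pi / 2 < th < phi + pi / 2 ->
    r * kap < r * `|cos (th - phi)| \/ 0 < sin (phi - th) -> normc (nrm y i (r, th) - e i) <= ep.
  move=> phiI thI' h; apply: (est phi y _ _ (r * kap)) => //.
  - lra.
  - by apply: hy; lra.
  - exact: ltW.
  - by case: h => h; [left|right].
have cos_large (x x0 : K) : 0 <= x -> x <= x0 -> x0 < pi / 2 -> kap < cos x0 -> kap < cos x.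
  move=> x1 x2 x3 kx; apply: lt_le_trans kx _; rewrite leNgt.
  by rewrite ltr_cos ?in_itv /= -?leNgt //; lra.
(* For extreme angles, from [phip] upwards or from phim - pi downwards, the line of the extreme
   direction is at distance more than r kap from the origin. For the angles in between, a direction
   is available for which the point lies after the foot of the perpendicular. *)
have [th1|th1] := ltP th phip; last first.
  apply: (key phip) => //; [lra|lra|left].
  rewrite ltr_pM2l// (lt_le_trans _ (ler_norm _))//.
  by apply: (cos_large _ xp); lra.
have [th2|th2] := ltP th phim; last first.
  pose phi := Num.min phip (th + 1).
  have [q1 q2 q3 q4] : [/\ phim <= phi, phi <= phip, th < phi & phi <= th + 1].
    by rewrite /phi; split; rewrite ?lt_min ?le_min ?ge_min ?lexx ?orbT//; lra.
  clearbody phi.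
  apply: (key phi) => //; [lra|lra|right].
  by apply: sin_gt0_pi; lra.
have [th3|th3] := ltP (phim - pi) th.
  apply: (key phim) => //; [lra|lra|right].
  by apply: sin_gt0_pi; lra.
apply: (key phim) => //; [lra|lra|left].
rewrite ltr_pM2l// -normrN (lt_le_trans _ (ler_norm _))//.
rewrite -cosDpi.
have -> : cos (th - phim + pi) = cos (phim - pi - th).
  by rewrite -cosN; congr cos; ring.
by apply: (cos_large _ xm); lra.
Qed.

End Levinson.

(** * Existence, asymptotics and uniqueness for the matrix equation *)

Lemma holomorphic_cd (K : realType) m n (a p q : K) (f : ucover K -> 'M[K[i]]_(m, n)) :
  holomorphic_on (Hunion `]p, q[%classic a) f -> exists2 U : set (ucover K),
   [/\ open U, Hunion `]p, q[%classic a `<=` U & U `<=` [set z | 0 < z.1]] &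
   forall z, U z -> forall i j, exists d, cd (fun w => f w i j) z d.
Proof.
move=> [U [oU HU U0 h]]; exists U; first by split.
move=> z Uz i j; have [d /(is_cderive_cd _ _ (U0 z Uz)) hd] := h z Uz.
by exists (d i j); exact: hd.
Qed.

Theorem theorem2p13 (K : realType) (n : nat) (hn : (1 <= n)%N)
    (a phimin phimax : K) (ha : 0 < a) (hI : phimin < phimax)
    (N : 'M[K[i]]_n -> K) (hN : is_norm N)
    (Lambda R : ucover K -> 'M[K[i]]_n) (jo : 'I_n) :
  let I := `]phimin, phimax[%classic in
  let It := `]phimin - pi, phimax[%classic in
  let H := Hunion It a in
  holomorphic_on H Lambda -> (forall z, H z -> is_diag_mx (Lambda z)) ->
  holomorphic_on H R ->
  subdominant I a Lambda jo ->
  S_decay N I a R ->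
  forall z0, H z0 ->
  let P (y : ucover K -> 'cV[K[i]]_n) :=
    [/\ holomorphic_on H y,
        solution_on H (fun z => Lambda z + R z) y
      & has_asymptotics It a z0 (fun z => Lambda z jo jo) (delta_mx jo 0) y] in
  exists y, P y /\ (forall y', P y' -> forall z, H z -> y' z = y z).
Proof.
move=> I It H holL diag holR subdom decay z0 Hz0 P; have pi0 := pi_gt0 K.
have [UL [oL HL L0] hL] := holomorphic_cd holL.
have [UR [oR HR R0] hR] := holomorphic_cd holR.
have ppq : phimin - pi < phimax by have : phimin < phimax := hI; lra.
(* One domain for both coefficients, whose open sets of holomorphy may differ. *)
have [D [rD HD DU]] : exists D, [/\ right_domain D, H `<=` D & D `<=` UL `&` UR].
  apply: right_domain_exists => //; first exact: openI.
  - by move=> z Hz; split; [exact: HL|exact: HR].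
  - by move=> z [/L0].
have Dpos z : D z -> 0 < z.1 by move=> /DU[/L0].
have dL i j z : D z -> exists d, cd (fun w => Lambda w i j) z d.
  by move=> /DU[/hL + _]; exact.
have dR i j z : D z -> exists d, cd (fun w => R w i j) z d.
  by move=> /DU[_ /hR +]; exact.
(* Primitives vanishing at z0, so that the integral in the asymptotics is the value of [prim jo]. *)
have /choice[prim hprim'] (i : 'I_n) :
    exists F, F z0 = 0 /\ forall z, D z -> cd F z (Lambda z i i).
  by apply: (primitive_exists rD (HD _ Hz0)); apply: cd_closed_form => z; exact: dL.
have hprim i z : D z -> cd (prim i) z (Lambda z i i) by move=> Dz; exact: (hprim' i).2.
have intE z g : C1_path H z0 z g -> path_int (fun z => Lambda z jo jo) g 0 1 = prim jo z.
  move=> hg; have [_ g0 g1 Dg] := hg.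
  rewrite (@path_int_primitive K _ (prim jo)) ?ler01//; last first.
    move=> x xI; have [cg dg] := C1_path_derive hg x; have Dx := HD _ (Dg x xI).
    split=> //; [exact: C1_path_velocity hg|exact: hprim|].
    by have [? /cd_ccont] := dL jo jo _ Dx.
  by rewrite g0 g1 (hprim' jo).1 subr0.
have solE S (y : ucover K -> 'cV[K[i]]_n) : S `<=` D ->
    solution_on S (fun z => Lambda z + R z) y <-> sol Lambda R S (fun i z => y z i 0).
  move=> SD; split=> h.
    move=> i z Sz; have := (is_cderive_cd _ _ (Dpos z (SD z Sz))).1 (h z Sz) i 0.
    rewrite mxE => hc; apply: cd_eq hc _.
    by apply: eq_bigr => j _; rewrite mxE.
  move=> z Sz; apply: (is_cderive_cd _ _ (Dpos z (SD z Sz))).2 => i j.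
  rewrite ord1; apply: cd_eq (h i z Sz) _.
  by rewrite mxE; apply: eq_bigr => k _; rewrite mxE.
pose phi0 := (phimin + phimax) / 2.
have phi0I : phimin < phi0 < phimax by have : phimin < phimax := hI; rewrite /phi0; lra.
have [y hy] := ray_solution_exists ha hN rD HD dL dR diag subdom decay hprim phi0I.
have hyall phi : phimin < phi < phimax -> ray_solution a phimin phimax Lambda R jo D prim phi y.
  by move=> phiI; exact: (ray_solution_all ha hN rD HD dL dR diag subdom decay hprim phi0I phiI hy).
have [soly _] := hy.
pose Y z : 'cV[K[i]]_n := \col_i y i z.
have solY : sol Lambda R D (fun i z => Y z i 0).
  move=> i z Dz; apply: cd_eq; last first.
    by under eq_bigr do rewrite mxE.
  by under eq_fun do rewrite mxE; exact: soly.
have solYD := (solE D Y (fun _ h => h)).2 solY.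
exists Y; split.
  split.
  - exists D; split=> //; first exact: rd_open.
    by move=> z Dz; exists ((Lambda z + R z) *m Y z); exact: solYD.
  - by move=> z Hz; exact: solYD (HD _ Hz).
  - exists (fun z => \col_i nrm jo prim y i z - delta_mx jo 0); split.
      move=> c d cd' cdI ep ep0.
      have [c1 d1] : phimin - pi < c /\ d < phimax.
        have h1 : It c by apply: cdI; rewrite /= in_itv/= lexx.
        have h2 : It d by apply: cdI; rewrite /= in_itv/= lexx cd'.
        by move: h1 h2; rewrite /It/= !in_itv/= => /andP[-> _] /andP[_ ->].
      have ep2 : 0 < ep / 2 by rewrite divr_gt0.
      have [M hM] := ray_solution_vanishes ha hN rD HD dL dR diag subdom decay hprim hI hyall c1 cd' d1 ep2.
      exists M => z Hz Mz k; rewrite !mxE eqxx andbT.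
      suff hk : (normc (nrm jo prim y k z - (k == jo)%:R))%:C < ep%:C by exact: hk.
      by rewrite ltcR (le_lt_trans (hM z Hz Mz k))// ltr_pdivrMr// ltr_pMr// ltr1n.
    move=> z g hg; rewrite (intE z g hg) addrC subrK.
    by apply/matrixP => i j; rewrite !mxE -nrmK.
move=> Y' [_ solY' [u' [van' eqY']]] z Hz.
(* The asymptotics of [Y'] are stated along paths, so a path from z0 to each point is supplied
   here. *)
have nrmY' z' i : H z' -> nrm jo prim (fun i z => Y' z i 0) i z' = (i == jo)%:R + u' z' i 0.
  move=> Hz'; have [g hg] := C1_path_exists Hz0 Hz'.
  rewrite /nrm (eqY' z' g hg) (intE z' g hg) !mxE eqxx andbT.
  by rewrite mulrA cexpN_mul mul1r.
(* The closed interval reduced to the angle phi0 - pi/2 already contains the ray on which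
   [ray_unique] is applied. *)
have Hw T : a <= T -> Hunion `[phi0 - pi / 2, phi0 - pi / 2] a (T, phi0 - pi / 2).
  move=> aT; exists (phi0 - pi / 2); first by rewrite /= in_itv/= lexx.
  by split=> /=; [lra|rewrite subrr cos0 divr1].
have solH : sol Lambda R H (fun i z => y i z - Y' z i 0).
  apply: solB; first by move=> i z' /HD; exact: soly.
  by apply/(solE H Y' HD).
apply/matrixP => i j; rewrite ord1 mxE; apply/esym/eqP; rewrite -subr_eq0; apply/eqP.
apply: (ray_unique ha hN HD dL dR diag subdom decay hprim phi0I solH) => // ep ep0.
have ep2 : 0 < ep / 2 by rewrite divr_gt0.
have ltI : phimin - pi < phi0 - pi / 2 < phimax by lra.
have subI' : `[phi0 - pi / 2, phi0 - pi / 2]%classic `<=` It.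
  by move=> x; rewrite /It /= !in_itv/= => xE; lra.
have [M1 hM1] := van' _ _ (lexx _) subI' _ ep2.
have [M2 hM2] := ray_solution_vanishes ha hN rD HD dL dR diag subdom decay hprim hI hyall
  (proj1 (andP ltI)) (lexx _) (proj2 (andP ltI)) ep2.
exists (Num.max a (Num.max M1 M2 + 1)) => T; rewrite ge_max => /andP[aT MT] k.
have [T1 T2] : M1 < T /\ M2 < T.
  have : M1 <= Num.max M1 M2 by rewrite le_max lexx.
  have : M2 <= Num.max M1 M2 by rewrite le_max lexx orbT.
  by lra.
have h1 : (normc (u' (T, phi0 - pi / 2) k 0))%:C < (ep / 2)%:C := hM1 _ (Hw T aT) T1 k.
rewrite ltcR in h1; have h2 := hM2 _ (Hw T aT) T2 k.
have HT : H (T, phi0 - pi / 2).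
  by have [psi psiI hs] := Hw T aT; exists psi => //; exact: subI'.
have -> : nrm jo prim (fun i z => y i z - Y' z i 0) k (T, phi0 - pi / 2) =
   (nrm jo prim y k (T, phi0 - pi / 2) - (k == jo)%:R) - u' (T, phi0 - pi / 2) k 0.
  by rewrite -addrA -opprD -nrmY'// /nrm mulrBr.
by have := normcB (nrm jo prim y k (T, phi0 - pi / 2) - (k == jo)%:R) (u' (T, phi0 - pi / 2) k 0); lra.
Qed.
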